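(* Let $k \geq 2$ be an integer and $p_k := 2^k/(k+1)$. Then: (1) (Extremisers) For every ergodic system $X=(X,\mathcal{X},\mu,T)$ and every $f \in L^{p_k}(X)$ with $\|f\|_{L^{p_k}(X)} \leq 1$, one has $\|f\|_{U^k(X)}=1$ if and only if $f = \mu(H)^{-1/p_k}1_H e(P)$ almost everywhere for some coset $H$ of $X$ and some polynomial $P: H \to \mathbf{R}/\mathbf{Z}$ of degree $\leq k-1$. (2) (Near-extremisers) There is a function $c_k:[0,\infty)\to[0,\infty)$ depending only on $k$ with $c_k(\varepsilon)\to0$ as $\varepsilon\to0$ such that for every ergodic system $X$, every $f\in L^{p_k}(X)$ with $\|f\|_{L^{p_k}(X)}\le 1$ and every $\varepsilon \ge 0$: if $\|f\|_{U^k(X)} \geq 1-\varepsilon$, then there exist a coset $H$ of $X$ and a polynomial $P: H \to \mathbf{R}/\mathbf{Z}$ of degree $\leq k-1$ with $\|f - \mu(H)^{-1/p_k}1_H e(P)\|_{L^{p_k}(X)} \leq c_k(\varepsilon)$.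
   Context: An ergodic system $(X,\mathcal{X},\mu,T)$ is a probability space with an invertible bimeasurable measure-preserving map $T$ whose invariant $L^2$ functions are constant a.e. $T^h f := f\circ T^{-h}$. Gowers–Host–Kra seminorms: $\|f\|_{U^1(X)} := |\int_X f\,d\mu|$, $\|f\|_{U^{k+1}(X)} := \lim_{H\to\infty}\left(\frac1H\sum_{h=1}^H \|(T^hf)\overline f\|_{U^k(X)}^{2^k}\right)^{1/2^{k+1}}$ for $f \in L^\infty(X)$; one has $\|f\|_{U^k(X)}\le\|f\|_{L^{p_k}(X)}$ and the seminorm is extended to $L^{p_k}(X)$ by continuity. A coset in $X$ is a measurable set $H$ such that for some integer $m\ge1$ (the index), $T^mH = H$ up to null sets and $H, TH,\dots,T^{m-1}H$ partition $X$ up to null sets (so $\mu(H)=1/m$). Its normalisation is the ergodic system $(H, \mathcal{X}|_H, \mu(H)^{-1}\mu|_H, T^m)$. A measurable $P: H \to \mathbf{R}/\mathbf{Z}$ is a polynomial of degree $\le d$ if, in this normalisation, $\Delta_{h_1}\cdots\Delta_{h_{d+1}}P = 0$ a.e. for all $h_i \in \mathbf{Z}$, where $\Delta_h := (T^m)^h - 1$. $e(x) := e^{2\pi i x}$. *)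

(* Defs.v *)
From HB Require Import structures.
From mathcomp Require Import all_boot all_order all_algebra.
From mathcomp Require Import all_classical all_reals all_analysis.
From mathcomp.real_closed Require Import complex.

Set Implicit Arguments.
Unset Strict Implicit.
Unset Printing Implicit Defensive.

Import Order.TTheory GRing.Theory Num.Theory.
Import numFieldNormedType.Exports.

Local Open Scope classical_set_scope.
Local Open Scope ring_scope.

Section GHK.
Context {d : measure_display} {X : measurableType d} {R : realType}.

Definition cR (a : R) : R[i] := Complex a 0.
Definition cmod (z : R[i]) : R := Num.sqrt (complex.Re z ^+ 2 + complex.Im z ^+ 2).
Definition expe (t : R) : R[i] :=
  Complex (cos (2 * pi * t)) (sin (2 * pi * t)).

Definition cmeasurable (f : X -> R[i]) : Prop :=
  measurable_fun setT (fun x => complex.Re (f x)) /\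
  measurable_fun setT (fun x => complex.Im (f x)).

Definition cint (mu : {measure set X -> \bar R}) (f : X -> R[i]) : R[i] :=
  Complex (Rintegral mu setT (fun x => complex.Re (f x)))
          (Rintegral mu setT (fun x => complex.Im (f x))).

Definition cLnorm (mu : {measure set X -> \bar R}) (p : R) (f : X -> R[i])
  : \bar R := Lnorm mu p%:E (fun x => (cmod (f x))%:E).

Definition inLp (mu : {measure set X -> \bar R}) (p : R) (f : X -> R[i])
  : Prop := cmeasurable f /\ (cLnorm mu p f < +oo)%E.

Definition ergodic_system (mu : probability X R) (T Tinv : X -> X) : Prop :=
  [/\ measurable_fun setT T, measurable_fun setT Tinv,
      cancel T Tinv /\ cancel Tinv T,
      (forall A, measurable A -> mu (T @^-1` A) = mu A) &
      (* invariant L^2 functions are constant a.e.;  T g := g o T^{-1} *)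
      (forall g : X -> R[i], cmeasurable g ->
         (\int[mu]_x ((cmod (g x)) ^+ 2)%:E < +oo)%E ->
         {ae mu, forall x, g (Tinv x) = g x} ->
         exists c : R[i], {ae mu, forall x, g x = c})].

Definition Tz (T Tinv : X -> X) (n : int) : X -> X :=
  match n with
  | Posz k => iter k T
  | Negz k => iter k.+1 Tinv
  end.

Definition shiftf (T Tinv : X -> X) (h : int) (f : X -> R[i]) : X -> R[i] :=
  fun x => f (Tz T Tinv (- h) x).

(** Gowers-Host-Kra seminorms on L^infty:
    ghk_inf n f = ||f||_{U^(n+1)(X)} *)
Fixpoint ghk_inf (mu : {measure set X -> \bar R}) (T Tinv : X -> X)
    (n : nat) (f : X -> R[i]) : R :=
  match n with
  | 0 => cmod (cint mu f)
  | n'.+1 =>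
      powR (limn (fun H : nat => H%:R^-1 *
          \sum_(1 <= h < H.+1)
             (ghk_inf mu T Tinv n'
                (fun x => shiftf T Tinv h%:Z f x * conjc (f x))) ^+ (2 ^ n)))
           (1 / (2 ^ n.+1)%:R)
  end.

Definition trunc (n : nat) (f : X -> R[i]) : X -> R[i] :=
  fun x => if cmod (f x) <= n%:R then f x else 0.

(** ||f||_{U^k(X)} for f in L^{p_k}, extended by continuity from L^infty:
    the limit of the seminorms of the truncations of f *)
Definition ghk (mu : {measure set X -> \bar R}) (T Tinv : X -> X)
    (k : nat) (f : X -> R[i]) : R :=
  limn (fun n : nat => ghk_inf mu T Tinv k.-1 (trunc n f)).

(** T^j A (image of A under T^j) *)
Definition Tset (Tinv : X -> X) (j : nat) (A : set X) : set X :=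
  iter j Tinv @^-1` A.

Definition is_coset (mu : {measure set X -> \bar R}) (Tinv : X -> X)
    (H : set X) (m : nat) : Prop :=
  [/\ measurable H, (0 < m)%N,
      mu ((Tset Tinv m H `\` H) `|` (H `\` Tset Tinv m H)) = 0%E,
      (forall i j : nat, (i < j < m)%N ->
          mu (Tset Tinv i H `&` Tset Tinv j H) = 0%E) &
      mu (~` \big[setU/set0]_(i < m) Tset Tinv i H) = 0%E].

(** iterated differences Delta_{h_1} ... Delta_{h_r} P in the normalisation
    (H, T^m):  Delta_h Q = Q o (T^m)^{-h} - Q *)
Fixpoint idiff (T Tinv : X -> X) (m : nat) (hs : seq int) (P : X -> R)
    : X -> R :=
  match hs with
  | [::] => P
  | h :: hs' => fun x =>
      idiff T Tinv m hs' P (Tz T Tinv (- (m%:Z * h)) x)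
      - idiff T Tinv m hs' P x
  end.

(** P : H -> R/Z (represented by a real-valued lift) is a polynomial of
    degree <= deg on the coset H of index m *)
Definition is_poly (mu : {measure set X -> \bar R}) (T Tinv : X -> X)
    (H : set X) (m deg : nat) (P : X -> R) : Prop :=
  measurable_fun H P /\
  forall hs : seq int, size hs = deg.+1 ->
    {ae mu, forall x, H x -> exists z : int, idiff T Tinv m hs P x = z%:~R}.

Definition coset_poly_fun (mu : {measure set X -> \bar R}) (p : R)
    (H : set X) (P : X -> R) : X -> R[i] :=
  fun x => cR (powR (fine (mu H)) (- p^-1)) * cR (\1_H x) * expe (P x).

End GHK.

Definition pk {R : realType} (k : nat) : R := (2 ^ k)%:R / (k.+1)%:R.

(* Main.v *)
From HB Require Import structures.
From mathcomp Require Import all_boot all_order all_algebra.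
From mathcomp Require Import all_classical all_reals all_analysis.
From mathcomp Require Import measurable_realfun.
From mathcomp Require Import ring lra zify.
From mathcomp.real_closed Require Import complex.
Require Import Defs.
Set Implicit Arguments.
Unset Strict Implicit.
Unset Printing Implicit Defensive.
Import Order.TTheory GRing.Theory Num.Theory.
Import numFieldNormedType.Exports.
Local Open Scope classical_set_scope.
Local Open Scope ring_scope.

(** Write [p] for [p_(n+2)], [Delta_h f := (T^h f) (conj f)] and [w := |f|^p]. Hoelder's
    inequality bounds [(int |Delta_h f|^(p_(n+1)))^(n+2)] by the correlation [int (T^h w) w]
    when [int w <= 1], and by the mean ergodic theorem these correlations average to
    [(int w)^2], so induction on [n] gives [||f||_(U^(n+2)) <= ||f||_p].

    If this is nearly an equality, then Hoelder is nearly sharp for many [h], so the product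
    [w (T^h w)] is nearly constant where it lives and [w] is nearly constant on its support.
    The distances [D h := int |T^h w - w|] then have a gap: [D h <= 4 eta] forces
    [D h <= 2 eta], so the [h] with small [D h] are the multiples of some [m], and [w] is
    close to [m 1_H] for a coset [H] of index [m]. For most [j], the rescaled function
    [Delta_(mj) f] is then a near-extremiser one degree lower, so by induction its phase is
    close to a phase polynomial on [H]; as every integer is a difference of two good [j], all multiplicative derivatives
    of the phase [u] of [f] are close to phase polynomials of lower degree.

    Such a [u] is close to a phase polynomial: nonconstant phase polynomials are far from
    constants, so [u] is an approximate eigenfunction of a twisted shift [g |-> lam q (T g)],
    with [lam] found by correcting an almost homomorphism to the circle. The element of
    minimal norm in the convex hull of the twisted orbit of [u] is an exact fixed point near
    [u], and its phase is the required polynomial.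

    All bounds are uniform in the system, which gives the near-extremisers, first for bounded
    functions and then in [L^p] by truncation. An exact extremiser is an almost everywhere
    limit of functions [m_i^(1/p) 1_(H_i) e(P_i)]; the indices [m_i] are eventually constant,
    and the identities defining cosets and polynomials pass to the limit. *)

(** * Expectations of bounded functions *)

(** A limit that does not exist is 0 by convention. Upper bounds on the seminorms are then trivial,
    and a seminorm close to 1 is a genuine limit, so that its averages are eventually almost as
    large. The exponents enter through p_(n+1) / p_(n+2) = (1 + 1/(n+2)) / 2. With t =
    |f|^(p_(n+2)/4) and int |f|^(p_(n+2)) <= 1, this ratio bounds the (n+2)-th power of int |Delta_h
    f|^(p_(n+1)) by (int (t T^h t)^3)^2, whatever n is. The coset is therefore found by one argument
    about t, and only the phases need induction on the degree. The obstacle for the phases is that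
    composing approximate derivatives adds up their errors. Rigidity of phase polynomials resets the
    error after each step, at the price of an unknown constant of modulus 1; these constants form
    the almost homomorphism. *)

Section BoundedFunctions.
Context {d : measure_display} {X : measurableType d} {R : realType}.
Implicit Types f g : X -> R.

Definition bm f : Prop :=
  measurable_fun setT f /\ exists M, forall x, `|f x| <= M.

Lemma bm_cst (c : R) : bm (fun=> c).
Proof. by split; [exact: measurable_cst | exists `|c|]. Qed.

Lemma bmD f g : bm f -> bm g -> bm (fun x => f x + g x).
Proof.
move=> [mf [M fM]] [mg [N gN]]; split; first exact: measurable_funD.
by exists (M + N) => x; rewrite (le_trans (ler_normD _ _))// lerD.
Qed.

Lemma bmN f : bm f -> bm (fun x => - f x).
Proof.
move=> [mf [M fM]]; split; first exact: measurableT_comp.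
by exists M => x; rewrite normrN.
Qed.

Lemma bmB f g : bm f -> bm g -> bm (fun x => f x - g x).
Proof. by move=> bf bg; apply: bmD => //; exact: bmN. Qed.

Lemma bmM f g : bm f -> bm g -> bm (fun x => f x * g x).
Proof.
move=> [mf [M fM]] [mg [N gN]]; split; first exact: measurable_funM.
by exists (M * N) => x; rewrite normrM ler_pM.
Qed.

Lemma bmX f n : bm f -> bm (fun x => f x ^+ n).
Proof.
move=> bf; elim: n => [|n IH]; first exact: bm_cst.
have -> : (fun x => f x ^+ n.+1) = (fun x => f x * f x ^+ n).
  by apply/funext => x; rewrite exprS.
exact: bmM.
Qed.

Lemma bm_norm f : bm f -> bm (fun x => `|f x|).
Proof.
move=> [mf [M fM]]; split; first exact: measurableT_comp.
by exists M => x; rewrite normr_id.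
Qed.

Lemma bm_indic A : measurable A -> bm (\1_A : X -> R).
Proof.
move=> mA; split; first exact: measurable_indic.
by exists 1 => x; rewrite indicE; case: (x \in A); rewrite ?normr1 ?normr0.
Qed.

Lemma bm_powR f (p : R) : 0 <= p -> bm f -> (forall x, 0 <= f x) ->
  bm (fun x => f x `^ p).
Proof.
move=> p0 [mf [M fM]] f0; split; first exact: (measurableT_comp (measurable_powR p) mf).
exists (M `^ p) => x; rewrite ger0_norm ?powR_ge0// ge0_ler_powR//.
- by rewrite nnegrE.
- by rewrite nnegrE (le_trans (normr_ge0 _) (fM x)).
- by rewrite (le_trans (ler_norm _)).
Qed.

Lemma bm_sqrt f : bm f -> bm (fun x => Num.sqrt (f x)).
Proof.
move=> [mf [M fM]]; split.
  exact: (measurableT_comp (continuous_measurable_fun (@sqrt_continuous R)) mf).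
exists (Num.sqrt M) => x; rewrite ger0_norm ?sqrtr_ge0// ler_wsqrtr//.
by rewrite (le_trans (ler_norm _)).
Qed.

Lemma bm_min f g : bm f -> bm g -> bm (fun x => Num.min (f x) (g x)).
Proof.
move=> [mf [M fM]] [mg [N gN]]; split; first exact: (measurable_minr mf mg).
exists (Num.max M N) => x; rewrite /Num.min; case: ifP => _.
- by rewrite le_max fM.
- by rewrite le_max gN orbT.
Qed.

Lemma bm_sum (I : Type) (r : seq I) (P : pred I) (F : I -> X -> R) :
  (forall i, bm (F i)) -> bm (fun x => \sum_(i <- r | P i) F i x).
Proof.
move=> bF; elim: r => [|i r IH].
  by under eq_fun do rewrite big_nil; exact: bm_cst.
under eq_fun do rewrite big_cons.
by case: (P i) => //; exact: bmD.
Qed.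

Lemma bm_comp f (g : X -> X) : measurable_fun setT g -> bm f ->
  bm (fun x => f (g x)).
Proof.
move=> mg [mf [M fM]]; split; first exact: (measurableT_comp mf mg).
by exists M => x.
Qed.

End BoundedFunctions.

Ltac bmt :=
  repeat first
  [ assumption
  | match goal with
    | |- bm (fun x => ?c) => exact: (bm_cst c)
    | |- bm (fun x => _ - _) => apply: bmB
    | |- bm (fun x => _ + _) => apply: bmD
    | |- bm (fun x => - _) => apply: bmN
    | |- bm (fun x => _ * _) => apply: bmM
    | |- bm (fun x => _ ^+ _) => apply: bmX
    | |- bm (fun x => `|_|) => apply: bm_norm
    | |- bm (fun x => Num.sqrt _) => apply: bm_sqrt
    | |- bm (fun x => Num.min _ _) => apply: bm_min
    | |- bm (fun x => \1_?A x) => apply: (bm_indic (A := A))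
    end ].

Section Expectation.
Context {d : measure_display} {X : measurableType d} {R : realType}.
Variable mu : probability X R.
Implicit Types f g : X -> R.

Definition Ex f : R := Rintegral mu setT f.

Lemma bm_integrable f : bm f -> mu.-integrable setT (EFin \o f).
Proof.
move=> [mf [M fM]]; apply: measurable_bounded_integrable => //.
- exact: fin_num_fun_lty.
- by exists M; split; [exact: num_real | move=> y My x _; exact: le_trans (fM x) (ltW My)].
Qed.

Lemma Ex_cst c : Ex (fun=> c) = c.
Proof.
rewrite /Ex Rintegral_cst//; transitivity (c * 1); last by rewrite mulr1.
by congr (_ * _); exact: (congr1 fine (probability_setT mu)).
Qed.

Lemma ExD f g : bm f -> bm g -> Ex (fun x => f x + g x) = Ex f + Ex g.
Proof. by move=> *; apply: RintegralD => //; exact: bm_integrable. Qed.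

Lemma ExB f g : bm f -> bm g -> Ex (fun x => f x - g x) = Ex f - Ex g.
Proof. by move=> *; apply: RintegralB => //; exact: bm_integrable. Qed.

Lemma ExZ c f : bm f -> Ex (fun x => c * f x) = c * Ex f.
Proof. by move=> *; apply: RintegralZl => //; exact: bm_integrable. Qed.

Lemma le_Ex f g : bm f -> bm g -> (forall x, f x <= g x) -> Ex f <= Ex g.
Proof. by move=> *; apply: le_Rintegral => //; exact: bm_integrable. Qed.

Lemma Ex_ge0 f : (forall x, 0 <= f x) -> 0 <= Ex f.
Proof. by move=> *; apply: Rintegral_ge0. Qed.

Lemma le_norm_Ex f : bm f -> `|Ex f| <= Ex (fun x => `|f x|).
Proof. by move=> bf; apply: le_normr_Rintegral => //; exact: bm_integrable. Qed.

Lemma Ex_sum (I : Type) (r : seq I) (P : pred I) (F : I -> X -> R) :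
  (forall i, bm (F i)) ->
  Ex (fun x => \sum_(i <- r | P i) F i x) = \sum_(i <- r | P i) Ex (F i).
Proof.
move=> bF; elim: r => [|i r IH].
  by under eq_fun do rewrite big_nil; rewrite big_nil Ex_cst.
under eq_fun do rewrite big_cons.
rewrite big_cons; case: (P i) => //.
by rewrite ExD ?IH//; exact: bm_sum.
Qed.

Lemma Ex_indic A : measurable A -> Ex \1_A = fine (mu A).
Proof. by move=> mA; rewrite /Ex /Rintegral integral_indic// setIT. Qed.

Lemma EFin_Ex f : bm f -> (Ex f)%:E = (\int[mu]_x (f x)%:E)%E.
Proof.
move=> bf; rewrite /Ex /Rintegral fineK//.
exact: integrable_fin_num (bm_integrable bf).
Qed.

Lemma eq_ae_Ex f g : bm f -> bm g -> {ae mu, forall x, f x = g x} -> Ex f = Ex g.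
Proof.
move=> [mf _] [mg _] fg; congr fine; apply: ae_eq_integral => //.
- exact/measurable_EFinP.
- exact/measurable_EFinP.
- by apply: filterS fg => x /= -> _.
Qed.

Lemma le_ae_Ex f g : bm f -> bm g -> {ae mu, forall x, f x <= g x} -> Ex f <= Ex g.
Proof.
move=> bf bg fg.
have -> : Ex f = Ex (fun x => Num.min (f x) (g x)).
  by apply: eq_ae_Ex => //; [bmt | apply: filterS fg => x /= /min_idPl ->].
by apply: le_Ex => //; [bmt | move=> x; rewrite ge_min lexx orbT].
Qed.

Lemma Ex_eq0 f : bm f -> (forall x, 0 <= f x) -> Ex f = 0 ->
  {ae mu, forall x, f x = 0}.
Proof.
move=> bf f0 Ef.
have mf : measurable_fun setT (EFin \o f) by apply/measurable_EFinP; exact: bf.1.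
have := (ae_eq_integral_abs mu measurableT mf).1; move=> h.
have {}h := h _; apply: filterS (h _) => [x /= /(_ I) []//|].
under eq_integral do rewrite gee0_abs ?lee_fin//.
by rewrite -EFin_Ex// Ef.
Qed.

(** The form [Ex (s f - t g)^2] is nonnegative. At (s, t) = (C, A) it gives C (B C - A^2) >= 0; if C
    = 0, the point (A, B + 1) gives - A^2 (B + 2) >= 0, so A = 0. *)
Lemma Ex_CS f g : bm f -> bm g ->
  Ex (fun x => f x * g x) ^+ 2 <= Ex (fun x => f x ^+ 2) * Ex (fun x => g x ^+ 2).
Proof.
move=> bf bg.
set A := Ex _; set B := Ex (fun x => f x ^+ 2); set C := Ex (fun x => g x ^+ 2).
have B0 : 0 <= B by apply: Ex_ge0 => x; exact: sqr_ge0.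
have C0 : 0 <= C by apply: Ex_ge0 => x; exact: sqr_ge0.
have key (s t : R) : 0 <= s ^+ 2 * B - 2 * s * t * A + t ^+ 2 * C.
  suff <- : Ex (fun x => (s * f x - t * g x) ^+ 2) =
      s ^+ 2 * B - 2 * s * t * A + t ^+ 2 * C.
    by apply: Ex_ge0 => x; exact: sqr_ge0.
  rewrite -!ExZ -?ExB -?ExD; try by bmt.
  by congr Ex; apply/funext => x; ring.
have := key C A; have := key A B; have := key 1 A; have := key 1 (- A).
have [C0'|] := eqVneq C 0; last by move=> Cn; nra.
have := key A (B + 1); rewrite C0'; nra.
Qed.

Lemma norm_Ex_le f c : bm f -> (forall x, `|f x| <= c) -> `|Ex f| <= c.
Proof.
move=> bf fc; rewrite (le_trans (le_norm_Ex bf))// -[leRHS]Ex_cst.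
by apply: le_Ex => //; bmt.
Qed.

Lemma ae_Ex0 f : bm f -> {ae mu, forall x, f x = 0} -> Ex f = 0.
Proof. by move=> bf f0; rewrite (eq_ae_Ex bf (bm_cst 0) f0) Ex_cst. Qed.

End Expectation.

(** * Complex moduli and phases *)

Section ComplexModulus.
Context {R : realType}.
Implicit Types z w : R[i].

Lemma cmodE z : cmod z = Normc.normc z.
Proof. by case: z. Qed.

Lemma cmod_ge0 z : 0 <= cmod z. Proof. exact: sqrtr_ge0. Qed.

Lemma cmod0 : cmod (0 : R[i]) = 0. Proof. by rewrite cmodE Normc.normc0. Qed.

Lemma cmod1 : cmod (1 : R[i]) = 1. Proof. by rewrite cmodE Normc.normc1. Qed.

Lemma cmodM z w : cmod (z * w) = cmod z * cmod w.
Proof. by rewrite !cmodE Normc.normcM. Qed.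

Lemma cmodD z w : cmod (z + w) <= cmod z + cmod w.
Proof. by rewrite !cmodE le_normcD. Qed.

Lemma cmodN z : cmod (- z) = cmod z.
Proof. by rewrite !cmodE normcN. Qed.

Lemma cmodBC z w : cmod (z - w) = cmod (w - z).
Proof. by rewrite -cmodN opprB. Qed.

Lemma cmodJ z : cmod (conjc z) = cmod z.
Proof. by case: z => a b; rewrite /cmod /= sqrrN. Qed.

Lemma cmodX z n : cmod (z ^+ n) = cmod z ^+ n.
Proof. by elim: n => [|n IH]; rewrite ?expr0 ?cmod1// !exprS cmodM IH. Qed.

Lemma cmod_triB z w t : cmod (z - t) <= cmod (z - w) + cmod (w - t).
Proof. by rewrite (le_trans _ (cmodD _ _))// addrA subrK. Qed.

Lemma cmod_eq0 z : cmod z = 0 -> z = 0.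
Proof. by rewrite cmodE => /Normc.eq0_normc. Qed.

Lemma cmod_sqr z : cmod z ^+ 2 = complex.Re z ^+ 2 + complex.Im z ^+ 2.
Proof. by rewrite sqr_sqrtr// addr_ge0 ?sqr_ge0. Qed.

Lemma Re_le_cmod z : `|complex.Re z| <= cmod z.
Proof. by rewrite -sqrtr_sqr ler_wsqrtr// lerDl sqr_ge0. Qed.

Lemma Im_le_cmod z : `|complex.Im z| <= cmod z.
Proof. by rewrite -sqrtr_sqr ler_wsqrtr// lerDr sqr_ge0. Qed.

Lemma cmod_le_ReIm z : cmod z <= `|complex.Re z| + `|complex.Im z|.
Proof.
rewrite -(ler_pXn2r (n := 2)) ?nnegrE ?cmod_ge0 ?addr_ge0//.
rewrite cmod_sqr -(real_normK (num_real (complex.Re z))).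
rewrite -(real_normK (num_real (complex.Im z))).
have := normr_ge0 (complex.Re z); have := normr_ge0 (complex.Im z).
by move=> *; nra.
Qed.

Lemma cmod_cR (a : R) : cmod (cR a) = `|a|.
Proof. by rewrite /cmod /= expr0n addr0 sqrtr_sqr. Qed.

Lemma cRM (a b : R) : cR (a * b) = cR a * cR b.
Proof. exact: (rmorphM (real_complex R)). Qed.

Lemma cRD (a b : R) : cR (a + b) = cR a + cR b.
Proof. exact: (rmorphD (real_complex R)). Qed.

Lemma cRB (a b : R) : cR (a - b) = cR a - cR b.
Proof. exact: (rmorphB (real_complex R)). Qed.

Lemma cR1 : cR (1 : R) = 1. Proof. by []. Qed.

Lemma cR0 : cR (0 : R) = 0. Proof. by []. Qed.

Lemma conjcM z w : conjc (z * w) = conjc z * conjc w.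
Proof. exact: (rmorphM (@conjc R)). Qed.

Lemma conjcB z w : conjc (z - w) = conjc z - conjc w.
Proof. exact: (rmorphB (@conjc R)). Qed.

Lemma conjc_cR (a : R) : conjc (cR a) = cR a.
Proof. by rewrite /cR /= oppr0. Qed.

Lemma mulcJ z : z * conjc z = cR (cmod z ^+ 2).
Proof.
case: z => a b; rewrite cmod_sqr; apply/eqP; rewrite eq_complex /=.
by apply/andP; split; apply/eqP; ring.
Qed.

Lemma mulcJ1 z : cmod z = 1 -> z * conjc z = 1.
Proof. by move=> z1; rewrite mulcJ z1 expr1n. Qed.

Lemma mulJc1 z : cmod z = 1 -> conjc z * z = 1.
Proof. by rewrite mulrC => /mulcJ1. Qed.

Lemma cReM z w : complex.Re (z * w) =
  complex.Re z * complex.Re w - complex.Im z * complex.Im w.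
Proof. by case: z => a b; case: w. Qed.

Lemma cImM z w : complex.Im (z * w) =
  complex.Re z * complex.Im w + complex.Im z * complex.Re w.
Proof. by case: z => a b; case: w. Qed.

Lemma cReD z w : complex.Re (z + w) = complex.Re z + complex.Re w.
Proof. by case: z => a b; case: w. Qed.

Lemma cImD z w : complex.Im (z + w) = complex.Im z + complex.Im w.
Proof. by case: z => a b; case: w. Qed.

Lemma cReN z : complex.Re (- z) = - complex.Re z. Proof. by case: z. Qed.

Lemma cImN z : complex.Im (- z) = - complex.Im z. Proof. by case: z. Qed.

Lemma cReJ z : complex.Re (conjc z) = complex.Re z. Proof. by case: z. Qed.

Lemma cImJ z : complex.Im (conjc z) = - complex.Im z. Proof. by case: z. Qed.

Lemma cmod_mulJB (a b v : R[i]) : cmod v = 1 -> cmod (a * conjc v - b) = cmod (a - b * v).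
Proof.
move=> v1; rewrite -[LHS]mulr1 -[X in _ * X]v1 -cmodM mulrBl -mulrA (mulJc1 v1).
by rewrite mulr1.
Qed.

(* With [x^-1 = 0] at [x = 0], [ph 0 = 0] and [ph] is multiplicative everywhere. *)
Definition ph z : R[i] := cR (cmod z)^-1 * z.

Lemma phM z w : ph (z * w) = ph z * ph w.
Proof. by rewrite /ph cmodM invfM cRM mulrACA. Qed.

Lemma phJ z : ph (conjc z) = conjc (ph z).
Proof. by rewrite /ph cmodJ conjcM conjc_cR. Qed.

Lemma ph0 : ph 0 = 0. Proof. by rewrite /ph mulr0. Qed.

Lemma cmod_ph z : z != 0 -> cmod (ph z) = 1.
Proof.
move=> z0; rewrite /ph cmodM cmod_cR ger0_norm ?invr_ge0 ?cmod_ge0// mulVf//.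
by apply: contraNneq z0 => /cmod_eq0 ->.
Qed.

Lemma cmod_ph_le1 z : cmod (ph z) <= 1.
Proof.
by have [->|/cmod_ph ->] := eqVneq z 0; rewrite ?ph0 ?cmod0.
Qed.

Lemma phK z : cR (cmod z) * ph z = z.
Proof.
have [->|z0] := eqVneq z 0; first by rewrite ph0 mulr0.
rewrite /ph mulrA -cRM divff ?cR1 ?mul1r//.
by apply: contraNneq z0 => /cmod_eq0 ->.
Qed.

Lemma ph_cR (a : R) z : 0 < a -> ph (cR a * z) = ph z.
Proof.
move=> a0; rewrite phM /ph cmod_cR gtr0_norm// -cRM mulVf ?gt_eqF// cR1.
by rewrite mul1r.
Qed.

Lemma ph_unit z : cmod z = 1 -> ph z = z.
Proof. by move=> z1; rewrite /ph z1 invr1 cR1 mul1r. Qed.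

End ComplexModulus.

Section BoundedComplex.
Context {d : measure_display} {X : measurableType d} {R : realType}.
Implicit Types f g : X -> R[i].

Definition bmc f : Prop :=
  bm (fun x => complex.Re (f x)) /\ bm (fun x => complex.Im (f x)).

Lemma bmcP f M : cmeasurable f -> (forall x, cmod (f x) <= M) -> bmc f.
Proof.
move=> [mr mi] fM; split; split => //; exists M => x.
- exact: le_trans (Re_le_cmod _) (fM x).
- exact: le_trans (Im_le_cmod _) (fM x).
Qed.

Lemma bmc_cmeas f : bmc f -> cmeasurable f.
Proof. by move=> [[? _] [? _]]. Qed.

Lemma bmc_cst (c : R[i]) : bmc (fun=> c).
Proof. by split; exact: bm_cst. Qed.

Lemma bmcD f g : bmc f -> bmc g -> bmc (fun x => f x + g x).
Proof.
move=> [rf i_f] [rg ig]; split.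
- by under eq_fun do rewrite cReD; bmt.
- by under eq_fun do rewrite cImD; bmt.
Qed.

Lemma bmcN f : bmc f -> bmc (fun x => - f x).
Proof.
move=> [rf i_f]; split.
- by under eq_fun do rewrite cReN; bmt.
- by under eq_fun do rewrite cImN; bmt.
Qed.

Lemma bmcB f g : bmc f -> bmc g -> bmc (fun x => f x - g x).
Proof. by move=> bf bg; apply: bmcD => //; exact: bmcN. Qed.

Lemma bmcM f g : bmc f -> bmc g -> bmc (fun x => f x * g x).
Proof.
move=> [rf i_f] [rg ig]; split.
- by under eq_fun do rewrite cReM; bmt.
- by under eq_fun do rewrite cImM; bmt.
Qed.

Lemma bmcJ f : bmc f -> bmc (fun x => conjc (f x)).
Proof.
move=> [rf i_f]; split.
- by under eq_fun do rewrite cReJ; bmt.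
- by under eq_fun do rewrite cImJ; bmt.
Qed.

Lemma bmc_cR (f : X -> R) : bm f -> bmc (fun x => cR (f x)).
Proof. by move=> bf; split => //=; exact: bm_cst. Qed.

Lemma bmc_comp f (g : X -> X) : measurable_fun setT g -> bmc f ->
  bmc (fun x => f (g x)).
Proof. by move=> mg [rf i_f]; split; [exact: (bm_comp mg rf)|exact: (bm_comp mg i_f)]. Qed.

Lemma bm_cmod f : bmc f -> bm (fun x => cmod (f x)).
Proof. by move=> [rf i_f]; rewrite /cmod; bmt. Qed.

Lemma cmeas_cmod f : cmeasurable f -> measurable_fun setT (fun x => cmod (f x)).
Proof.
move=> [mr mi].
apply: (measurableT_comp (continuous_measurable_fun (@sqrt_continuous R))).
by apply: measurable_funD; exact: measurable_funX.
Qed.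

Lemma cmeasM f g : cmeasurable f -> cmeasurable g -> cmeasurable (fun x => f x * g x).
Proof.
move=> [rf i_f] [rg ig]; split.
- under eq_fun do rewrite cReM.
  by apply: measurable_funB; exact: measurable_funM.
- under eq_fun do rewrite cImM.
  by apply: measurable_funD; exact: measurable_funM.
Qed.

Lemma cmeas_ph f : cmeasurable f -> cmeasurable (fun x => ph (f x)).
Proof.
move=> mf; apply: cmeasM => //; split => /=; last exact: measurable_cst.
have -> : (fun x => (cmod (f x))^-1) = (fun x => cmod (f x) `^ (- 1)).
  by apply/funext => x; rewrite powR_inv1// cmod_ge0.
exact: (measurableT_comp (measurable_powR _) (cmeas_cmod mf)).
Qed.

Lemma bmc_ph f : cmeasurable f -> bmc (fun x => ph (f x)).
Proof.
by move=> mf; apply: (bmcP (M := 1)); [exact: cmeas_ph|move=> x; exact: cmod_ph_le1].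
Qed.

End BoundedComplex.

Ltac bmct :=
  repeat first
  [ assumption
  | match goal with
    | |- bm (fun x => ?c) => exact: (bm_cst c)
    | |- bmc (fun x => ?c) => exact: (bmc_cst c)
    | |- bm (fun x => _ - _) => apply: bmB
    | |- bm (fun x => _ + _) => apply: bmD
    | |- bm (fun x => - _) => apply: bmN
    | |- bm (fun x => _ * _) => apply: bmM
    | |- bm (fun x => _ ^+ _) => apply: bmX
    | |- bm (fun x => `|_|) => apply: bm_norm
    | |- bm (fun x => Num.sqrt _) => apply: bm_sqrt
    | |- bm (fun x => Num.min _ _) => apply: bm_min
    | |- bm (fun x => \1_?A x) => apply: (bm_indic (A := A))
    | |- bm (fun x => cmod _) => apply: bm_cmod
    | |- bmc (fun x => _ - _) => apply: bmcB
    | |- bmc (fun x => _ + _) => apply: bmcD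
    | |- bmc (fun x => - _) => apply: bmcN
    | |- bmc (fun x => _ * _) => apply: bmcM
    | |- bmc (fun x => conjc _) => apply: bmcJ
    | |- bmc (fun x => cR _) => apply: bmc_cR
    end
  | match goal with
    | H : forall _, bmc _ |- bmc _ => solve [apply H]
    | H : forall _, bm _ |- bm _ => solve [apply H]
    | H : forall _ _, bmc _ |- bmc _ => solve [apply H]
    | H : forall _ _, bm _ |- bm _ => solve [apply H]
    | H : forall _ _ _, bm _ |- bm _ => solve [apply H]
    end ].

(** * Measure-preserving systems *)

Section Systems.
Context {d : measure_display} {X : measurableType d} {R : realType}.

Definition mps (nu : probability X R) (S Si : X -> X) : Prop :=
  [/\ measurable_fun setT S, measurable_fun setT Si, cancel S Si, cancel Si S &
      forall A, measurable A -> nu (S @^-1` A) = nu A].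

(** Bounded real functions stay within the class [bm]; complex invariant functions are treated
    through their real and imaginary parts. *)
Definition ergodic (nu : probability X R) (Si : X -> X) : Prop :=
  forall g : X -> R, bm g -> {ae nu, forall x, g (Si x) = g x} ->
    exists c, {ae nu, forall x, g x = c}.

Section Shift.
Variables (S Si : X -> X).
Hypotheses (SK : cancel S Si) (SiK : cancel Si S).

Lemma TzS n x : Tz S Si (n + 1) x = S (Tz S Si n x).
Proof.
case: n => [n|[|n]].
- by rewrite -PoszD addn1.
- by rewrite /= SiK.
- have -> : Negz n.+1 + 1 = Negz n by rewrite !NegzE -addn1 PoszD opprD addrNK.
  exact: (esym (SiK (iter n.+1 Si x))).
Qed.

Lemma TzP n x : Tz S Si (n - 1) x = Si (Tz S Si n x).
Proof. by rewrite -[in RHS](subrK 1 n) TzS SK. Qed.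

Lemma TzD a b x : Tz S Si (a + b) x = Tz S Si a (Tz S Si b x).
Proof.
elim/int_ind: a => [|n IH|n IH]; first by rewrite add0r.
- by rewrite -addn1 PoszD addrAC TzS IH TzS.
- by rewrite -addn1 PoszD opprD addrAC TzP IH TzP.
Qed.

Lemma Tz0 x : Tz S Si 0 x = x. Proof. by []. Qed.

Lemma TzN1 x : Tz S Si (- 1) x = Si x. Proof. by []. Qed.

Lemma Tz_nat n x : Tz S Si n%:Z x = iter n S x. Proof. by []. Qed.

Lemma Tz_natN (n : nat) x : Tz S Si (- n%:Z) x = iter n Si x.
Proof. by case: n. Qed.

Lemma TzK n : cancel (Tz S Si n) (Tz S Si (- n)).
Proof. by move=> x; rewrite -TzD addNr. Qed.

Lemma TzNK n : cancel (Tz S Si (- n)) (Tz S Si n).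
Proof. by move=> x; rewrite -TzD addrN. Qed.

Lemma Tz_iter m n x : Tz (iter m S) (iter m Si) n x = Tz S Si (m%:Z * n) x.
Proof.
case: n => n; first by rewrite -PoszM mulnC !Tz_nat iterM.
by rewrite NegzE mulrN -PoszM Tz_natN mulnC iterM.
Qed.

End Shift.

Variables (nu : probability X R) (S Si : X -> X).
Hypothesis HS : mps nu S Si.

Lemma measurable_Tz n : measurable_fun setT (Tz S Si n).
Proof.
have iterM (f : X -> X) k : measurable_fun setT f -> measurable_fun setT (iter k f).
  move=> mf; elim: k => [|k IH]; first exact: measurable_id.
  exact: (measurableT_comp mf IH).
by case: HS => mS mSi _ _ _; case: n => k; exact: iterM.
Qed.

Lemma measurable_Tz_pre n A : measurable A -> measurable (Tz S Si n @^-1` A).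
Proof. by move=> mA; rewrite -[X in measurable X]setTI; exact: measurable_Tz. Qed.

Lemma Tz_mp n A : measurable A -> nu (Tz S Si n @^-1` A) = nu A.
Proof.
have [_ _ SK SiK pres] := HS.
elim/int_ind: n A => [A|n IH A mA|n IH A mA]; first by [].
- rewrite -(IH A)// -(pres (Tz S Si n @^-1` A)); last exact: measurable_Tz_pre.
  congr (nu _); apply/funext => x.
  change (A (Tz S Si n.+1%:Z x) = A (Tz S Si n (Tz S Si 1 x))).
  by rewrite -(TzD SK SiK) -addn1 PoszD.
- rewrite -(IH A)// -[LHS]pres; last exact: measurable_Tz_pre.
  congr (nu _); apply/funext => x.
  change (A (Tz S Si (- n.+1%:Z) (Tz S Si 1 x)) = A (Tz S Si (- n%:Z) x)).
  by rewrite -(TzD SK SiK) -addn1 PoszD opprD addrNK.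
Qed.

Lemma ae_Tz n (P : X -> Prop) : {ae nu, forall x, P x} ->
  {ae nu, forall x, P (Tz S Si n x)}.
Proof.
move=> [A [mA A0 PA]]; exists (Tz S Si n @^-1` A); split.
- exact: measurable_Tz_pre.
- by rewrite Tz_mp.
- by move=> x /= nP; apply: PA => /=.
Qed.

Lemma bm_Tz n (f : X -> R) : bm f -> bm (fun x => f (Tz S Si n x)).
Proof. by apply: bm_comp; exact: measurable_Tz. Qed.

Lemma bmc_Tz n (f : X -> R[i]) : bmc f -> bmc (fun x => f (Tz S Si n x)).
Proof. by apply: bmc_comp; exact: measurable_Tz. Qed.

Lemma Ex_Tz n (f : X -> R) : bm f -> Ex nu (fun x => f (Tz S Si n x)) = Ex nu f.
Proof.
move=> bf; rewrite /Ex /Rintegral; congr fine.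
have mT := measurable_Tz n.
have h : (\int[pushforward nu (Tz S Si n)]_y (f y)%:E =
      \int[nu]_x (f (Tz S Si n x))%:E)%E.
  rewrite (@integral_pushforward _ _ _ _ _ _ mT nu setT (EFin \o f))//.
  - by apply/measurable_EFinP; exact: bf.1.
  - rewrite preimage_setT; exact: (bm_integrable nu (bm_Tz n bf)).
rewrite -h; apply: eq_measure_integral => A mA _.
exact: (Tz_mp n mA).
Qed.

Lemma mps_iter m : mps nu (iter m S) (iter m Si).
Proof.
have [_ _ SK SiK _] := HS.
have iN x : iter m Si x = Tz S Si (- m%:Z) x by rewrite Tz_natN.
split.
- exact: (measurable_Tz m%:Z).
- rewrite (_ : iter m Si = Tz S Si (- m%:Z)); last exact/funext.
  exact: measurable_Tz.
- by move=> x; rewrite iN -[iter m S x]/(Tz S Si m%:Z x) TzK.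
- by move=> x; rewrite iN -[iter m S _]/(Tz S Si m%:Z _) TzNK.
- by move=> A mA; exact: (Tz_mp m%:Z mA).
Qed.

End Systems.

(* [lra] may fail on hypotheses quantified over the carrier of a measurable space. *)
Ltac numclear :=
  repeat match goal with
  | H : ?P |- _ =>
    lazymatch P with is_true _ => fail | @eq (Num.RealField.sort _) _ _ => fail | mps _ _ _ => fail | ergodic _ _ => fail | _ => idtac end;
    clear H
  end.
Ltac lrac := numclear; lra.
Ltac nrac := numclear; nra.

(** * Almost everywhere convergence from bounds on integrals *)

Section Convergence.
Context {d : measure_display} {X : measurableType d} {R : realType}.
Variable nu : probability X R.

Lemma dct (f_ : nat -> X -> R) f M : (forall n, bm (f_ n)) -> bm f ->
  (forall n x, `|f_ n x| <= M) -> {ae nu, forall x, f_ ^~ x @ \oo --> f x} ->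
  (fun n => Ex nu (f_ n)) @ \oo --> Ex nu f.
Proof.
move=> bf_ bf fM fcv.
have mf_ n : measurable_fun setT (EFin \o f_ n).
  by apply/measurable_EFinP; exact: (bf_ n).1.
have mf : measurable_fun setT (EFin \o f) by apply/measurable_EFinP; exact: bf.1.
have [|||_ _ h] := @dominated_convergence _ _ _ nu setT measurableT
  (fun n => EFin \o f_ n) (EFin \o f) (cst M%:E) mf_ mf.
- apply: filterS fcv => x /= h _.
  by apply: cvg_EFin h; exact: nearW.
- exact: (bm_integrable nu (bm_cst M)).
- by apply: aeW => x n _; rewrite /= lee_fin.
apply: fine_cvg; rewrite EFin_Ex//.
Qed.

(** Monotone convergence: the sum of the series has a finite integral, so it is finite almost
    everywhere. *)
Lemma summable_ae (g : nat -> X -> R) C : (forall n, bm (g n)) ->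
  (forall n x, 0 <= g n x) -> (forall n, \sum_(0 <= i < n) Ex nu (g i) <= C) ->
  {ae nu, forall x, cvgn (series (g ^~ x))}.
Proof.
move=> bg g0 gC.
have mg n : measurable_fun setT (fun x => (g n x)%:E).
  by apply/measurable_EFinP; exact: (bg n).1.
have mS : measurable_fun setT (fun x => (\sum_(0 <= n <oo) (g n x)%:E)%E).
  by apply: ge0_emeasurable_sum => // n x _ _; rewrite lee_fin.
have intS : nu.-integrable setT (fun x => (\sum_(0 <= n <oo) (g n x)%:E)%E).
  apply/integrableP; split => //.
  rewrite (eq_integral (fun x => (\sum_(0 <= n <oo) (g n x)%:E)%E)); last first.
    move=> x _; rewrite gee0_abs//.
    by apply: nneseries_ge0 => n *; rewrite lee_fin.
  rewrite integral_nneseries//; last by move=> n x _; rewrite lee_fin.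
  apply: (@le_lt_trans _ _ C%:E); last exact: ltry.
  apply: lime_le; first by apply: is_cvg_nneseries => n *; apply: integral_ge0 => x _; rewrite lee_fin.
  apply: nearW => n.
  under eq_bigr do rewrite -EFin_Ex//.
  by rewrite sumEFin lee_fin.
apply: filterS (integrable_ae measurableT intS) => x /= /(_ I) fin.
apply: nondecreasing_is_cvgn; first exact: nondecreasing_series.
exists (fine (\sum_(0 <= n <oo) (g n x)%:E)%E) => _ [n _ <-].
rewrite -lee_fin fineK// /series /= -sumEFin.
by apply: nneseries_lim_ge => i _; rewrite lee_fin.
Qed.

(** Summable increments give absolute convergence almost everywhere. The limit is taken as the upper
    limit clipped to [-1, 1], so that it is measurable and bounded everywhere, also where the
    sequence diverges. *)
Lemma fast_limit (g : nat -> X -> R) C : (forall n, bm (g n)) ->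
  (forall n x, `|g n x| <= 1) ->
  (forall n, \sum_(0 <= i < n) Ex nu (fun x => `|g i.+1 x - g i x|) <= C) ->
  exists F, [/\ bm F, forall x, `|F x| <= 1 &
    {ae nu, forall x, g ^~ x @ \oo --> F x}].
Proof.
move=> bg g1 gC.
have bdg n : bm (fun x => `|g n.+1 x - g n x|) by bmt.
have := summable_ae bdg (fun n x => normr_ge0 _) gC.
pose L x := limn_sup (g ^~ x).
have mL : measurable_fun setT L.
  apply: measurable_fun_limn_sup => [x _|x _|n].
  - by exists 1 => _ [n _ <-]; exact: le_trans (ler_norm _) (g1 n x).
  - by exists (- 1) => _ [n _ <-]; have := g1 n x; rewrite ler_norml => /andP[].
  - exact: (bg n).1.
move=> scv; exists (fun x => Num.max (- 1) (Num.min 1 (L x))).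
have F1 x : `|Num.max (- 1) (Num.min 1 (L x))| <= 1.
  by rewrite ler_norml le_max lexx/= ge_max ge_min lexx !andbT -subr_ge0 opprK.
split => //.
- split; last by exists 1.
  apply: measurable_maxr; first exact: measurable_cst.
  by apply: measurable_minr => //; exact: measurable_cst.
- apply: filterS scv => x /= /normed_cvg cs.
  have cg : cvgn (g ^~ x).
    have -> : g ^~ x = (fun n => g 0%N x + series (fun i => g i.+1 x - g i x) n).
      by apply/funext => n; rewrite /series /= telescope_sumr// addrC subrK.
    by apply: is_cvgD => //; exact: is_cvg_cst.
  have [l gl] := (cvg_ex _).1 cg.
  have -> : L x = l by rewrite /L (cvg_limn_supE cg); exact: cvg_lim.
  have l1 : `|l| <= 1.
    rewrite -(cvg_lim _ gl)// ler_norml.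
    rewrite limr_ge//; last by apply: nearW => n; have := g1 n x; rewrite ler_norml => /andP[].
    by apply: limr_le => //; apply: nearW => n; exact: le_trans (ler_norm _) (g1 n x).
  move: l1; rewrite ler_norml => /andP[l1 l2].
  by rewrite (min_idPr l2) (max_idPr l1).
Qed.

End Convergence.

(** * Twisted fixed points and the mean ergodic theorem *)

Section MinimalElement.
Context {d : measure_display} {X : measurableType d} {R : realType}.
Variables (nu : probability X R) (S Si : X -> X).
Hypothesis HS : mps nu S Si.
Variables (phi f0 : X -> R[i]).
Hypotheses (bphi : bmc phi) (phi1 : forall x, cmod (phi x) = 1).
Hypotheses (bf0 : bmc f0) (f01 : forall x, cmod (f0 x) <= 1).

(** The weighted Koopman operator, an L^2 isometry because [phi] is unimodular. *)
Definition twist (g : X -> R[i]) : X -> R[i] := fun x => phi x * g (Si x).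

(** The dyadic convex hull of the twisted orbit of [f0]. Midpoints are what the parallelogram law
    uses, and structural induction passes convex properties stable under the twist from [f0] to the
    whole hull. *)
Inductive hull : (X -> R[i]) -> Prop :=
| hull_base : hull f0
| hull_twist g : hull g -> hull (twist g)
| hull_mid g g' : hull g -> hull g' -> hull (fun x => cR (1 / 2) * (g x + g' x)).

Let N2 (g : X -> R[i]) := Ex nu (fun x => cmod (g x) ^+ 2).

Lemma bmc_Si (g : X -> R[i]) : bmc g -> bmc (fun x => g (Si x)).
Proof. by apply: bmc_comp; case: HS. Qed.

Lemma bmc_twist (g : X -> R[i]) : bmc g -> bmc (twist g).
Proof. by move=> bg; apply: bmcM => //; exact: bmc_Si. Qed.

Lemma hull_bmc g : hull g -> bmc g.
Proof.
elim=> [//|{}g _|{}g g' _ bg _ bg']; first exact: bmc_twist.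
by apply: bmcM; [exact: bmc_cst|exact: bmcD].
Qed.

Lemma hull_le1 g : hull g -> forall x, cmod (g x) <= 1.
Proof.
elim=> [//|{}g _ IH x|{}g g' _ IH _ IH' x]; first by rewrite cmodM phi1 mul1r.
rewrite cmodM cmod_cR ger0_norm//.
have := cmodD (g x) (g' x); have := IH x; have := IH' x; lra.
Qed.

Lemma Ex_Si (f : X -> R) : bm f -> Ex nu (fun x => f (Si x)) = Ex nu f.
Proof. exact: (Ex_Tz HS (- 1)). Qed.

Lemma N2_twist g : bmc g -> N2 (twist g) = N2 g.
Proof.
move=> bg; rewrite /N2 /twist.
under eq_fun do rewrite cmodM phi1 mul1r.
by rewrite (Ex_Si (f := fun x => cmod (g x) ^+ 2))//; bmct.
Qed.

Lemma sqr_le2 (f a b : R) : 0 <= f -> f <= a + b ->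
  f ^+ 2 <= 2 * a ^+ 2 + 2 * b ^+ 2.
Proof.
move=> f0' fab; have : f ^+ 2 <= (a + b) ^+ 2 by rewrite !expr2 ler_pM.
by have := sqr_ge0 (a - b); lra.
Qed.

Lemma sqr_le3 (f a b c : R) : 0 <= f -> f <= a + b + c ->
  f ^+ 2 <= 3 * (a ^+ 2 + b ^+ 2 + c ^+ 2).
Proof.
move=> f0' fabc; have : f ^+ 2 <= (a + b + c) ^+ 2 by rewrite !expr2 ler_pM.
have := sqr_ge0 (a - b); have := sqr_ge0 (a - c); have := sqr_ge0 (b - c); nra.
Qed.

Lemma parallelogram (a b : R[i]) : cmod (a - b) ^+ 2 =
  2 * cmod a ^+ 2 + 2 * cmod b ^+ 2 - 4 * cmod (cR (1 / 2) * (a + b)) ^+ 2.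
Proof. by case: a => a1 a2; case: b => b1 b2; rewrite !cmod_sqr /=; field. Qed.

Lemma Ex_norm_sqr (h : X -> R) : bm h -> Ex nu (fun x => `|h x|) ^+ 2 <= Ex nu (fun x => h x ^+ 2).
Proof.
move=> bh; have := Ex_CS nu (bm_norm bh) (bm_cst 1).
under eq_fun do rewrite mulr1; move=> /le_trans; apply.
rewrite expr1n Ex_cst mulr1; apply: le_Ex; bmt.
by move=> x; rewrite real_normK// num_real.
Qed.

Let E := [set N2 g | g in hull].
Let m := inf E.

Let E0 : has_inf E.
Proof.
split; first by exists (N2 f0), f0 => //; exact: hull_base.
by exists 0 => _ [g _ <-]; apply: Ex_ge0 => x; exact: sqr_ge0.
Qed.

(** The midpoint of [g] and [g'] is again in the hull, so its [N2] is at least the infimum [m]; the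
    parallelogram law does the rest. *)
Lemma N2_near_min g g' e e' : hull g -> hull g' -> N2 g <= m + e -> N2 g' <= m + e' ->
  N2 (fun x => g x - g' x) <= 2 * e + 2 * e'.
Proof.
move=> hg hg' ge ge'; have bg := hull_bmc hg; have bg' := hull_bmc hg'.
rewrite /N2; under eq_fun do rewrite parallelogram.
rewrite ExB ?ExD ?ExZ; try by bmct.
have : m <= N2 (fun x => cR (1 / 2) * (g x + g' x)).
  by apply: ge_inf; [exact: E0.2|exists (fun x => cR (1 / 2) * (g x + g' x)) => //; exact: hull_mid].
rewrite /N2 in ge ge' *; lra.
Qed.

(** The rate 1/4^n in [N2] makes consecutive L^2 distances of order 1/2^n, hence summable. *)
Lemma minimal_seq : exists g : nat -> X -> R[i], forall n, hull (g n) /\ N2 (g n) <= m + (1 / 4) ^+ n.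
Proof.
have ex n : exists g, hull g /\ N2 g <= m + (1 / 4) ^+ n.
  have e0 : 0 < (1 / 4 : R) ^+ n by apply: exprn_gt0; lra.
  by have [_ [g hg <-] /ltW h] := inf_adherent e0 E0; exists g.
by have [g hg] := choice ex; exists g.
Qed.

Lemma cvg0_geo (u : nat -> R) (C : R) : (forall n, 0 <= u n <= C * (1 / 4) ^+ n) ->
  u @ \oo --> 0.
Proof.
move=> uC; apply: (@squeeze_cvgr _ _ _ _ (fun=> 0) (fun n => C * (1 / 4) ^+ n)).
- by apply: nearW.
- exact: cvg_cst.
- rewrite -(mulr0 C); apply: cvgMr; apply: cvg_expr.
  by rewrite ger0_norm; lra.
Qed.

(** The twist preserves [N2], so [twist (g n)] is as nearly minimal as [g n] and their difference
    tends to 0: the limit of the minimising sequence is fixed. Its real and imaginary parts are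
    bounded by 1 separately, whence the bound 2. *)
Theorem hull_fixed_point : exists F, [/\ bmc F, (forall x, cmod (F x) <= 2),
  {ae nu, forall x, F x = twist F x} &
  forall e, 0 < e -> exists2 g, hull g & Ex nu (fun x => cmod (g x - F x) ^+ 2) < e].
Proof.
have [g hg] := minimal_seq.
have bg n : bmc (g n) := hull_bmc (hg n).1.
have g1 n x : cmod (g n x) <= 1 := hull_le1 (hg n).1 x.
have q_ge0 n : 0 <= (1 / 4 : R) ^+ n by apply: exprn_ge0; lra.
have step n : N2 (fun x => g n.+1 x - g n x) <= 4 * (1 / 4) ^+ n.
  have := N2_near_min (hg n.+1).1 (hg n).1 (hg n.+1).2 (hg n).2.
  by have := q_ge0 n; rewrite exprS; lra.
(* Used for the real and for the imaginary parts: the n-th increment has L^1 norm at most its L^2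
   norm, hence at most 2/2^n, and these sum to at most 4. *)
have sumC (h : nat -> X -> R) : (forall n, bm (h n)) ->
    (forall n x, (h n.+1 x - h n x) ^+ 2 <= cmod (g n.+1 x - g n x) ^+ 2) ->
    forall n, \sum_(0 <= i < n) Ex nu (fun x => `|h i.+1 x - h i x|) <= 4.
  move=> bh hgl n; apply: (@le_trans _ _ (4 * (1 - (1 / 2) ^+ n))); last first.
    have : 0 <= (1 / 2 : R) ^+ n by apply: exprn_ge0; lra.
    by lra.
  elim: n => [|n IH]; first by rewrite big_geq// expr0 subrr mulr0.
  rewrite big_nat_recr//=; set u := Ex _ _.
  suff : u <= 2 * (1 / 2) ^+ n by rewrite exprS; lra.
  have h0 : 0 <= (1 / 2 : R) ^+ n by apply: exprn_ge0; lra.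
  rewrite -(ler_pXn2r (n := 2)) ?nnegrE ?mulr_ge0//; last by apply: Ex_ge0.
  rewrite exprMn -exprM mulnC exprM (_ : (1 / 2) ^+ 2 = 1 / 4 :> R); last by field.
  rewrite (_ : 2 ^+ 2 = 4 :> R); last by ring.
  apply: le_trans (step n); apply: le_trans (Ex_norm_sqr _) _; first by bmt.
  by apply: le_Ex; bmct.
have [Fr [bFr Fr1 gFr]] := fast_limit (g := fun n x => complex.Re (g n x))
  (fun n => (bg n).1) (fun n x => le_trans (Re_le_cmod _) (g1 n x))
  (sumC (fun n x => complex.Re (g n x)) (fun n => (bg n).1)
  ltac:(by move=> n x; rewrite cmod_sqr cReD cReN lerDl sqr_ge0)).
have [Fi [bFi Fi1 gFi]] := fast_limit (g := fun n x => complex.Im (g n x))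
  (fun n => (bg n).2) (fun n x => le_trans (Im_le_cmod _) (g1 n x))
  (sumC (fun n x => complex.Im (g n x)) (fun n => (bg n).2)
  ltac:(by move=> n x; rewrite cmod_sqr cImD cImN lerDr sqr_ge0)).
pose F x := Complex (Fr x) (Fi x).
have bF : bmc F by [].
have F2 x : cmod (F x) <= 2.
  apply: le_trans (cmod_le_ReIm _) _; rewrite /=; have := Fr1 x; have := Fi1 x; lra.
have cmod_cvg (u : nat -> R[i]) (z : R[i]) :
    (fun n => complex.Re (u n)) @ \oo --> complex.Re z ->
    (fun n => complex.Im (u n)) @ \oo --> complex.Im z ->
    (fun n => cmod (u n - z) ^+ 2) @ \oo --> 0.
  move=> ur ui; under eq_fun do rewrite cmod_sqr cReD cReN cImD cImN.
  rewrite (_ : 0 = (complex.Re z - complex.Re z) ^+ 2 + (complex.Im z - complex.Im z) ^+ 2); last by ring.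
  by apply: cvgD; rewrite !expr2; apply: cvgM; apply: cvgB => //; exact: cvg_cst.
have gF : {ae nu, forall x, (fun n => cmod (g n x - F x) ^+ 2) @ \oo --> 0}.
  by apply: filterS2 gFr gFi => x /= hr hi; exact: cmod_cvg.
have ngF n x : `|cmod (g n x - F x) ^+ 2| <= 9.
  rewrite ger0_norm ?sqr_ge0//.
  have := cmodD (g n x) (- F x); rewrite cmodN.
  have := g1 n x; have := F2 x; have := cmod_ge0 (g n x - F x); nra.
have cvF : (fun n => Ex nu (fun x => cmod (g n x - F x) ^+ 2)) @ \oo --> 0.
  rewrite -(Ex_cst nu 0); apply: (dct (M := 9)) => // [n|]; first by bmct.
  exact: bm_cst.
exists F; split => //.
- have bTF : bmc (twist F) := bmc_twist bF.
  have btg n : bmc (twist (g n)) := bmc_twist (bg n).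
  have N0 : N2 (fun x => F x - twist F x) = 0.
    apply/eqP; rewrite eq_le; apply/andP; split; last first.
      by apply: Ex_ge0 => x; exact: sqr_ge0.
    (* |F - UF|^2 <= 3 (|F - g|^2 + |g - Ug|^2 + |Ug - UF|^2) *)
    pose u n := 6 * Ex nu (fun x => cmod (g n x - F x) ^+ 2) + 3 * N2 (fun x => g n x - twist (g n) x).
    have ub n : N2 (fun x => F x - twist F x) <= u n.
      have bt : bm (fun x => cmod (twist (fun y => g n y - F y) x) ^+ 2).
        by apply: bmX; apply: bm_cmod; apply: bmc_twist; bmct.
      have -> : u n = Ex nu (fun x => 3 * (cmod (g n x - F x) ^+ 2 +
          cmod (g n x - twist (g n) x) ^+ 2 + cmod (twist (fun y => g n y - F y) x) ^+ 2)).
        rewrite ExZ ?ExD; try by bmct.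
        rewrite -[Ex nu (fun x => cmod (twist _ x) ^+ 2)]/(N2 _) N2_twist; last by bmct.
        by rewrite /u /N2; ring.
      rewrite /N2; apply: le_Ex => [||x]; [by bmct| by bmct|].
      have -> : twist (fun y => g n y - F y) x = twist (g n) x - twist F x.
        by rewrite /twist mulrBr.
      rewrite (cmodBC (g n x) (F x)); apply: sqr_le3; first exact: cmod_ge0.
      apply: le_trans (cmod_triB _ (g n x) _) _; rewrite -addrA lerD2l.
      exact: cmod_triB.
    suff u0 : u @ \oo --> 0.
      rewrite -(cvg_lim _ u0)//; apply: limr_ge; first by apply/cvg_ex; exists 0.
      exact: nearW.
    rewrite (_ : 0 = 6 * 0 + 3 * 0); last by ring.
    apply: cvgD; apply: cvgMr => //.
    apply: (cvg0_geo (C := 4)) => n; apply/andP; split.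
      by apply: Ex_ge0 => x; exact: sqr_ge0.
    have hn := hg n; have := @N2_near_min _ _ _ _ hn.1 (hull_twist hn.1) hn.2.
    by rewrite N2_twist// => /(_ _ hn.2); lra.
  have := Ex_eq0 (_ : bm _) (fun x => sqr_ge0 (cmod (F x - twist F x))) N0.
  move=> /(_ ltac:(by bmct)); apply: filterS => x /= /eqP.
  by rewrite sqrf_eq0 => /eqP /cmod_eq0 /eqP; rewrite subr_eq0 => /eqP.
- move=> e e0; have [n _ /(_ n (leqnn n)) h] := (cvgr0Pnorm_lt _).1 cvF _ e0.
  by exists (g n); [exact: (hg n).1|exact: le_lt_trans (ler_norm _) h].
Qed.

End MinimalElement.

Section HullConsequences.
Context {d : measure_display} {X : measurableType d} {R : realType}.
Variables (nu : probability X R) (S Si : X -> X).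
Hypothesis HS : mps nu S Si.

Lemma iter_twist_mid (phi g g' : X -> R[i]) (n : nat) :
  iter n (twist Si phi) (fun x => cR (1 / 2) * (g x + g' x)) =
  (fun x => cR (1 / 2) * (iter n (twist Si phi) g x + iter n (twist Si phi) g' x)).
Proof.
elim: n => [//|n IH]; rewrite !iterS IH /twist; apply/funext => x; ring.
Qed.

(** Having all twisted iterates within [xi] of [f0] in mean square is a convex condition, and a
    twist only shifts the iterate; so it passes to the whole hull. The factor 2 pays for
    approximating the fixed point by elements of the hull. *)
Lemma almost_fixed (phi f0 : X -> R[i]) (xi : R) :
  bmc phi -> (forall x, cmod (phi x) = 1) ->
  bmc f0 -> (forall x, cmod (f0 x) <= 1) -> 
  (forall n, Ex nu (fun x => cmod (iter n (twist Si phi) f0 x - f0 x) ^+ 2) <= xi) ->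
  exists F, [/\ bmc F, (forall x, cmod (F x) <= 2),
    {ae nu, forall x, F x = twist Si phi F x} &
    Ex nu (fun x => cmod (F x - f0 x) ^+ 2) <= 2 * xi].
Proof.
move=> bphi phi1 bf0 f01 close.
have [F [bF F2 Finv Fapp]] := hull_fixed_point HS bphi phi1 bf0 f01.
exists F; split => //.
have biter g n : bmc g -> bmc (iter n (twist Si phi) g).
  by move=> bg; elim: n => [//|n IH]; exact: (bmc_twist HS bphi).
have hclose g : hull Si phi f0 g ->
    forall n, Ex nu (fun x => cmod (iter n (twist Si phi) g x - f0 x) ^+ 2) <= xi.
  elim=> [//|{}g _ IH n|{}g g' hg IH hg' IH' n]; first by rewrite -iterSr; exact: IH.
  have bg := biter _ n (hull_bmc HS bphi bf0 hg).
  have bg' := biter _ n (hull_bmc HS bphi bf0 hg').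
  rewrite iter_twist_mid.
  apply: (@le_trans _ _ (Ex nu (fun x => 1 / 2 * cmod (iter n (twist Si phi) g x - f0 x) ^+ 2
     + 1 / 2 * cmod (iter n (twist Si phi) g' x - f0 x) ^+ 2))).
    apply: le_Ex => [||x]; [by bmct|by bmct|].
    set a := iter _ _ g x; set b := iter _ _ g' x.
    have -> : cR (1 / 2) * (a + b) - f0 x = cR (1 / 2) * ((a - f0 x) + (b - f0 x)).
      have h1 : cR (1 / 2) + cR (1 / 2) = 1 :> R[i].
        by rewrite -cRD (_ : 1 / 2 + 1 / 2 = 1 :> R)//; field.
      by rewrite -[X in _ - X]mul1r -h1; ring.
    have := parallelogram (a - f0 x) (b - f0 x).
    by have := sqr_ge0 (cmod (a - f0 x - (b - f0 x))); lra.
  rewrite ExD ?ExZ; try by bmct.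
  by have := IH n; have := IH' n; lra.
apply/ler_addgt0Pr => e e0.
have e20 : 0 < e / 2 by rewrite divr_gt0.
have [g hg gF] := Fapp _ e20.
have bg := hull_bmc HS bphi bf0 hg.
have g0 := hclose g hg 0%N; rewrite /= in g0.
apply: (@le_trans _ _ (Ex nu (fun x => 2 * cmod (g x - F x) ^+ 2 + 2 * cmod (g x - f0 x) ^+ 2))).
  apply: le_Ex => [||x]; [by bmct|by bmct|].
  rewrite (cmodBC (g x) (F x)); apply: sqr_le2; first exact: cmod_ge0.
  exact: cmod_triB.
rewrite ExD ?ExZ; try by bmct.
lra.
Qed.

Lemma norm_shift_le (a b p q m : R) : 4 <= m -> `|p| <= 1 -> `|q| <= 1 ->
  `|a - b| <= m / 2 -> `|a + q - p - b| <= m.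
Proof. by rewrite !ler_norml => ? /andP[? ?] /andP[? ?] /andP[? ?]; lra. Qed.

Lemma sum_shift (f : int -> R) N :
  \sum_(1 <= h < N.+1) f (- h%:Z - 1) =
  \sum_(1 <= h < N.+1) f (- h%:Z) + f (- N%:Z - 1) - f (- 1).
Proof.
elim: N => [|N IH]; first by rewrite !big_geq// oppr0 sub0r add0r subrr.
rewrite !(big_nat_recr N.+1)//= IH.
by rewrite (_ : - N%:Z - 1 = - N.+1%:Z); [ring|rewrite -addn1 PoszD opprD].
Qed.

Hypothesis erg : ergodic nu Si.

(** For the trivial twist the fixed point is invariant, so its real part is a constant c. A hull
    element [g] has nearly the same orbit averages as [w], uniformly in the point, and those of [g]
    are close to c in L^1 because [g] is. As [g] and [w] have the same mean, c is close to it. *)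
Lemma mean_ergodic_unit (w : X -> R) : bm w -> (forall x, `|w x| <= 1) ->
  forall e, 0 < e -> exists N0, forall N, (N0 <= N)%N ->
  `|\sum_(1 <= h < N.+1) Ex nu (fun x => w (Tz S Si (- h%:Z) x) * w x)
    - N%:R * Ex nu w ^+ 2| <= e * N%:R.
Proof.
move=> bw w1 e e0.
have [_ _ SK SiK _] := HS.
pose f0 x := cR (w x).
have bf0 : bmc f0 by exact: bmc_cR.
have f01 x : cmod (f0 x) <= 1 by rewrite cmod_cR.
have b1 : bmc (fun _ : X => 1 : R[i]) by exact: bmc_cst.
have one1 (x : X) : cmod (1 : R[i]) = 1 by exact: cmod1.
have [F [bF F2 Finv Fapp]] := hull_fixed_point HS b1 one1 bf0 f01.
have [c Fc] : exists c, {ae nu, forall x, complex.Re (F x) = c}.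
  apply: erg; first exact: bF.1.
  by apply: filterS Finv => x /= ->; rewrite /twist mul1r.
have bT (f : X -> R) n : bm f -> bm (fun x => f (Tz S Si n x)) := @bm_Tz _ _ _ _ _ _ HS n f.
have hP g : hull Si (fun=> 1) f0 g -> [/\ Ex nu (fun x => complex.Re (g x)) = Ex nu w &
  forall e, 0 < e -> exists N0, forall N, (N0 <= N)%N -> forall x,
   `|\sum_(1 <= h < N.+1) (complex.Re (g (Tz S Si (- h%:Z) x)) - w (Tz S Si (- h%:Z) x))|
    <= e * N%:R].
  elim=> [|{}g hg [Eg Ag]|{}g g' hg [Eg Ag] hg' [Eg' Ag']].
  - split => // e' e'0; exists 0%N => N _ x.
    by rewrite big1 ?normr0 ?mulr_ge0// ?ltW// => h _; rewrite /f0 /= subrr.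
  - have bg := hull_bmc HS b1 bf0 hg.
    split.
      rewrite /twist; under eq_fun do rewrite mul1r.
      by rewrite -Eg -(Ex_Si HS bg.1).
    (* One more shift changes the orbit sum by two boundary terms of modulus at most 1, absorbed by
       e' N / 2 as soon as e' N >= 4. *)
    move=> e' e'0; have [N0 hN0] := Ag _ (divr_gt0 e'0 (ltr0n _ 2)).
    have [N1 hN1] : exists N1 : nat, 4 / e' <= N1%:R.
      by exists (Num.truncn (4 / e')).+1; exact: ltW (truncnS_gt _).
    exists (maxn N0 N1) => N; rewrite geq_max => /andP[NN0 NN1] x.
    rewrite sumrB; under eq_bigr => h _ do
      rewrite /twist mul1r -[Si _]/(Tz S Si (- 1) _) -(TzD SK SiK) addrC.
    rewrite (sum_shift (fun a => complex.Re (g (Tz S Si a x)))).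
    have := hN0 N NN0 x; rewrite sumrB.
    have := le_trans (Re_le_cmod _) (hull_le1 one1 f01 hg (Tz S Si (- N%:Z - 1) x)).
    have := le_trans (Re_le_cmod _) (hull_le1 one1 f01 hg (Tz S Si (- 1) x)).
    have : 4 <= e' * N%:R.
      rewrite -ler_pdivrMl// mulrC (le_trans hN1)// ler_nat//.
    move=> h1 h2 h3 h4; exact: (@norm_shift_le _ _ _ _ (e' * N%:R) h1 h2 h3 ltac:(rewrite mulrAC in h4; exact: h4)).
  - have bg := hull_bmc HS b1 bf0 hg; have bg' := hull_bmc HS b1 bf0 hg'.
    have reE x : complex.Re (cR (1 / 2) * (g x + g' x)) =
        1 / 2 * complex.Re (g x) + 1 / 2 * complex.Re (g' x).
      by case: (g x) => a b; case: (g' x) => a' b' /=; rewrite mul0r subr0 mulrDr.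
    split.
      under eq_fun do rewrite reE.
      have [? _] := bg; have [? _] := bg'.
      by rewrite ExD ?ExZ ?Eg ?Eg'; try by bmct; field.
    move=> e' e'0; have [N0 hN0] := Ag _ e'0; have [N1 hN1] := Ag' _ e'0.
    exists (maxn N0 N1) => N; rewrite geq_max => /andP[NN0 NN1] x.
    under eq_bigr do rewrite reE.
    have := hN0 N NN0 x; have := hN1 N NN1 x; rewrite !sumrB.
    rewrite big_split /= -!mulr_sumr !ler_norml => /andP[? ?] /andP[? ?]; lrac.
pose e1 := Num.min (e / 8) 1.
have e10 : 0 < e1 by rewrite lt_min ltr01 andbT divr_gt0.
have [g hg gF] := Fapp (e1 ^+ 2) (exprn_gt0 _ e10).
have bg := hull_bmc HS b1 bf0 hg.
have [Eg Ag] := hP g hg.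
have [bRg _] := bg.
have gc : Ex nu (fun x => `|complex.Re (g x) - c|) <= e1.
  rewrite -(ler_pXn2r (n := 2)) ?nnegrE ?(ltW e10)//; last by apply: Ex_ge0.
  apply: le_trans (ltW gF); apply: le_trans (Ex_norm_sqr _ _) _; first by bmct.
  apply: le_ae_Ex; [by bmct|by bmct|apply: filterS Fc => x /= <-].
  by rewrite cmod_sqr cReD cReN lerDl sqr_ge0.
have wc : `|Ex nu w - c| <= e1.
  rewrite -Eg -(Ex_cst nu c) -ExB//; last exact: bm_cst.
  by apply: le_trans (le_norm_Ex _ _) _ => //; bmct; rewrite Ex_cst.
have [N0 hN0] := Ag _ e10.
exists N0 => N NN0.
have bwT h : bm (fun x => w (Tz S Si (- h%:Z) x)) := bT w _ bw.
have bgT h : bm (fun x => complex.Re (g (Tz S Si (- h%:Z) x))) := bT _ _ bRg.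
have -> : \sum_(1 <= h < N.+1) Ex nu (fun x => w (Tz S Si (- h%:Z) x) * w x) =
  Ex nu (fun x => (\sum_(1 <= h < N.+1) w (Tz S Si (- h%:Z) x)) * w x).
  rewrite -Ex_sum; last by move=> h; bmct; exact: bwT.
  by congr Ex; apply/funext => x; rewrite mulr_suml.
have bA : bm (fun x => \sum_(1 <= h < N.+1) w (Tz S Si (- h%:Z) x)) by exact: bm_sum.
have key : `|Ex nu (fun x => (\sum_(1 <= h < N.+1) w (Tz S Si (- h%:Z) x)) * w x)
    - N%:R * c * Ex nu w| <= 2 * e1 * N%:R.
  rewrite -(ExZ nu _ bw) -ExB; [|by bmct|by bmct].
  have bB : bm (fun x => \sum_(1 <= h < N.+1) `|complex.Re (g (Tz S Si (- h%:Z) x)) - c|).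
    by apply: bm_sum => h; bmct; exact: bgT.
  apply: (@le_trans _ _ (Ex nu (fun x => e1 * N%:R +
     \sum_(1 <= h < N.+1) `|complex.Re (g (Tz S Si (- h%:Z) x)) - c|))).
    apply: le_trans (le_norm_Ex _ _) _; first by bmct.
    apply: le_Ex; [by bmct|by bmct|move=> x].
    rewrite -mulrBl normrM.
    apply: (@le_trans _ _ (`|\sum_(1 <= h < N.+1) w (Tz S Si (- h%:Z) x) - N%:R * c| * 1)).
      by rewrite ler_wpM2l.
    rewrite mulr1.
    have -> : N%:R * c = \sum_(1 <= h < N.+1) c.
      by rewrite sumr_const_nat subn1 /= mulr_natl.
    rewrite -sumrB.
    under eq_bigr => h _ do rewrite -(subrKA (complex.Re (g (Tz S Si (- h%:Z) x)))).
    rewrite big_split /=; apply: le_trans (ler_normD _ _) _; apply: lerD.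
      rewrite -normrN -sumrN; under eq_bigr do rewrite opprB.
      exact: hN0.
    exact: ler_norm_sum.
  rewrite ExD//; last exact: bm_cst.
  rewrite Ex_cst Ex_sum; last by move=> h; bmct; exact: bgT.
  rewrite (_ : 2 * e1 * N%:R = e1 * N%:R + \sum_(1 <= h < N.+1) e1); last first.
    by rewrite sumr_const_nat subn1 /= -mulr_natr; ring.
  rewrite lerD2l; apply: ler_sum => h _.
  rewrite (_ : Ex nu _ = Ex nu (fun x => `|complex.Re (g x) - c|))//.
  by apply: (Ex_Tz HS (- h%:Z) (f := fun x => `|complex.Re (g x) - c|)); bmct.
have E1 : `|Ex nu w| <= 1 by apply: norm_Ex_le.
have N0' : 0 <= N%:R :> R by [].
have e18 : e1 <= e / 8 by rewrite ge_min lexx.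
move: key wc E1; rewrite !ler_norml; set A := Ex nu _; set W := Ex nu w.
move=> /andP[k1 k2] /andP[c1 c2] /andP[E1 E2].
have d1 : - e1 <= (W - c) * W <= e1 by nrac.
have : - (e1 * N%:R) <= N%:R * ((W - c) * W) <= e1 * N%:R.
  move: d1; set D := (W - c) * W => /andP[d1 d2].
  by apply/andP; split; nrac.
have : e1 * N%:R <= e / 8 * N%:R by rewrite ler_wpM2r.
move=> h1 /andP[h2 h3]; apply/andP; split; nrac.
Qed.

Lemma mean_ergodic (w : X -> R) : bm w ->
  forall e, 0 < e -> exists N0, forall N, (N0 <= N)%N ->
  `|\sum_(1 <= h < N.+1) Ex nu (fun x => w (Tz S Si (- h%:Z) x) * w x)
    - N%:R * Ex nu w ^+ 2| <= e * N%:R.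
Proof.
move=> bw e e0; have [_ [M wM]] := bw.
pose K := Num.max M 1.
have K0 : 0 < K by rewrite lt_max ltr01 orbT.
have wK x : `|K^-1 * w x| <= 1.
  by rewrite normrM gtr0_norm ?invr_gt0// ler_pdivrMl// mulr1 le_max wM.
have bu : bm (fun x => K^-1 * w x) by bmct.
have K20 : 0 < K ^+ 2 by rewrite exprn_gt0.
have [N0 hN0] := mean_ergodic_unit bu wK (divr_gt0 e0 K20).
exists N0 => N /hN0; rewrite ExZ//.
have E h : Ex nu (fun x => K^-1 * w (Tz S Si (- h%:Z) x) * (K^-1 * w x)) =
    (K ^+ 2)^-1 * Ex nu (fun x => w (Tz S Si (- h%:Z) x) * w x).
  rewrite -ExZ; last by apply: bmM => //; exact: (bm_Tz HS).
  by congr Ex; apply/funext => x; field; rewrite gt_eqF.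
under eq_bigr do rewrite E.
rewrite -mulr_sumr exprMn exprVn mulrCA -mulrBr normrM gtr0_norm ?invr_gt0//.
rewrite ler_pdivrMl// (_ : K ^+ 2 * _ = e * N%:R)//; field; rewrite gt_eqF//.
Qed.

End HullConsequences.

(** * Almost homomorphisms into the circle *)

Section CircleArgument.
Context {R : realType}.
Implicit Types (t : R) (z : R[i]).

Lemma expeD (a b : R) : expe (a + b) = expe a * expe b.
Proof.
rewrite /expe mulrDr cosD sinD; apply/eqP; rewrite eq_complex /=.
by apply/andP; split; apply/eqP; ring.
Qed.

Lemma expe0 : expe (0 : R) = 1.
Proof. by rewrite /expe mulr0 cos0 sin0. Qed.

Lemma cmod_expe t : cmod (expe t) = 1.
Proof. by rewrite /cmod /= cos2Dsin2 sqrtr1. Qed.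

Lemma expeN t : expe (- t) = conjc (expe t).
Proof. by rewrite /expe mulrN cosN sinN. Qed.

Lemma expeB (a b : R) : expe (a - b) = expe a * conjc (expe b).
Proof. by rewrite expeD expeN. Qed.

Lemma expe1 : expe (1 : R) = 1.
Proof.
by rewrite /expe mulr1 (_ : 2 * pi = pi *+ 2); [rewrite cos2pi sin2pi|rewrite mulr2n; ring].
Qed.

Lemma expe_nat (n : nat) : expe (n%:R : R) = 1.
Proof.
by elim: n => [|n IH]; rewrite ?expe0// -natr1 expeD IH expe1 mulr1.
Qed.

Lemma expe_int (k : int) : expe (k%:~R : R) = 1.
Proof.
case: k => n; first exact: expe_nat.
by rewrite NegzE mulrNz expeN expe_nat conjc1.
Qed.

Lemma expeX t (n : nat) : expe (n%:R * t) = expe t ^+ n.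
Proof.
elim: n => [|n IH]; first by rewrite mul0r expe0.
by rewrite -natr1 mulrDl mul1r expeD IH exprSr.
Qed.

Lemma expe_eq1 t : expe t = 1 -> exists k : int, t = k%:~R.
Proof.
move=> t1; exists (Num.floor t).
pose s := t - (Num.floor t)%:~R.
have s1 : expe s = 1 by rewrite expeB expe_int t1 conjc1 mulr1.
have s0 : 0 <= s by rewrite subr_ge0 floor_le_tmp.
have sl1 : s < 1 by rewrite ltrBlDl -[X in _ + X](mulr1z 1) -intrD floorD1_gt.
have pi0 := pi_gt0 R.
have cs : cos (2 * pi * s) = 1 by move: s1 => [].
suff : s = 0 by move/eqP; rewrite subr_eq0 => /eqP.
have [sh|sh] := leP s (1 / 2).
  suff : 2 * pi * s = 0 by move/eqP; rewrite !mulf_eq0 (gt_eqF pi0) pnatr_eq0 /= => /eqP.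
  by apply: cos_inj; rewrite ?in_itv/= ?cs ?cos0//; apply/andP; split; nra.
suff : 2 * pi * (1 - s) = 0.
  move/eqP; rewrite !mulf_eq0 (gt_eqF pi0) pnatr_eq0 /= subr_eq0 => /eqP s1'.
  by move: sl1; rewrite s1' ltxx.
apply: cos_inj; rewrite ?in_itv/=; try by apply/andP; split; nra.
rewrite cos0 -[RHS]cs -cosN -(cosD2pi (- _)); congr cos; rewrite mulr2n; ring.
Qed.

(** The argument measured in turns, in [-1/2, 1/2] on the unit circle. *)
Definition carg z : R :=
  if 0 <= complex.Im z then acos (complex.Re z) / (2 * pi)
  else - (acos (complex.Re z) / (2 * pi)).

Lemma Re_unit z : cmod z = 1 -> -1 <= complex.Re z <= 1.
Proof. by move=> z1; rewrite -ler_norml -z1; exact: Re_le_cmod. Qed.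

Lemma cargK z : cmod z = 1 -> expe (carg z) = z.
Proof.
move=> z1; have rz := Re_unit z1; have := cmod_sqr z; rewrite z1 expr1n => zz.
have pi2 : 2 * pi != 0 :> R by rewrite mulf_neq0// gt_eqF// pi_gt0.
have im2 : 1 - complex.Re z ^+ 2 = complex.Im z ^+ 2 by rewrite zz; ring.
rewrite /carg; case: ifPn => [i0|]; last first.
  rewrite -ltNge => i0; rewrite expeN /expe mulrCA divff// mulr1.
  rewrite acosK ?in_itv//= sin_acos// im2 sqrtr_sqr ltr0_norm// opprK.
  by rewrite [RHS](complexE z) /=; apply/eqP; rewrite eq_complex /=; apply/andP; split; apply/eqP; ring.
rewrite /expe mulrCA divff// mulr1.
rewrite acosK ?in_itv//= sin_acos// im2 sqrtr_sqr ger0_norm//.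
by case: (z).
Qed.

Lemma carg_le z : cmod z = 1 -> `|carg z| <= 1 / 2.
Proof.
move=> z1; have rz := Re_unit z1; have pi0 := pi_gt0 R.
have -> : `|carg z| = acos (complex.Re z) / (2 * pi).
  have pi2 : 0 <= 2 * pi :> R by rewrite mulr_ge0// ltW.
  by rewrite /carg; case: ifP => _; rewrite ?normrN ger0_norm// divr_ge0 ?acos_ge0.
by rewrite ler_pdivrMr ?mulr_gt0// (le_trans (acos_lepi rz))//; lra.
Qed.

Lemma cos_carg z : cmod z = 1 -> cos (2 * pi * `|carg z|) = complex.Re z.
Proof.
move=> z1; rewrite -[in RHS](cargK z1) /expe /=.
by case: (ger0P (carg z)) => _; rewrite ?mulrN ?cosN.
Qed.

Lemma carg_small (kappa : R) : 0 < kappa <= 1 / 2 ->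
  exists2 eta : R, 0 < eta &
    forall z, cmod z = 1 -> cmod (z - 1) < eta -> `|carg z| < kappa.
Proof.
move=> /andP[k0 k1]; have pi0 := pi_gt0 R.
have m0 : (0 : R) \in `[0, pi] by rewrite in_itv/= lexx ltW.
have mk : 2 * pi * kappa \in `[0, pi].
  by rewrite in_itv/=; apply/andP; split; nra.
have ck : cos (2 * pi * kappa) < 1.
  by rewrite -[ltRHS](@cos0 R) ltr_cos// !mulr_gt0.
exists (1 - cos (2 * pi * kappa)); first by rewrite subr_gt0.
move=> z z1 zs; rewrite ltNge; apply/negP => ka.
have : complex.Re z <= cos (2 * pi * kappa).
  have mz : 2 * pi * `|carg z| \in `[0, pi].
    have := carg_le z1; have := normr_ge0 (carg z); move: `|_| => u *.
    by rewrite in_itv/=; apply/andP; split; nra.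
  by rewrite -(cos_carg z1) leNgt ltr_cos// -leNgt ler_pM2l// mulr_gt0.
have := Re_le_cmod (z - 1); rewrite cReD cReN /= ler_norml => /andP[+ _]; lra.
Qed.

Lemma expe_small (rho : R) : 0 < rho -> exists2 kappa : R, 0 < kappa <= 1 / 8 &
  forall t, `|t| <= kappa -> cmod (expe t - 1) <= rho.
Proof.
move=> rho0; have pi0 := pi_gt0 R.
have : (fun t : R => 2 - 2 * cos (2 * pi * t)) t @[t --> (0 : R)] --> (2 - 2 * cos (2 * pi * 0) : R).
  apply: cvgB; first exact: cvg_cst.
  apply: cvgM; first exact: cvg_cst.
  apply: (continuous_cvg _ (@continuous_cos R _)).
  by apply: cvgM; [exact: cvg_cst|exact: cvg_id].
rewrite mulr0 cos0 mulr1 subrr => /cvgr0_norm_lt /(_ _ (exprn_gt0 2 rho0)).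
move=> /nbhs_ballP[r /= r0 hr].
exists (Num.min (r / 2) (1 / 8)).
  by rewrite lt_min ge_min lexx orbT !divr_gt0// andbT; lra.
move=> t; rewrite le_min => /andP[tr _].
rewrite -(ler_pXn2r (n := 2)) ?nnegrE ?cmod_ge0 ?(ltW rho0)//.
have -> : cmod (expe t - 1) ^+ 2 = 2 - 2 * cos (2 * pi * t).
  rewrite cmod_sqr cReD cImD cReN cImN /=.
  have := cos2Dsin2 (2 * pi * t); lra.
apply: le_trans (ler_norm _) (ltW (hr t _)).
by rewrite -ball_normE /ball_ /= sub0r normrN; lra.
Qed.

Lemma near_int (x kappa : R) : `|carg (expe x)| < kappa -> exists k : int, `|x - k%:~R| < kappa.
Proof.
move=> h; have : expe (x - carg (expe x)) = 1.
  by rewrite expeB cargK ?mulcJ1// cmod_expe.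
by move=> /expe_eq1[k xk]; exists k; rewrite -xk opprB addrC subrK.
Qed.

Lemma int_lt1 (k : int) : `|k%:~R : R| < 1 -> k = 0.
Proof.
by rewrite -intr_norm (_ : 1 = 1%:~R :> R)// ltr_int => h; apply/eqP; rewrite -normr_le0; lia.
Qed.

(* [phi] lifts [c] to the reals; it is almost additive, and the slope of the nearby
   additive function is the supremum of [(phi n - kappa) / n]. *)
Lemma approx_hom (rho : R) : 0 < rho -> exists2 eta : R, 0 < eta &
  forall c : nat -> R[i], (forall n, cmod (c n) = 1) -> c 0%N = 1 ->
    (forall n m, cmod (c (n + m)%N - c n * c m) < eta) ->
    exists2 lam, cmod lam = 1 & forall n, cmod (c n - lam ^+ n) <= rho.
Proof.
move=> /expe_small[kappa /andP[k0 k8] hk].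
have [|eta eta0 heta] := @carg_small kappa; first by rewrite k0; lra.
exists eta => // c c1 c0 chom.
pose q n m := c (n + m)%N * conjc (c n * c m).
have q1 n m : cmod (q n m) = 1 by rewrite cmodM cmodJ cmodM !c1 !mulr1.
have qsmall n m : `|carg (q n m)| < kappa.
  apply: heta => //; apply: le_lt_trans (chom n m); rewrite /q.
  have u1 : cmod (c n * c m) = 1 by rewrite cmodM !c1 mulr1.
  by rewrite -(mulcJ1 u1) -mulrBl cmodM cmodJ u1 mulr1.
pose phi n := n%:R * carg (c 1%N) + \sum_(0 <= i < n) carg (q i 1%N).
have phiS n : phi n.+1 = phi n + carg (c 1%N) + carg (q n 1%N).
  by rewrite /phi big_nat_recr//= -natr1; ring.
have phi0 : phi 0%N = 0 by rewrite /phi big_geq// mul0r addr0.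
have ephi n : expe (phi n) = c n.
  elim: n => [|n IH]; first by rewrite /phi big_geq// mul0r addr0 expe0 c0.
  rewrite phiS expeD (expeD (phi n)) IH !cargK// /q conjcM addn1.
  have := mulcJ1 (c1 n); have := mulcJ1 (c1 1%N); move: (c n) (c 1%N) (c n.+1) => a b e hb ha.
  by transitivity (e * (a * conjc a) * (b * conjc b)); [ring|rewrite ha hb !mulr1].
pose D n m := phi (n + m)%N - phi n - phi m.
have eD n m : expe (D n m) = q n m.
  by rewrite /D !expeB !ephi /q conjcM mulrA.
(* [D n m] is always within kappa of an integer. One step in m moves it by less than 2 kappa, so
   with kappa <= 1/8 this integer cannot leave 0. *)
have Dsmall n m : `|D n m| < kappa.
  elim: m => [|m IH]; first by rewrite /D addn0 phi0 subr0 subrr normr0.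
  have Drec : D n m.+1 = D n m + carg (q (n + m)%N 1%N) - carg (q m 1%N).
    by rewrite /D addnS !phiS; ring.
  have := qsmall n m.+1; rewrite -eD => /near_int[k hk'].
  have k00 : k = 0.
    apply: int_lt1; have := qsmall (n + m)%N 1%N; have := qsmall m 1%N.
    move: hk' IH; rewrite Drec; move: (k%:~R : R) (D n m) (carg _) (carg _) => a b e f.
    rewrite !ltr_norml => /andP[? ?] /andP[? ?] /andP[? ?] /andP[? ?].
    by apply/andP; split; lra.
  by move: hk'; rewrite k00 subr0.
have phiM n m : `|phi (n * m)%N - n%:R * phi m| <= n%:R * kappa.
  elim: n => [|n IH]; first by rewrite mul0n phi0 !mul0r subr0 normr0.
  have := Dsmall m (n * m)%N; rewrite /D -mulSn => h.
  rewrite -natr1; move: h IH; rewrite ltr_norml !ler_norml => /andP[? ?] /andP[? ?].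
  by apply/andP; split; lra.
pose E := [set (phi n.+1 - kappa) / n.+1%:R | n in setT].
have cross n m : (phi n.+1 - kappa) / n.+1%:R <= (phi m.+1 + kappa) / m.+1%:R.
  rewrite ler_pdivrMr// mulrAC ler_pdivlMr//.
  have := phiM n.+1 m.+1; have := phiM m.+1 n.+1; rewrite mulnC.
  by rewrite !ler_norml => /andP[? ?] /andP[? ?]; lra.
have E0 : has_sup E.
  split; first by exists ((phi 1%N - kappa) / 1), 0%N.
  by exists ((phi 1%N + kappa) / 1) => _ [n _ <-]; exact: (cross n 0%N).
pose L := sup E.
have phiL n : `|phi n - n%:R * L| <= kappa.
  case: n => [|n]; first by rewrite phi0 mul0r subr0 normr0 ltW.
  have h1 : (phi n.+1 - kappa) / n.+1%:R <= L by apply: ub_le_sup; [exact: E0.2|exists n].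
  have h2 : L <= (phi n.+1 + kappa) / n.+1%:R.
    by apply: ge_sup; [exact: E0.1|move=> _ [m _ <-]; exact: cross].
  move: h1 h2; rewrite ler_pdivrMr// ler_pdivlMr// ler_norml => h1 h2.
  by apply/andP; split; lra.
exists (expe L); first exact: cmod_expe.
move=> n; rewrite -ephi -expeX.
rewrite -{1}(subrK (n%:R * L) (phi n)) expeD -[X in _ - X]mul1r -mulrBl cmodM cmod_expe mulr1.
exact: hk.
Qed.

End CircleArgument.

Section MeasurableArgument.
Context {d : measure_display} {X : measurableType d} {R : realType}.

(** [acos] is handled through its superlevel sets: for a in [0, pi], a < acos r amounts to r < cos
    a. *)
Lemma measurable_carg (f : X -> R[i]) : cmeasurable f ->
  (forall x, cmod (f x) = 1) -> measurable_fun setT (fun x => carg (f x)).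
Proof.
move=> [mr mi] f1.
have mac : measurable_fun setT (fun x => acos (complex.Re (f x)) / (2 * pi)).
  apply: measurable_funM; last exact: measurable_cst.
  move=> _; apply: (measurability _ (RGenOInfty.measurableE R)) => // _ [_ [a ->] <-].
  rewrite setTI preimage_itvoy.
  have [a0|a0] := ltP a 0.
    rewrite [X in measurable X](_ : _ = setT)//; apply/seteqP; split => x //= _.
    by apply: lt_le_trans a0 _; apply: acos_ge0; exact: Re_unit.
  have [api|api] := ltP pi a.
    rewrite [X in measurable X](_ : _ = set0)//; apply/seteqP; split => x //=.
    by rewrite ltNge (le_trans (acos_lepi (Re_unit (f1 x))))// ltW.
  rewrite [X in measurable X](_ : _ = (fun x => complex.Re (f x)) @^-1` `]-oo, (cos a)[).
    by rewrite -[X in measurable X]setTI; apply: mr => //; exact: measurable_itv.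
  apply/funext => x; rewrite /= in_itv /= -{2}(@acosK _ (complex.Re (f x))); last first.
    by rewrite in_itv /=; exact: Re_unit.
  rewrite ltr_cos//; rewrite in_itv /= ?a0//.
  by rewrite acos_ge0 ?acos_lepi//; exact: Re_unit.
apply: measurable_fun_ifT => //.
- by apply: measurable_fun_ler => //; exact: measurable_cst.
- exact: measurableT_comp.
Qed.

End MeasurableArgument.

(** * Phase polynomials and cocycle rigidity *)

Section PhasePolynomials.
Context {d : measure_display} {X : measurableType d} {R : realType}.

Lemma ae_cst (nu : probability X R) (P : Prop) : {ae nu, forall x, P} -> P.
Proof.
move=> [A [mA A0 PA]]; apply: contrapT => nP.
have AT : A = setT by apply/seteqP; split => // x _; apply: PA => /=.
move: A0; rewrite AT => A0.
have := probability_setT nu.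
by rewrite -[X in X = _]/(nu setT) A0 => -[] /eqP; rewrite eq_sym oner_eq0.
Qed.

Definition uni (q : X -> R[i]) : Prop := bmc q /\ forall x, cmod (q x) = 1.

Lemma uniM q q' : uni q -> uni q' -> uni (fun x => q x * q' x).
Proof.
move=> [b1 u1] [b2 u2]; split; first by bmct.
by move=> x; rewrite cmodM u1 u2 mulr1.
Qed.

Lemma uniJ q : uni q -> uni (fun x => conjc (q x)).
Proof. by move=> [b1 u1]; split; [bmct|move=> x; rewrite cmodJ]. Qed.

Lemma uni_cst c : cmod c = 1 -> uni (fun=> c).
Proof. by move=> c1; split => //; exact: bmc_cst. Qed.

Lemma uni_comp q (g : X -> X) : measurable_fun setT g -> uni q -> uni (fun x => q (g x)).
Proof. by move=> mg [b u]; split => //; exact: (bmc_comp mg b). Qed.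

(** [ph] completed by the value 1 at 0: unimodular everywhere, but multiplicative only away from
    0. *)
Definition uph (z : R[i]) : R[i] := ph z + cR (cmod z == 0)%:R.

Lemma cmod_uph z : cmod (uph z) = 1.
Proof.
rewrite /uph; have [->|z0] := eqVneq z 0; first by rewrite ph0 cmod0 eqxx add0r cmod1.
have /negPf -> : cmod z != 0 by apply: contraNneq z0 => /cmod_eq0 ->.
by rewrite cR0 addr0 cmod_ph.
Qed.

Lemma uph_ph z : z != 0 -> uph z = ph z.
Proof.
move=> z0; rewrite /uph.
have /negPf -> : cmod z != 0 by apply: contraNneq z0 => /cmod_eq0 ->.
by rewrite cR0 addr0.
Qed.

Lemma uni_uph (f : X -> R[i]) : cmeasurable f -> uni (fun x => uph (f x)).
Proof.
move=> mf; split; last by move=> x; exact: cmod_uph.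
apply: bmcD; first exact: bmc_ph.
apply: bmc_cR; split; last first.
  by exists 1 => x; case: (_ == _); rewrite ?normr1 ?normr0.
have -> : (fun x => (cmod (f x) == 0)%:R) = \1_[set x | cmod (f x) = 0] :> (X -> R).
  apply/funext => x; rewrite indicE; congr (nat_of_bool _)%:R.
  by apply/eqP/idP; rewrite inE.
apply: measurable_indic.
rewrite (_ : [set _ | _] = (fun x => cmod (f x)) @^-1` [set 0]); last by [].
by rewrite -[X in measurable X]setTI; apply: (cmeas_cmod mf).
Qed.

Variables (nu : probability X R) (S Si : X -> X).
Hypothesis HS : mps nu S Si.

(* The phase polynomials of degree at most [n - 1]; differences along [-1] suffice, since they
   generate all the others. *)
Fixpoint PP (n : nat) (q : X -> R[i]) : Prop :=
  match n with
  | 0 => {ae nu, forall x, q x = 1}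
  | n'.+1 => PP n' (fun x => q (Si x) * conjc (q x))
  end.

Lemma ae_Si (P : X -> Prop) : {ae nu, forall x, P x} -> {ae nu, forall x, P (Si x)}.
Proof. exact: (ae_Tz HS (- 1)). Qed.

Lemma PP_ae n q q' : {ae nu, forall x, q x = q' x} -> PP n q -> PP n q'.
Proof.
elim: n q q' => [|n IH] q q' qq' /= hq.
  by apply: filterS2 qq' hq => x /= <-.
apply: IH hq; apply: filterS2 qq' (ae_Si qq') => x /= -> -> //.
Qed.

Lemma PPM n q q' : PP n q -> PP n q' -> PP n (fun x => q x * q' x).
Proof.
elim: n q q' => [|n IH] q q' /= hq hq'.
  by apply: filterS2 hq hq' => x /= -> ->; rewrite mulr1.
have := IH _ _ hq hq'; congr PP; apply/funext => x.
by rewrite conjcM mulrACA.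
Qed.

Lemma PPJ n q : PP n q -> PP n (fun x => conjc (q x)).
Proof.
elim: n q => [|n IH] q /= hq.
  by apply: filterS hq => x /= ->; rewrite conjc1.
by have := IH _ hq; congr PP; apply/funext => x; rewrite conjcM.
Qed.

Lemma PP_Tz n q h : PP n q -> PP n (fun x => q (Tz S Si h x)).
Proof.
have [_ _ SK SiK _] := HS.
elim: n q => [|n IH] q /= hq; first exact: (ae_Tz HS h hq).
have := IH _ hq; congr PP; apply/funext => x.
by rewrite -[Si (Tz S Si h x)]/(Tz S Si (- 1) (Tz S Si h x)) -(TzD SK SiK) addrC (TzD SK SiK).
Qed.

Lemma PP_succ n q : PP n q -> PP n.+1 q.
Proof. by move=> hq /=; apply: PPM; [exact: (PP_Tz (- 1))|exact: PPJ]. Qed.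

Lemma PP_cst n c : cmod c = 1 -> PP n.+1 (fun=> c).
Proof.
move=> c1; elim: n => [|n IH]; last exact: PP_succ.
by rewrite /=; apply: aeW => x; exact: mulcJ1.
Qed.

Hypothesis erg : ergodic nu Si.

Lemma ergodic_cst (q : X -> R[i]) : bmc q -> {ae nu, forall x, q (Si x) = q x} ->
  exists c, {ae nu, forall x, q x = c}.
Proof.
move=> bq inv.
have [a ha] : exists a, {ae nu, forall x, complex.Re (q x) = a}.
  by apply: erg; [exact: bq.1|apply: filterS inv => x /= ->].
have [b hb] : exists b, {ae nu, forall x, complex.Im (q x) = b}.
  by apply: erg; [exact: bq.2|apply: filterS inv => x /= ->].
exists (Complex a b); apply: filterS2 ha hb => x /=.
by case: (q x) => u v /= -> ->.
Qed.

(** If q is within 1/2^n of 1, its derivative is within 1/2^(n-1) of 1, hence constant by induction,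
    and q is an eigenfunction. An eigenvalue other than 1 forces integral 0 and so distance at least
    1 from the constant 1; for the eigenvalue 1, ergodicity concludes. *)
Lemma PP_rigid n q : uni q -> PP n q ->
  Ex nu (fun x => cmod (q x - 1)) < (1 / 2) ^+ n ->
  exists2 c, cmod c = 1 & {ae nu, forall x, q x = c}.
Proof.
elim: n q => [|n IH] q [bq uq] hq close.
  by exists 1; [exact: cmod1|exact: hq].
have bSi : bmc (fun x => q (Si x)) := bmc_Tz HS (- 1) bq.
have E1 : Ex nu (fun x => cmod (q (Si x) - 1)) = Ex nu (fun x => cmod (q x - 1)).
  by apply: (Ex_Tz HS (- 1) (f := fun x => cmod (q x - 1))); bmct.
have b1 : bmc (fun _ : X => 1 : R[i]) := bmc_cst 1.
have [||lam lam1 hlam] := IH (fun x => q (Si x) * conjc (q x)) _ hq.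
- by apply: uniM; [split|exact: uniJ].
- apply: (@le_lt_trans _ _ (Ex nu (fun x => cmod (q (Si x) - 1) + cmod (q x - 1)))).
    apply: le_Ex; [by bmct|by bmct|move=> x].
    rewrite -{1}(mulcJ1 (uq x)) -mulrBl cmodM cmodJ uq mulr1 (cmodBC (q x) 1).
    exact: cmod_triB.
  rewrite ExD ?E1; try by bmct.
  by move: close; rewrite exprS; lrac.
have qlam : {ae nu, forall x, q (Si x) = lam * q x}.
  by apply: filterS hlam => x /= <-; rewrite -mulrA (mulJc1 (uq x)) mulr1.
have [bqr bqi] := bq.
have Er : Ex nu (fun x => complex.Re (q x)) =
    complex.Re lam * Ex nu (fun x => complex.Re (q x)) -
    complex.Im lam * Ex nu (fun x => complex.Im (q x)).
  rewrite -[LHS](Ex_Si HS bqr) -!ExZ -?ExB; try by bmct.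
  apply: eq_ae_Ex; [exact: bSi.1|by bmct|].
  by apply: filterS qlam => x /= ->; rewrite cReM.
have Ei : Ex nu (fun x => complex.Im (q x)) =
    complex.Re lam * Ex nu (fun x => complex.Im (q x)) +
    complex.Im lam * Ex nu (fun x => complex.Re (q x)).
  rewrite -[LHS](Ex_Si HS bqi) -!ExZ -?ExD; try by bmct.
  apply: eq_ae_Ex; [exact: bSi.2|by bmct|].
  by apply: filterS qlam => x /= ->; rewrite cImM.
have lamE : lam = 1.
  apply: contrapT => ln1.
  have : (1 - lam) * Complex (Ex nu (fun x => complex.Re (q x))) (Ex nu (fun x => complex.Im (q x))) = 0.
    apply/eqP; rewrite eq_complex; apply/andP; split; apply/eqP.
    - by rewrite cReM cReD cReN cImD cImN /= add0r mulrBl mul1r; move: Er; lrac.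
    - by rewrite cImM cReD cReN cImD cImN /= add0r mulrBl mul1r; move: Ei; lrac.
  move/eqP; rewrite mulf_eq0 subr_eq0 eq_sym => /orP[/eqP //|/eqP[Er0 _]].
  move: close; apply/negP; rewrite -leNgt.
  apply: (@le_trans _ _ (Ex nu (fun x => 1 - complex.Re (q x)))).
    rewrite ExB ?Er0 ?Ex_cst//; last exact: bm_cst.
    by rewrite subr0; apply: exprn_ile1; lra.
  apply: le_Ex; [by bmct|by bmct|move=> x].
  apply: le_trans (ler_norm _) _.
  by rewrite cmodBC; apply: le_trans (Re_le_cmod _); rewrite cReD cReN.
have [|c hc] := @ergodic_cst q bq.
  by apply: filterS qlam => x /= ->; rewrite lamE mul1r.
exists c => //; apply: (@ae_cst nu).
by apply: filterS hc => x /= <-.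
Qed.

End PhasePolynomials.

(** * From approximate derivatives to an exact phase polynomial *)

Section CocycleRigidity.
Context {R : realType}.

(** The approximate derivative [phi] generates a cocycle [phn], and u o T^(-n) stays close to c_n
    (phn n) u for a constant c_n. Once c_n is replaced by lam^n, u is almost fixed by the twist of
    weight conj (lam phi); the phase of the nearby fixed point has derivative lam phi exactly. *)
Lemma cocycle_rigidity (K : nat) (delta : R) : 0 < delta ->
  exists2 xi : R, 0 < xi & forall (d : measure_display) (X : measurableType d)
    (nu : probability X R) (S Si : X -> X), mps nu S Si -> ergodic nu Si ->
    forall u : X -> R[i], uni u ->
    (forall g : int, exists q, [/\ uni q, PP nu Si K.+1 q &
      Ex nu (fun x => cmod (u (Tz S Si (- g) x) * conjc (u x) - q x)) <= xi]) ->
    exists q, [/\ uni q, PP nu Si K.+2 q & Ex nu (fun x => cmod (u x - q x)) <= delta].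
Proof.
move=> delta0.
(* The fixed point lies at mean distance e from u with e^2 <= 4 beta. The two bounds on beta give e
   <= delta / 2 and e <= 1 / 2; the second keeps its modulus away from 0. *)
pose beta : R := Num.min (delta ^+ 2 / 16) (1 / 32).
have beta0 : 0 < beta by rewrite lt_min divr_gt0 ?exprn_gt0//= divr_gt0.
have [eta eta0 heta] := @approx_hom R (beta / 2) (divr_gt0 beta0 (ltr0n _ 2)).
pose kK : R := (1 / 2) ^+ K.+1.
have kK0 : 0 < kK by apply: exprn_gt0; lra.
(* The three bounds serve [close], then [chom], where three errors add up against eta, then
   rigidity, where three errors add up against 1/2^(K+1). *)
pose xi : R := Num.min (beta / 2) (Num.min (eta / 4) (kK / 4)).
have xi0 : 0 < xi by rewrite !lt_min !divr_gt0.
have xib : xi <= beta / 2 by rewrite ge_min lexx.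
have xie : xi <= eta / 4 by rewrite !ge_min lexx orbT.
have xik : xi <= kK / 4 by rewrite !ge_min lexx !orbT.
exists xi => // d X nu S Si HS erg u [bu uu] hyp.
have [_ _ SK SiK _] := HS.
have mT n : measurable_fun setT (Tz S Si n) := measurable_Tz HS n.
have mSi : measurable_fun setT Si := mT (- 1).
have [phi [[bphi uphi] Pphi hphi]] := hyp 1.
pose fix phn (n : nat) : X -> R[i] :=
  if n is n'.+1 then fun x => phn n' (Si x) * phi x else fun=> 1.
have uphn n : uni (phn n).
  elim: n => [|n IH] /=; first exact/uni_cst/cmod1.
  by apply: uniM => //; exact: uni_comp.
have bphn n : bmc (phn n) := (uphn n).1.
have Pphn n : PP nu Si K.+1 (phn n).
  elim: n => [|n IH]; first exact/(PP_cst HS)/cmod1.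
  by apply: PPM => //; exact: (PP_Tz HS (- 1)).
have phnD n m x : phn (n + m)%N x = phn n (Tz S Si (- m%:Z) x) * phn m x.
  elim: m x => [|m IH] x; first by rewrite addn0 mulr1.
  rewrite addnS -[LHS]/(phn (n + m)%N (Si x) * phi x) IH.
  rewrite -[phn m.+1 x]/(phn m (Si x) * phi x) mulrA.
  congr (phn n _ * _ * _).
  by rewrite -[Si x]/(Tz S Si (- 1) x) -(TzD SK SiK) -addn1 PoszD opprD.
have buT n : bmc (fun x => u (Tz S Si n x)) := bmc_Tz HS n bu.
have bphnT n m : bmc (fun x => phn n (Tz S Si m x)) := bmc_Tz HS m (bphn n).
pose D n (c : R[i]) := Ex nu (fun x => cmod (u (Tz S Si (- n%:Z) x) - c * phn n x * u x)).
have bD n c : bm (fun x => cmod (u (Tz S Si (- n%:Z) x) - c * phn n x * u x)).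
  by bmct.
have DT n c m : Ex nu (fun x => cmod (u (Tz S Si (- (n + m)%N%:Z) x)
     - c * phn n (Tz S Si (- m%:Z) x) * u (Tz S Si (- m%:Z) x))) = D n c.
  rewrite /D -[RHS](Ex_Tz HS (- m%:Z)) //; congr Ex; apply/funext => x.
  by rewrite -(TzD SK SiK) PoszD opprD.
have bDT n c m : bm (fun x => cmod (u (Tz S Si (- (n + m)%N%:Z) x)
     - c * phn n (Tz S Si (- m%:Z) x) * u (Tz S Si (- m%:Z) x))).
  by bmct.
have comp n m c c' : cmod c = 1 ->
    Ex nu (fun x => cmod (u (Tz S Si (- (n + m)%N%:Z) x) - (c * c') * phn (n + m)%N x * u x))
      <= D n c + D m c'.
  move=> c1; rewrite -(DT n c m) /D -ExD//.
  apply: le_Ex; [exact: bD|by bmct|move=> x].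
  apply: le_trans (cmod_triB _ (c * phn n (Tz S Si (- m%:Z) x) * u (Tz S Si (- m%:Z) x)) _) _.
  rewrite lerD2l phnD.
  have -> : c * c' * (phn n (Tz S Si (- m%:Z) x) * phn m x) * u x =
     c * phn n (Tz S Si (- m%:Z) x) * (c' * phn m x * u x) by ring.
  by rewrite -mulrBr !cmodM c1 (uphn n).2 !mul1r.
(* Composing with one more step raises the error to 3 xi, still below the rigidity threshold. So the
   approximant given for n+1 is a constant multiple of [phn n.+1], and with that constant the error
   is [xi] again. *)
have claim n : exists c, cmod c = 1 /\ D n c <= xi.
  elim: n => [|n [c [c1 hc]]].
    exists 1; split; first exact: cmod1.
    rewrite /D (_ : (fun x => _) = fun=> 0) ?Ex_cst ?ltW//.
    by apply/funext => x; rewrite oppr0 Tz0 !mul1r subrr cmod0.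
  have [p [[bp up] Pp hp]] := hyp n.+1.
  have D1 : D 1%N 1 <= xi.
    apply: le_trans hphi; apply: le_Ex; [exact: bD|by bmct|move=> x].
    by rewrite /= !mul1r cmod_mulJB.
  have [|||c' c'1 hc'] := @PP_rigid _ _ _ nu S Si HS erg K.+1
      (fun x => p x * conjc (c * phn n.+1 x)).
  - by apply: uniM => //; apply: uniJ; apply: uniM => //; exact: uni_cst.
  - by apply: PPM => //; apply: PPJ; apply: PPM => //; exact: (PP_cst HS).
  - apply: (@le_lt_trans _ _ (Ex nu (fun x => cmod (u (Tz S Si (- n.+1%:Z) x) * conjc (u x) - p x)
       + cmod (u (Tz S Si (- (n + 1)%N%:Z) x) - (c * 1) * phn (n + 1)%N x * u x)))).
      apply: le_Ex; [by bmct|by bmct|move=> x].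
      have cphi1 : cmod (c * phn n.+1 x) = 1 by rewrite cmodM c1 (uphn _).2 mulr1.
      rewrite -{1}(mulcJ1 cphi1) -mulrBl cmodM cmodJ cphi1 mulr1.
      rewrite (cmodBC _ (p x)).
      apply: le_trans (cmod_triB _ (u (Tz S Si (- n.+1%:Z) x) * conjc (u x)) _) _.
      by rewrite lerD2l addn1 mulr1 cmod_mulJB.
    rewrite ExD; [|by bmct|by bmct].
    have := comp n 1%N c 1 c1; move: hp D1 hc xik kK0; rewrite -/kK.
    set a := Ex _ _; set b := Ex _ _; move: (D 1%N 1) (D n c) => e f; lrac.
  exists (c' * c); split; first by rewrite cmodM c'1 c1 mulr1.
  apply: le_trans hp; apply: le_ae_Ex; [exact: bD|by bmct|].
  apply: filterS hc' => x /= hx.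
  have px : p x = c' * c * phn n.+1 x.
    have cphi1 : cmod (c * phn n.+1 x) = 1 by rewrite cmodM c1 (uphn _).2 mulr1.
    by rewrite -mulrA -hx -mulrA (mulJc1 cphi1) mulr1.
  by rewrite px cmod_mulJB.
have [c0 hc0] := choice claim.
pose c n := if n is n'.+1 then c0 n'.+1 else 1.
have c1 n : cmod (c n) = 1 by case: n => [|n]; [exact: cmod1|exact: (hc0 _).1].
have hc n : D n (c n) <= xi.
  case: n => [|n]; last exact: (hc0 _).2.
  rewrite /D (_ : (fun x => _) = fun=> 0) ?Ex_cst ?ltW//.
  by apply/funext => x; rewrite oppr0 Tz0 !mul1r subrr cmod0.
have chom n m : cmod (c (n + m)%N - c n * c m) < eta.
  have : cmod (c (n + m)%N - c n * c m) <= D (n + m)%N (c (n + m)%N) + (D n (c n) + D m (c m)).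
    apply: le_trans (lerD (lexx _) (comp n m (c n) (c m) (c1 n))).
    rewrite -[leLHS](Ex_cst nu) /D -ExD; [|exact: bD|exact: bD].
    apply: le_Ex; [exact: bm_cst|by bmct|move=> x].
    have -> : cmod (c (n + m)%N - c n * c m) =
        cmod (c (n + m)%N * phn (n + m)%N x * u x - c n * c m * phn (n + m)%N x * u x).
      by rewrite -!mulrBl !cmodM uu (uphn _).2 !mulr1.
    apply: le_trans (cmod_triB _ (u (Tz S Si (- (n + m)%N%:Z) x)) _) _.
    by rewrite cmodBC.
  have := hc (n + m)%N; have := hc n; have := hc m.
  move: xie eta0; move: (D _ _) (D _ _) (D _ _) (cmod _) => a b e f; lrac.
have [lam lam1 hlam] := heta c c1 (erefl _) chom.
(* The conjugate weight undoes the cocycle: n twists of u give conj (lam^n phn n) times u o T^(-n),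
   which is close to u. *)
pose psi x := conjc (lam * phi x).
have bpsi : bmc psi by rewrite /psi; bmct.
have psi1 x : cmod (psi x) = 1 by rewrite cmodJ cmodM lam1 uphi mulr1.
have itpsi n x : iter n (twist Si psi) u x =
    conjc (lam ^+ n * phn n x) * u (Tz S Si (- n%:Z) x).
  elim: n x => [|n IH] x; first by rewrite (_ : lam ^+ 0 * phn 0%N x = 1) ?conjc1 ?mul1r ?mulr1.
  rewrite iterS /twist IH /psi exprS /=.
  have -> : Tz S Si (- n%:Z) (Si x) = Tz S Si (- n.+1%:Z) x.
    by rewrite -[Si x]/(Tz S Si (- 1) x) -(TzD SK SiK) -addn1 PoszD opprD.
  by rewrite !conjcM; ring.
have close n : Ex nu (fun x => cmod (iter n (twist Si psi) u x - u x) ^+ 2) <= 2 * beta.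
  have E x : cmod (iter n (twist Si psi) u x - u x) =
      cmod (u (Tz S Si (- n%:Z) x) - lam ^+ n * phn n x * u x).
    have l1 : cmod (lam ^+ n * phn n x) = 1.
      by rewrite cmodM cmodX lam1 expr1n (uphn _).2 mulr1.
    rewrite itpsi -[LHS]mul1r -l1 -cmodM mulrBr mulrA (mulcJ1 l1) mul1r//.
  have bE : bm (fun x => cmod (u (Tz S Si (- n%:Z) x) - lam ^+ n * phn n x * u x)) by exact: bD.
  under eq_fun do rewrite E.
  apply: (@le_trans _ _ (Ex nu (fun x => 2 *
    (cmod (u (Tz S Si (- n%:Z) x) - c n * phn n x * u x) + cmod (c n - lam ^+ n))))).
    apply: le_Ex; [by bmct|by bmct|move=> x].
    have h2 : cmod (u (Tz S Si (- n%:Z) x) - lam ^+ n * phn n x * u x) <= 2.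
      apply: le_trans (cmodD _ _) _; rewrite cmodN !cmodM cmodX lam1 expr1n (uphn _).2 !uu.
      by rewrite !mulr1; lra.
    have h3 : cmod (u (Tz S Si (- n%:Z) x) - lam ^+ n * phn n x * u x) <=
      cmod (u (Tz S Si (- n%:Z) x) - c n * phn n x * u x) + cmod (c n - lam ^+ n).
      apply: le_trans (cmod_triB _ (c n * phn n x * u x) _) _.
      by rewrite lerD2l -!mulrBl !cmodM (uphn _).2 uu !mulr1.
    have := cmod_ge0 (u (Tz S Si (- n%:Z) x) - lam ^+ n * phn n x * u x).
    move: h2 h3; move: (cmod _) (cmod _ + cmod _) => a b; nrac.
  rewrite ExZ ?ExD ?Ex_cst; try by bmct.
  have := hc n; have := hlam n; move: xib; rewrite -/(D n (c n)).
  move: (D _ _) (cmod _) => a b; lrac.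
have u1 x : cmod (u x) <= 1 by rewrite uu.
have [F [bF F2 Finv FE]] := almost_fixed HS bpsi psi1 bu u1 close.
(* The modulus of F is invariant, hence a constant r; as u has modulus 1, r is within e of 1 and
   normalising F costs at most e. *)
have [r Fr] : exists r, {ae nu, forall x, cmod (F x) = r}.
  apply: erg; first by bmct.
  by apply: filterS Finv => x /= ->; rewrite /twist cmodM psi1 mul1r.
pose e := Ex nu (fun x => cmod (F x - u x)).
have e0 : 0 <= e by apply: Ex_ge0 => x; exact: cmod_ge0.
have e2 : e ^+ 2 <= 4 * beta.
  have -> : e = Ex nu (fun x => `|cmod (F x - u x)|).
    by congr Ex; apply/funext => x; rewrite ger0_norm// cmod_ge0.
  apply: le_trans (Ex_norm_sqr _ _) _; first by bmct.
  by apply: le_trans FE _; lrac.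
have bd : beta <= delta ^+ 2 / 16 by rewrite ge_min lexx.
have b32 : beta <= 1 / 32 by rewrite !ge_min lexx orbT.
have ed : e <= delta / 2 by move: e0 delta0 e2 bd; nrac.
have eh : e <= 1 / 2 by move: e0 e2 b32; nrac.
have re : `|r - 1| <= e.
  rewrite -[leLHS](Ex_cst nu); apply: le_ae_Ex; [exact: bm_cst|by bmct|].
  apply: filterS Fr => x /= <-; rewrite ler_norml.
  have := cmodD (F x - u x) (u x); rewrite subrK uu.
  have := cmodD (u x - F x) (F x); rewrite subrK uu (cmodBC (u x)).
  by move: (cmod _) (cmod _) => a b; move=> ? ?; apply/andP; split; lrac.
have r0 : 0 < r by move: re eh; rewrite ler_norml => /andP[]; lrac.
have F0 : {ae nu, forall x, F x != 0}.
  apply: filterS Fr => x /= Fxr; apply/eqP => Fx0.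
  by move: r0; rewrite -Fxr Fx0 cmod0 ltxx.
exists (fun x => uph (F x)); split.
- exact: (uni_uph (bmc_cmeas bF)).
- change (PP nu Si K.+1 (fun x => uph (F (Si x)) * conjc (uph (F x)))).
  apply: (PP_ae HS (q := fun x => lam * phi x)); last first.
    by apply: (PPM (q := fun=> lam)) => //; exact: (PP_cst HS K lam1).
  apply: filterS3 Finv F0 (ae_Si HS F0) => x /= Fx Fx0 FSx0.
  rewrite !uph_ph// Fx /twist phM (ph_unit (psi1 x)) conjcM mulrCA (mulcJ1 (cmod_ph FSx0)).
  by rewrite mulr1 /psi conjcK.
- apply: (@le_trans _ _ (Ex nu (fun x => cmod (F x - u x) + `|r - 1|))).
    apply: le_ae_Ex; [|by bmct|].
      by have := uni_uph (bmc_cmeas bF) => -[? _]; bmct.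
    apply: filterS2 Fr F0 => x /= Fxr Fx0.
    apply: le_trans (cmod_triB _ (F x) _) _; rewrite (cmodBC (u x)) lerD2l uph_ph//.
    rewrite -{1}(phK (F x)) Fxr -{2}(mul1r (ph (F x))) -cR1 -mulrBl -cRB.
    by rewrite cmodM cmod_cR cmod_ph// mulr1.
  rewrite ExD ?Ex_cst; try by bmct.
  by move: ed re; rewrite -/e; lrac.
Qed.

End CocycleRigidity.

(** * Cosets and near-equality in Young's inequality *)

Section Cosets.
Context {d : measure_display} {X : measurableType d} {R : realType}.
Variables (mu : probability X R) (T Ti : X -> X).

Lemma ae_mu0 (A : set X) : measurable A ->
  {ae mu, forall x, ~ A x} <-> mu A = 0%E.
Proof.
move=> mA; split=> [h|A0].
  apply: (measure_negligible mA); case: h => B [mB B0 AB]; exists B; split => // x Ax.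
  by apply: AB => /=; apply.
by exists A; split => // x /= /contrapT.
Qed.

(** The pointwise form of [is_coset]: a count along one orbit segment, suited to integration and to
    limits at almost every point. *)
Definition coset (H : set X) (m : nat) : Prop :=
  [/\ measurable H, (0 < m)%N,
      {ae mu, forall x, (iter m Ti x \in H) = (x \in H)} &
      {ae mu, forall x, (\sum_(i < m) (iter i Ti x \in H) = 1)%N}].

Hypothesis HS : mps mu T Ti.

Lemma measurable_Tset j H : measurable H -> measurable (Tset Ti j H).
Proof.
move=> mH; have := measurable_Tz_pre HS (- j%:Z) mH.
by congr measurable; apply/funext => x; rewrite /preimage /= Tz_natN.
Qed.

Lemma coset_is_coset H m : coset H m -> is_coset mu Ti H m.
Proof.
move=> [mH m0 inv part]; split => //.
- apply/ae_mu0.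
    by apply: measurableU; apply: measurableD => //; exact: measurable_Tset.
  apply: filterS inv => x /= hx [[h1 h2]|[h1 h2]].
  + by apply: h2; rewrite -[H x]inE -hx inE.
  + by apply: h2; rewrite /Tset /preimage /= -[H _]inE hx inE.
- move=> i j /andP[ij jm]; apply/ae_mu0.
    by apply: measurableI; exact: measurable_Tset.
  apply: filterS part => x /= hx [h1 h2]; move: hx.
  rewrite (bigD1 (Ordinal jm)) //= (bigD1 (Ordinal (ltn_trans ij jm))) /=; last first.
    by apply/eqP => /(congr1 val) /= ijE; move: ij; rewrite ijE ltnn.
  by rewrite (mem_set (h2 : H _)) (mem_set (h1 : H _)).
- apply/ae_mu0.
    apply: measurableC; apply: bigsetU_measurable => i _; exact: measurable_Tset.
  apply: filterS part => x /= hx; apply; rewrite -(bigcup_mkord m (fun i => Tset Ti i H)).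
  have [i hi] : exists i : 'I_m, iter i Ti x \in H.
    apply: contrapT => /forallNP nh; move: hx; rewrite big1// => i _.
    by have /negP/negPf -> := nh i.
  by exists (nat_of_ord i); [exact: (ltn_ord i)|exact: (set_mem hi)].
Qed.

Lemma is_coset_coset H m : is_coset mu Ti H m -> coset H m.
Proof.
move=> [mH m0 inv disj cov]; split => //.
- have /ae_mu0 h := inv; apply: filterS (h _); last first.
    by apply: measurableU; apply: measurableD => //; exact: measurable_Tset.
  move=> x hx; apply/idP/idP => h1; apply: contrapT => nh; apply: hx.
  + by left; split; [exact: set_mem|move=> /mem_set].
  + by right; split; [exact: set_mem|move=> /mem_set].
- have disj' : {ae mu, forall x (i j : nat), (i < j < m)%N -> ~ (Tset Ti i H `&` Tset Ti j H) x}.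
    apply/ae_foralln => i; apply/ae_foralln => j.
    have [ijm|] := boolP (i < j < m)%N; last by move=> _; apply: aeW.
    have /ae_mu0 h := disj i j ijm; apply: filterS (h _) => //.
    by apply: measurableI; exact: measurable_Tset.
  have /ae_mu0 cov' := cov.
  have {}cov' : {ae mu, forall x, ~ (~` \big[setU/set0]_(i < m) Tset Ti i H) x}.
    apply: cov'; apply: measurableC; apply: bigsetU_measurable => i _.
    exact: measurable_Tset.
  apply: filterS2 disj' cov' => x /= hd /contrapT.
  rewrite -(bigcup_mkord m (fun i => Tset Ti i H)) => -[i im hi].
  rewrite (bigD1 (Ordinal im)) //= (mem_set (hi : H _)) big1 ?addn0// => j /eqP ji.
  case: (boolP (_ \in _)) => // /set_mem hj; exfalso.
  have : (i < j)%N || (j < i)%N.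
    by rewrite -neq_ltn; apply/eqP => ij; apply: ji; apply: val_inj.
  move=> /orP[ij|ji'].
  + by apply: (hd i j); [rewrite ij /=|split].
  + by apply: (hd j i); [rewrite ji' im|split].
Qed.

End Cosets.

(** * Near-equality in the Cauchy-Schwarz inequality for correlations *)

Section CorrelationStability.
Context {d : measure_display} {X : measurableType d} {R : realType}.
Variable mu : probability X R.

(* Where [v' = (v v') / v] is close to [v] and [y = sqrt (v v')] is close to [al], so is [v]. *)
Lemma level_set_ineq (t t' al kap : R) : 0 <= t -> 0 <= t' -> 0 < al -> 0 < kap <= 1 / 4 ->
  3 * kap * al < `|t ^+ 2 - al| ->
  t ^+ 4 <= kap ^- 2 * (t ^+ 2 - t' ^+ 2) ^+ 2 +
    2 * (kap * al) ^- 2 * ((t * t') ^+ 2 * (t * t' - al) ^+ 2).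
Proof.
move=> t0 t'0 al0 /andP[k0 k3] far.
have kn : kap != 0 by rewrite gt_eqF.
have aln : al != 0 by rewrite gt_eqF.
have A0 : 0 <= kap ^- 2 * (t ^+ 2 - t' ^+ 2) ^+ 2.
  by rewrite mulr_ge0 ?sqr_ge0// invr_ge0 sqr_ge0.
have B0 : 0 <= 2 * (kap * al) ^- 2 * ((t * t') ^+ 2 * (t * t' - al) ^+ 2).
  apply: mulr_ge0; last by apply: mulr_ge0; exact: sqr_ge0.
  by apply: mulr_ge0 => //; rewrite invr_ge0 sqr_ge0.
have [h|h] := leP (kap * t ^+ 2) (`|t ^+ 2 - t' ^+ 2|).
  suff : t ^+ 4 <= kap ^- 2 * (t ^+ 2 - t' ^+ 2) ^+ 2 by move=> ?; rewrite -[leLHS]addr0 lerD.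
  rewrite mulrC ler_pdivlMr ?exprn_gt0//.
  rewrite -(real_normK (num_real (t ^+ 2 - t' ^+ 2))).
  rewrite (_ : t ^+ 4 * kap ^+ 2 = (kap * t ^+ 2) ^+ 2); last by ring.
  by rewrite ler_pXn2r// ?nnegrE ?mulr_ge0 ?sqr_ge0// ltW.
suff : t ^+ 4 <= 2 * (kap * al) ^- 2 * ((t * t') ^+ 2 * (t * t' - al) ^+ 2).
  by move=> ?; rewrite -[leLHS]add0r lerD.
move: h; rewrite ltr_norml => /andP[h1 h2].
set y := t * t'; set v := t ^+ 2.
have v0 : 0 <= v by exact: sqr_ge0.
have y0 : 0 <= y by exact: mulr_ge0.
have y2 : y ^+ 2 = v * t' ^+ 2 by rewrite /y /v; ring.
have ylo : (1 - kap) * v <= y.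
  rewrite -(ler_pXn2r (n := 2)) ?nnegrE ?mulr_ge0//; last by lra.
  rewrite y2; rewrite -/v in h1 h2; move: (t' ^+ 2) h1 h2 => v' h1 h2.
  have : (1 - kap) * v <= v' by lra.
  have : (1 - kap) ^+ 2 <= 1 - kap by nra.
  move=> g1 g2; apply: (@le_trans _ _ (v * ((1 - kap) * v))).
    by rewrite exprMn expr2 [v ^+ 2]expr2; nra.
  by rewrite ler_wpM2l.
have yhi : y <= (1 + kap) * v.
  rewrite -(ler_pXn2r (n := 2)) ?nnegrE ?mulr_ge0//; last by lra.
  rewrite y2; rewrite -/v in h1 h2; move: (t' ^+ 2) h1 h2 => v' h1 h2.
  have : v' <= (1 + kap) * v by lra.
  have : 1 + kap <= (1 + kap) ^+ 2 by nra.
  move=> g1 g2; apply: (@le_trans _ _ (v * ((1 + kap) * v))).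
    by rewrite ler_wpM2l.
  by rewrite exprMn expr2 [v ^+ 2]expr2; nra.
have yal : (kap * al) ^+ 2 <= (y - al) ^+ 2.
  move: far; rewrite -/v => far.
  have kal : 0 < kap * al by rewrite mulr_gt0.
  have [hv|hv] := leP al v.
    have : kap * al <= y - al.
      move: far; rewrite ger0_norm ?subr_ge0// => far.
      have : (1 - kap) * ((1 + 3 * kap) * al) <= y.
        apply: le_trans ylo; rewrite ler_wpM2l//; first lra.
        lra.
      by have : kap ^+ 2 * al <= 1 / 3 * (kap * al); nra.
    by move=> h; rewrite ler_pXn2r ?nnegrE ?(ltW kal)// (le_trans (ltW kal)).
  have : kap * al <= al - y.
    move: far; rewrite ltr0_norm ?subr_lt0// => far.
    have : y <= (1 + kap) * ((1 - 3 * kap) * al).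
      apply: le_trans yhi _; rewrite ler_wpM2l//; first lra.
      lra.
    by nra.
  move=> h; rewrite -[leRHS]sqrrN opprB ler_pXn2r ?nnegrE ?(ltW kal)//.
  exact: le_trans (ltW kal) h.
have -> : t ^+ 4 = v ^+ 2 by rewrite /v; ring.
rewrite mulrAC ler_pdivlMr ?exprn_gt0 ?mulr_gt0//.
have v2y : v ^+ 2 <= 2 * y ^+ 2.
  have : 3 / 4 * v <= y by nra.
  by nra.
have := sqr_ge0 (kap * al); have := sqr_ge0 y; have := sqr_ge0 v.
move: yal v2y; move: ((kap * al) ^+ 2) (y ^+ 2) (v ^+ 2) ((y - al) ^+ 2) => a b c e; nra.
Qed.

Variables (t t' : X -> R).
Hypotheses (bt : bm t) (bt' : bm t') (t0 : forall x, 0 <= t x) (t'0 : forall x, 0 <= t' x).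
Hypotheses (Et : Ex mu (fun x => t x ^+ 4) <= 1)
  (Ett' : Ex mu (fun x => t' x ^+ 4) = Ex mu (fun x => t x ^+ 4)).

(** Cauchy-Schwarz gives al^2 <= a rho with rho = E (t t')^2 <= E t^4 <= 1. The hypothesis forces
    rho >= 1 - tau, which makes t^2 and t'^2 close in L^2 and E (t t')^2 (t t' - al)^2 = a - 2 al^2
    + al^2 rho small. [level_set_ineq] turns both into concentration of t^2 at al; its factor kap^-2
    uses up two of the three powers of kap in tau. *)
Lemma correlation_stability (kap tau : R) : 0 < kap <= 1 / 4 -> tau = kap ^+ 3 / 2 ->
  let a := Ex mu (fun x => (t x * t' x) ^+ 4) in
  let al := Ex mu (fun x => (t x * t' x) ^+ 3) in
  0 < a -> (1 - tau) * a <= al ^+ 2 ->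
  [/\ 0 < al, al ^+ 2 <= a,
      Ex mu (fun x => `|t' x ^+ 4 - t x ^+ 4|) <= 3 * kap,
      Ex mu (fun x => t x ^+ 4 * \1_[set x | 3 * kap * al < `|t x ^+ 2 - al|] x) <= 3 * kap &
      1 - 3 * kap <= Ex mu (fun x => t x ^+ 4)].
Proof.
move=> /andP[k0 k3] tauE a al a0 hal.
have tau1 : 0 < tau <= 1 / 6.
  rewrite tauE; have : 0 < kap ^+ 3 by rewrite exprn_gt0.
  by have : kap ^+ 3 <= kap; [rewrite exprS; nra|move=> *; apply/andP; split; lra].
have tauk : 2 * tau <= kap by rewrite tauE exprS; nra.
pose rho := Ex mu (fun x => (t x * t' x) ^+ 2).
have bv : bm (fun x => t x ^+ 2) by bmt.
have CS1 : al ^+ 2 <= a * rho.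
  have -> : al = Ex mu (fun x => (t x * t' x) ^+ 2 * (t x * t' x)).
    by congr Ex; apply/funext => x; rewrite exprSr.
  have b1 : bm (fun x => (t x * t' x) ^+ 2) by bmt.
  have b2 : bm (fun x => t x * t' x) by bmt.
  have := Ex_CS mu b1 b2; congr (_ <= _ * _).
  by congr Ex; apply/funext => x; rewrite -exprM.
have rho_lo : 1 - tau <= rho by move: a0 CS1 hal; clearbody a al rho; nra.
pose w := Ex mu (fun x => t x ^+ 4).
have w1 : w <= 1 := Et.
have Ev : Ex mu (fun x => (t x ^+ 2 - t' x ^+ 2) ^+ 2) = 2 * w - 2 * rho.
  transitivity (Ex mu (fun x => (t x ^+ 4 + t' x ^+ 4) - 2 * (t x * t' x) ^+ 2)).
    by congr Ex; apply/funext => x; ring.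
  by rewrite ExB ?ExD ?ExZ ?Ett' -/w -/rho; try by bmt; ring.
have Ev' : Ex mu (fun x => (t x ^+ 2 + t' x ^+ 2) ^+ 2) = 2 * w + 2 * rho.
  transitivity (Ex mu (fun x => (t x ^+ 4 + t' x ^+ 4) + 2 * (t x * t' x) ^+ 2)).
    by congr Ex; apply/funext => x; ring.
  by rewrite !ExD ?ExZ ?Ett' -/w -/rho; try by bmt; ring.
have rhow : rho <= w.
  have : 0 <= Ex mu (fun x => (t x ^+ 2 - t' x ^+ 2) ^+ 2).
    by apply: Ex_ge0 => x; exact: sqr_ge0.
  by rewrite Ev; lrac.
have ala : al ^+ 2 <= a by move: CS1 a0 rhow w1; clearbody a al rho w; nrac.
have al0 : 0 < al.
  have al_ge0 : 0 <= al by apply: Ex_ge0 => x; rewrite exprn_ge0// mulr_ge0.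
  rewrite lt_def al_ge0 andbT; apply/eqP => al00.
  by move: hal tau1 a0; rewrite al00 expr0n /=; nrac.
split => //.
- rewrite -(ler_pXn2r (n := 2)) ?nnegrE//; last 2 first.
  + by apply: Ex_ge0.
  + by move: k0; lrac.
  have b1 : bm (fun x => `|t x ^+ 2 - t' x ^+ 2|) by bmt.
  have b2 : bm (fun x => t x ^+ 2 + t' x ^+ 2) by bmt.
  have := Ex_CS mu b1 b2.
  have -> : (fun x => `|t x ^+ 2 - t' x ^+ 2| * (t x ^+ 2 + t' x ^+ 2)) =
      (fun x => `|t' x ^+ 4 - t x ^+ 4|).
    apply/funext => x; rewrite -[in LHS](ger0_norm (_ : 0 <= t x ^+ 2 + t' x ^+ 2)).
      by rewrite -normrM -normrN; congr `|_|; ring.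
    by rewrite addr_ge0// sqr_ge0.
  under [X in _ <= Ex _ X * _]eq_fun do rewrite real_normK ?num_real//.
  rewrite Ev Ev' => /le_trans; apply.
  have h1 : 2 * w - 2 * rho <= 2 * tau by move: rho_lo w1; lrac.
  have h2 : 2 * w + 2 * rho <= 4 by move: rhow w1; lrac.
  have h3 : 0 <= 2 * w - 2 * rho by move: rhow; lrac.
  have h4 : kap ^+ 3 <= kap ^+ 2 by rewrite exprS; move: (sqr_ge0 kap) k3; nrac.
  apply: (@le_trans _ _ (2 * tau * 4)).
    by move: h1 h2 h3 (tau1); nrac.
  by move: h4 (sqr_ge0 kap); rewrite tauE exprMn; lrac.
- have mE : measurable [set x | 3 * kap * al < `|t x ^+ 2 - al|].
    have bd : bm (fun x => `|t x ^+ 2 - al|) by bmt.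
    have := @measurable_fun_ltr _ _ _ setT _ _ (bm_cst (3 * kap * al)).1 bd.1.
    by move=> /(_ measurableT [set true] I); rewrite setTI.
  have bI := bm_indic (R := R) mE.
  pose A x := (t x ^+ 2 - t' x ^+ 2) ^+ 2.
  pose B x := (t x * t' x) ^+ 2 * (t x * t' x - al) ^+ 2.
  have bA : bm A by rewrite /A; bmt.
  have bB : bm B by rewrite /B; bmt.
  apply: (@le_trans _ _ (Ex mu (fun x => kap ^- 2 * A x + 2 * (kap * al) ^- 2 * B x))).
    apply: le_Ex; [by apply: bmM => //; bmt|by bmt|move=> x].
    rewrite indicE; have [h|h] := boolP (x \in _); last first.
      rewrite mulr0 addr_ge0// mulr_ge0//; try by [rewrite invr_ge0 sqr_ge0|exact: sqr_ge0].
        by apply: mulr_ge0 => //; rewrite invr_ge0 sqr_ge0.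
      by apply: mulr_ge0; exact: sqr_ge0.
    rewrite mulr1; apply: level_set_ineq => //; first by rewrite k0.
    exact: (set_mem h).
  rewrite ExD ?ExZ; try by bmt.
  have EB : Ex mu B = a - 2 * al ^+ 2 + al ^+ 2 * rho.
    transitivity (Ex mu (fun x => ((t x * t' x) ^+ 4 - 2 * al * (t x * t' x) ^+ 3) +
       al ^+ 2 * (t x * t' x) ^+ 2)).
      by congr Ex; apply/funext => x; rewrite /B; ring.
    by rewrite ExD ?ExB ?ExZ -/a -/al -/rho; try by bmt; ring.
  rewrite EB Ev.
  have k2 : 0 < kap ^+ 2 by rewrite exprn_gt0.
  have al2 : 0 < al ^+ 2 by rewrite exprn_gt0.
  have h1 : kap ^- 2 * (2 * w - 2 * rho) <= kap.
    rewrite mulrC ler_pdivrMr// -exprS.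
    have : 2 * w - 2 * rho <= 2 * tau by move: rho_lo w1; lrac.
    by rewrite tauE; lrac.
  have h2 : 2 * (kap * al) ^- 2 * (a - 2 * al ^+ 2 + al ^+ 2 * rho) <= 2 * kap.
    rewrite mulrAC ler_pdivrMr ?exprn_gt0 ?mulr_gt0//.
    rewrite exprMn.
    have rho1 : rho <= 1 by move: rhow w1; lrac.
    have e1 : a - 2 * al ^+ 2 + al ^+ 2 * rho <= a - al ^+ 2.
      by move: rho1 al2; clearbody a al rho; nrac.
    have e2 : a - al ^+ 2 <= tau * a by move: hal; clearbody a al rho; lrac.
    have e3 : a <= 2 * al ^+ 2 by move: hal tau1 a0; clearbody a al rho; nrac.
    have e4 : tau * a <= kap ^+ 3 * al ^+ 2.
      rewrite tauE; have : 0 < kap ^+ 3 by rewrite exprn_gt0.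
      by move: e3; clearbody a al rho; move: (kap ^+ 3) => q; nrac.
    by move: e1 e2 e4; rewrite [kap ^+ 3]exprS; clearbody a al rho; lrac.
  by move: h1 h2; lrac.
- by move: rho_lo rhow tauk k0; rewrite -/w; lrac.
Qed.

End CorrelationStability.

Lemma shift_count (P : pred nat) h N :
  (\sum_(1 <= g < N.+1) P g <= \sum_(1 <= g < N.+1) ((h < g) && P (g - h)%N) + h)%N.
Proof.
elim: h => [|h IH].
  rewrite addn0 big_nat_cond [X in (_ <= X)%N]big_nat_cond; apply: leq_sum => g.
  by rewrite andbT subn0 => /andP[-> _].
apply: leq_trans IH _; rewrite addnS -addSn leq_add2r.
suff : (\sum_(1 <= g < N.+1) ((h < g) && P (g - h)%N) <=
   \sum_(1 <= g < N.+1) ((h.+1 < g) && P (g - h.+1)%N) + ((h < N) && P (N - h)%N))%N.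
  by move=> /leq_trans; apply; rewrite -[X in (_ <= X)%N]addn1 leq_add2l; case: (_ && _).
elim: N => [|N IHN]; first by rewrite !big_geq.
rewrite !(big_nat_recr N.+1)//= subSS ltnS leq_add2r.
exact: IHN.
Qed.

Lemma double_count (A B C h : nat) : (A <= B + h)%N -> (A + B <= C)%N -> (2 * A <= C + h)%N.
Proof. lia. Qed.

Section NearExtremalYoung.
Context {d : measure_display} {X : measurableType d} {R : realType}.
Variables (mu : probability X R) (T Ti : X -> X).
Hypotheses (HS : mps mu T Ti) (erg : ergodic mu Ti).
Variables (t : X -> R) (eta : R).
Hypotheses (bt : bm t) (t0 : forall x, 0 <= t x) (Et : Ex mu (fun x => t x ^+ 4) <= 1).
Hypothesis eta01 : 0 < eta <= 1 / 2000.

(** [correlation_stability] is applied with kap = eta / 3, whence this value; a shift is [good] when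
    its hypotheses hold there, and [al h] is then the level at which t^2 concentrates. *)
Let tau : R := (eta / 3) ^+ 3 / 2.
Let w x := t x ^+ 4.
Let a (h : int) := Ex mu (fun x => (t x * t (Tz T Ti (- h) x)) ^+ 4).
Let al (h : int) := Ex mu (fun x => (t x * t (Tz T Ti (- h) x)) ^+ 3).
Let D (h : int) := Ex mu (fun x => `|w (Tz T Ti (- h) x) - w x|).
Let far (c : R) := [set x | eta * c < `|t x ^+ 2 - c|].
Let good (h : int) : bool := (0 < a h) && ((1 - tau) * a h <= al h ^+ 2).

Let eta0 : 0 < eta. Proof. by case/andP: eta01. Qed.
Let eta1 : eta <= 1 / 2000. Proof. by case/andP: eta01. Qed.
Let bw : bm w. Proof. by rewrite /w; bmt. Qed.
Let btT h : bm (fun x => t (Tz T Ti h x)). Proof. exact: (bm_Tz HS). Qed.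
Let bwT h : bm (fun x => w (Tz T Ti h x)). Proof. exact: (bm_Tz HS). Qed.
Let w0 x : 0 <= w x. Proof. exact: exprn_ge0. Qed.

Let mfar c : measurable (far c).
Proof.
have bd : bm (fun x => `|t x ^+ 2 - c|) by bmt.
have := @measurable_fun_ltr _ _ _ setT _ _ (bm_cst (eta * c)).1 bd.1.
by move=> /(_ measurableT [set true] I); rewrite setTI.
Qed.

Let tau01 : 0 < tau <= eta.
Proof.
have : 0 < (eta / 3) ^+ 3 by rewrite exprn_gt0// divr_gt0.
have : (eta / 3) ^+ 3 <= eta / 3 by move: eta0 eta1 => ? ?; rewrite exprS; nra.
by rewrite /tau => ? ?; move: eta0 => ?; apply/andP; split; lra.
Qed.

Lemma good_stable h : good h ->
  [/\ 0 < al h, al h ^+ 2 <= a h, D h <= eta,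
      Ex mu (fun x => w x * \1_(far (al h)) x) <= eta & 1 - eta <= Ex mu w].
Proof.
move=> /andP[a0 hal].
have Ew : Ex mu (fun x => t (Tz T Ti (- h) x) ^+ 4) = Ex mu w.
  exact: (Ex_Tz HS (- h) bw).
have k01 : 0 < eta / 3 <= 1 / 4.
  by move: eta0 eta1 => ? ?; apply/andP; split; lra.
have := correlation_stability bt (btT (- h)) t0 (fun x => t0 _) Et Ew k01 (erefl _) a0 hal.
by rewrite (_ : 3 * (eta / 3) = eta) //; field.
Qed.

Lemma al_le_a h : al h ^+ 2 <= a h.
Proof.
pose y x := t x * t (Tz T Ti (- h) x).
have by_ : bm y by rewrite /y; bmct.
have by2 : bm (fun x => y x ^+ 2) by bmt.
have CS := Ex_CS mu by2 by_.
have rho1 : Ex mu (fun x => y x ^+ 2) <= 1.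
  apply: (@le_trans _ _ (Ex mu (fun x => 1 / 2 * w x + 1 / 2 * w (Tz T Ti (- h) x)))).
    apply: le_Ex; [by bmct|by bmct|move=> x].
    rewrite /y /w; have := sqr_ge0 (t x ^+ 2 - t (Tz T Ti (- h) x) ^+ 2).
    by move: (t x) (t _) => u v; nra.
  rewrite ExD ?ExZ; try by bmct.
  have -> : Ex mu (fun x => w (Tz T Ti (- h) x)) = Ex mu w by exact: (Ex_Tz HS (- h) bw).
  by move: Et; rewrite -/w; lra.
have -> : al h = Ex mu (fun x => y x ^+ 2 * y x).
  by rewrite /al; congr Ex; apply/funext => x; rewrite -/(y x) exprSr.
apply: le_trans CS _.
have -> : a h = Ex mu (fun x => (y x ^+ 2) ^+ 2).
  by rewrite /a; congr Ex; apply/funext => x; rewrite -/(y x) -exprM.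
have : 0 <= Ex mu (fun x => (y x ^+ 2) ^+ 2) by apply: Ex_ge0 => x; exact: sqr_ge0.
by move: rho1; nra.
Qed.

(** With [DD], this makes [D] a length on the integers, so that the set of shifts with small [D]
    becomes a subgroup once [D] has a gap. *)
Lemma DN h : D (- h) = D h.
Proof.
have [_ _ SK SiK _] := HS.
rewrite /D opprK.
have b : bm (fun x => `|w (Tz T Ti h x) - w x|) by bmct.
rewrite -(Ex_Tz HS (- h) b); congr Ex; apply/funext => x.
by rewrite (TzNK SK SiK) distrC.
Qed.

Lemma DD g h : D (g + h) <= D g + D h.
Proof.
have [_ _ SK SiK _] := HS.
have b : bm (fun x => `|w (Tz T Ti (- g) x) - w x|) by bmct.
have b2 := bm_Tz HS (- h) b; rewrite /= in b2.
rewrite {2}/D -(Ex_Tz HS (- h) b) /D -ExD//; last by bmct.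
apply: le_Ex; [by bmct|by bmct|move=> x].
by rewrite opprD (TzD SK SiK) ler_distD.
Qed.

(** * The level set at a fixed level c *)

Section Base.
Variable c : R.
Hypotheses (c0 : 0 < c) (Efar : Ex mu (fun x => w x * \1_(far c) x) <= eta)
  (Ew1 : 1 - eta <= Ex mu w).

Let E := ~` far c.
Let mE : measurable E. Proof. exact: measurableC. Qed.
Let bE : bm (\1_E : X -> R). Proof. exact: bm_indic. Qed.
Let bF : bm (\1_(far c) : X -> R). Proof. exact: bm_indic. Qed.
Let bET h : bm (fun x => \1_E (Tz T Ti h x) : R).
Proof. exact: (bm_Tz HS h bE). Qed.

Let indE x : \1_E x = 1 - \1_(far c) x :> R.
Proof.
rewrite !indicE /E in_setC; case: (_ \in _); rewrite ?subrr ?subr0//.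
Qed.

Let onE x : x \in E -> (1 - eta) * c <= t x ^+ 2 <= (1 + eta) * c.
Proof.
rewrite /E in_setC => /negP; rewrite inE /far /= => /negP; rewrite -leNgt ler_norml.
by move=> /andP[h1 h2]; apply/andP; split; lra.
Qed.

Let wonE x : x \in E -> (1 - eta) ^+ 2 * c ^+ 2 <= w x <= (1 + eta) ^+ 2 * c ^+ 2.
Proof.
move=> /onE/andP[h1 h2]; rewrite /w (_ : t x ^+ 4 = (t x ^+ 2) ^+ 2); last by rewrite -exprM.
rewrite -!exprMn.
have h0 : 0 <= (1 - eta) * c by rewrite mulr_ge0 ?ltW//; move: eta1; lra.
have h3 : 0 <= t x ^+ 2 by exact: sqr_ge0.
by rewrite !ler_pXn2r ?nnegrE ?h1 ?h2// (le_trans h3).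
Qed.

Let muE := Ex mu \1_E.

(** On [E] the weight w is c^2 up to factors (1 +- eta)^2, while its mass on [E] lies between 1 - 2
    eta and 1. *)
Lemma level_mass : 1 - 4 * eta <= c ^+ 2 * muE <= 1 + 3 * eta.
Proof.
have EwE : 1 - 2 * eta <= Ex mu (fun x => w x * \1_E x).
  have -> : Ex mu (fun x => w x * \1_E x) = Ex mu w - Ex mu (fun x => w x * \1_(far c) x).
    by rewrite -ExB; [congr Ex; apply/funext => x; rewrite indE; ring|by bmct|by bmct].
  by move: Efar Ew1; lra.
have EwE1 : Ex mu (fun x => w x * \1_E x) <= 1.
  apply: le_trans Et; apply: le_Ex; [by bmct|by bmt|move=> x].
  by rewrite indicE -/(w x); case: (_ \in _); rewrite ?mulr1 ?mulr0.
have lo : (1 - eta) ^+ 2 * (c ^+ 2 * muE) <= Ex mu (fun x => w x * \1_E x).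
  rewrite mulrA -ExZ//; apply: le_Ex; [by bmct|by bmct|move=> x].
  rewrite indicE; have [/wonE/andP[h _]|_] := boolP (x \in E); rewrite ?mulr1 ?mulr0//.
have hi : Ex mu (fun x => w x * \1_E x) <= (1 + eta) ^+ 2 * (c ^+ 2 * muE).
  rewrite mulrA -ExZ//; apply: le_Ex; [by bmct|by bmct|move=> x].
  rewrite indicE; have [/wonE/andP[_ h]|_] := boolP (x \in E); rewrite ?mulr1 ?mulr0//.
move: lo hi EwE EwE1; move: (Ex _ _) (c ^+ 2 * muE) => b e lo hi h1 h2.
move: eta0 eta1 => g0 g1; apply/andP; split; nra.
Qed.

Lemma level_close : Ex mu (fun x => `|w x - c ^+ 2 * \1_E x|) <= 5 * eta.
Proof.
apply: (@le_trans _ _ (Ex mu (fun x => w x * \1_(far c) x + 3 * eta * c ^+ 2 * \1_E x))).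
  apply: le_Ex; [by bmct|by bmct|move=> x].
  have [xE|xE] := boolP (x \in E).
    have := indE x; rewrite !indicE xE => /esym/eqP; rewrite subr_eq addrC -subr_eq subrr => /eqP <-.
    rewrite mulr0 add0r !mulr1 ler_norml.
    have /andP[h1 h2] := wonE xE; have c20 := sqr_ge0 c; move: eta0 eta1 => g0 g1.
    move: h1 h2 c20; move: (c ^+ 2) => e h1 h2 e0; apply/andP; split; nra.
  have := indE x; rewrite !indicE (negPf xE) => /esym/eqP; rewrite subr_eq add0r => /eqP <-.
  by rewrite !mulr0 subr0 addr0 mulr1 ger0_norm.
rewrite ExD ?ExZ; try by bmct.
have /andP[_ h] := level_mass; rewrite -/muE.
move: h Efar; rewrite -!mulrA; move: (c ^+ 2 * muE) => e; move: eta0 eta1 => g0 g1 h1 h2; nra.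
Qed.

Lemma D_level h : c ^+ 2 * Ex mu (fun x => `|\1_E (Tz T Ti (- h) x) - \1_E x|) <= 10 * eta + D h.
Proof.
rewrite -ExZ; last by bmct.
have bl : bm (fun x => `|w x - c ^+ 2 * \1_E x|) by bmct.
apply: (@le_trans _ _ (Ex mu (fun x => (`|w x - c ^+ 2 * \1_E x| + `|w (Tz T Ti (- h) x) - w x|)
   + `|w (Tz T Ti (- h) x) - c ^+ 2 * \1_E (Tz T Ti (- h) x)|))).
  apply: le_Ex; [by bmct|by bmct|move=> x].
  rewrite -{1}(ger0_norm (sqr_ge0 c)) -normrM mulrBr.
  set f := c ^+ 2 * \1_E (Tz _ _ _ _); set e := c ^+ 2 * \1_E x.
  set u := w x; set v := w (Tz _ _ _ _).
  have -> : f - e = (u - e) + (v - u) + - (v - f) by ring.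
  rewrite (le_trans (ler_normD _ _))// normrN lerD2r.
  exact: ler_normD.
rewrite !ExD; try by bmct.
rewrite (Ex_Tz HS (- h) bl) -/(D h).
by have := level_close; lra.
Qed.

(** [a h] is at least about c^4 times the measure of the overlap of [E] with its translate. A small
    [D h] makes the overlap nearly all of [E], and c^2 mu(E) is about 1. *)
Lemma corr_lower h : D h <= 5 * eta -> (1 - 16 * eta) * c ^+ 2 <= a h.
Proof.
move=> Dh; set I := Ex mu (fun x => \1_E x * \1_E (Tz T Ti (- h) x)).
have EI : I = muE - 1 / 2 * Ex mu (fun x => `|\1_E (Tz T Ti (- h) x) - \1_E x|).
  have -> : muE = Ex mu (fun x => 1 / 2 * \1_E x + 1 / 2 * \1_E (Tz T Ti (- h) x)).
    rewrite ExD ?ExZ; try by bmct.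
    by rewrite (Ex_Tz HS (- h) bE) -/muE; field.
  rewrite -ExZ -?ExB; try by bmct.
  congr Ex; apply/funext => x; rewrite !indicE.
  by do 2 case: (_ \in _) => /=; rewrite ?subrr ?normr0 ?subr0 ?sub0r ?normrN ?normr1; field.
have cI : 1 - 12 * eta <= c ^+ 2 * I.
  rewrite EI mulrBr mulrCA; have /andP[h1 _] := level_mass; have := D_level h.
  by move: h1 Dh eta0; lra.
have : (1 - eta) ^+ 4 * c ^+ 4 * I <= a h.
  rewrite -ExZ; last by bmct.
  apply: le_Ex; [by bmct|by bmct|move=> x].
  have q0 : 0 <= (t x * t (Tz T Ti (- h) x)) ^+ 4 by rewrite exprn_ge0// mulr_ge0.
  rewrite !indicE; have [/wonE/andP[h1 _]|_] := boolP (x \in E); last by rewrite mul0r mulr0.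
  have [/wonE/andP[h2 _]|_] := boolP (_ \in E); last by rewrite !mulr0.
  rewrite !mulr1 exprMn.
  have e0 : 0 <= (1 - eta) ^+ 2 * c ^+ 2 by rewrite mulr_ge0 ?sqr_ge0.
  by have := ler_pM e0 e0 h1 h2; congr (_ <= _); ring.
apply: le_trans.
have e4 : 1 - 4 * eta <= (1 - eta) ^+ 4.
  have := sqr_ge0 eta; move: eta0 eta1 => g0 g1 g2.
  have : 1 - 2 * eta <= (1 - eta) ^+ 2 by lra.
  rewrite (_ : (1 - eta) ^+ 4 = ((1 - eta) ^+ 2) ^+ 2); last by rewrite -exprM.
  by move: ((1 - eta) ^+ 2) => q; nra.
rewrite (_ : _ * c ^+ 4 * I = (1 - eta) ^+ 4 * (c ^+ 2 * I) * c ^+ 2); last by ring.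
rewrite ler_wpM2r ?sqr_ge0//.
move: cI e4; move: (c ^+ 2 * I) ((1 - eta) ^+ 4) => u v; move: eta0 eta1 => g0 g1 h1 h2; nra.
Qed.

(** Another good shift has its own level [al h]. Each of the two level sets misses at most eta of
    the mass of w, so they meet, and c and [al h] agree up to a factor close to 1. *)
Lemma good_upper h : good h -> a h <= (1 + 6 * eta) * c ^+ 2.
Proof.
move=> gh; have [al0 ala Dh Efar' _] := good_stable gh.
have [x [x1 x2]] : exists x, x \in E /\ x \in ~` far (al h).
  apply: contrapT => /forallNP nx.
  have : Ex mu w <= Ex mu (fun x => w x * \1_(far c) x + w x * \1_(far (al h)) x).
    have bF' := bm_indic (R := R) (mfar (al h)).
    apply: le_Ex; [by []|by bmct|move=> x].
    have := nx x; rewrite !in_setC !indicE => h1.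
    have : (x \in far c) || (x \in far (al h)).
      by apply/orP; case: (boolP (x \in far c)) h1 => [|_] h1; [left|right; apply/negPn/negP => h2; apply: h1].
    by move=> /orP[] ->; rewrite !mulr1 ?lerDl ?lerDr mulr_ge0.
  rewrite ExD; [|by bmct|by apply: bmM => //; exact: bm_indic].
  by move: Efar Efar' Ew1; move: eta1; lra.
have /andP[_ h1] := onE x1.
have h2 : (1 - eta) * al h <= t x ^+ 2.
  move: x2; rewrite in_setC => /negP; rewrite inE /far /= => /negP; rewrite -leNgt ler_norml.
  by move=> /andP[g1 _]; lra.
have h3 : (1 - eta) * al h <= (1 + eta) * c by exact: le_trans h2 h1.
have h4 : (1 - eta) ^+ 2 * al h ^+ 2 <= (1 + eta) ^+ 2 * c ^+ 2.
  have p1 : 0 <= (1 - eta) * al h by rewrite mulr_ge0 ?ltW//; move: eta1; lra.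
  by rewrite -!exprMn ler_pXn2r// nnegrE// (le_trans p1).
have /andP[a0 h5] := gh; have /andP[tau0 tau1] := tau01.
have h6 : (1 - eta) * a h <= al h ^+ 2.
  by apply: le_trans h5; rewrite ler_wpM2r ?(ltW a0)// lerD2l lerN2.
have h7 : (1 - eta) ^+ 3 * a h <= (1 + eta) ^+ 2 * c ^+ 2.
  apply: le_trans h4; rewrite exprSr -mulrA ler_wpM2l ?sqr_ge0//.
have e1 : (1 + eta) ^+ 2 <= (1 + 6 * eta) * (1 - eta) ^+ 3.
  have e3 : 1 - 3 * eta <= (1 - eta) ^+ 3.
    rewrite (_ : (1 - eta) ^+ 3 = 1 - 3 * eta + eta ^+ 2 * (3 - eta)); last by ring.
    by rewrite lerDl mulr_ge0 ?sqr_ge0//; move: eta1; lra.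
  by move: e3; move: ((1 - eta) ^+ 3) => q; move: eta0 eta1 => g0 g1 e3; nra.
have e3 : 0 < (1 - eta) ^+ 3 by rewrite exprn_gt0//; move: eta1; lra.
rewrite -(ler_pM2l e3); apply: le_trans h7 _.
have -> : (1 - eta) ^+ 3 * ((1 + 6 * eta) * c ^+ 2) = (1 + 6 * eta) * (1 - eta) ^+ 3 * c ^+ 2.
  by ring.
by apply: ler_wpM2r => //; exact: sqr_ge0.
Qed.

End Base.

Section Rich.
Variable eps : R.
Hypotheses (eps0 : 0 < eps) (epst : eps + 2 * eps / tau <= eta).
Hypothesis rich : forall N0, exists2 N, (N0 <= N)%N &
  (1 - eps) * N%:R <= \sum_(1 <= h < N.+1) al h ^+ 2.

Let tau0 : 0 < tau. Proof. by case/andP: tau01. Qed.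
Let epsl : eps <= eta.
Proof.
apply: le_trans epst; rewrite lerDl divr_ge0 ?(ltW tau0)// mulr_ge0// ltW//.
Qed.

(** [a h] is the correlation of w with its translate, so the mean ergodic theorem caps its average
    by (E w)^2 <= 1: on average, [a h] and [al h ^+ 2] differ by at most 2 eps. *)
Lemma rich_total N0 : exists N, [/\ (N0 <= N)%N,
  (1 - eps) * N%:R <= \sum_(1 <= h < N.+1) al h ^+ 2 &
  \sum_(1 <= h < N.+1) a h <= (1 + eps) * N%:R].
Proof.
have [N1 hN1] := mean_ergodic HS erg bw eps0.
have [N] := rich (maxn N0 N1); rewrite geq_max => /andP[NN0 NN1] hN.
exists N; split => //.
have := hN1 N NN1; rewrite ler_norml => /andP[_].
have -> : \sum_(1 <= h < N.+1) Ex mu (fun x => w (Tz T Ti (- h%:Z) x) * w x) =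
    \sum_(1 <= h < N.+1) a h.
  by apply: eq_bigr => h _; congr Ex; apply/funext => x; rewrite /w exprMn mulrC.
have N0' : 0 <= N%:R :> R by [].
have W1 : Ex mu w ^+ 2 <= 1.
  by rewrite expr_le1//; apply: Ex_ge0.
have : N%:R * Ex mu w ^+ 2 <= N%:R by rewrite ler_piMr.
lra.
Qed.

(** Markov's inequality in pointwise form: a shift that is not good has al^2 <= a <= (a - al^2) /
    tau. *)
Lemma al_le_good h : al h ^+ 2 <= (good h)%:R * a h + tau^-1 * (a h - al h ^+ 2).
Proof.
have ala := al_le_a h.
have ti : 0 < tau^-1 by rewrite invr_gt0.
rewrite /good; have [a0|a0] /= := ltP 0 (a h); last first.
  rewrite mul0r add0r (le_trans (le_trans ala a0))//.
  by rewrite mulr_ge0 ?subr_ge0 ?(ltW ti).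
have [hg|hb] := leP ((1 - tau) * a h) (al h ^+ 2); rewrite ?mul1r ?mul0r ?add0r.
  by apply: (le_trans (al_le_a h)); rewrite lerDl mulr_ge0 ?subr_ge0 ?(ltW ti).
rewrite mulrC ler_pdivlMr//; apply: (@le_trans _ _ (tau * a h)); last by lra.
by rewrite mulrC ler_wpM2l// ltW.
Qed.

Lemma rich_good N c : (forall h, good h -> a h <= (1 + 6 * eta) * c ^+ 2) ->
  (1 - eps) * N%:R <= \sum_(1 <= h < N.+1) al h ^+ 2 ->
  \sum_(1 <= h < N.+1) a h <= (1 + eps) * N%:R ->
  (1 - eta) * N%:R <= (1 + 6 * eta) * c ^+ 2 * \sum_(1 <= h < N.+1) (good h)%:R.
Proof.
move=> hc h1 h2.
have h3 : \sum_(1 <= h < N.+1) al h ^+ 2 <= \sum_(1 <= h < N.+1) (good h)%:R * a h +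
    tau^-1 * (\sum_(1 <= h < N.+1) a h - \sum_(1 <= h < N.+1) al h ^+ 2).
  rewrite -sumrB mulr_sumr -big_split /=; apply: ler_sum => h _; exact: al_le_good.
have h4 : \sum_(1 <= h < N.+1) (good h)%:R * a h <=
    (1 + 6 * eta) * c ^+ 2 * \sum_(1 <= h < N.+1) (good h)%:R.
  rewrite mulr_sumr; apply: ler_sum => h _.
  by case: (boolP (good h)) => gh; rewrite ?mul0r ?mulr0// mul1r mulr1 hc.
apply: le_trans h4.
have h5 : tau^-1 * (\sum_(1 <= h < N.+1) a h - \sum_(1 <= h < N.+1) al h ^+ 2) <=
    tau^-1 * (2 * eps * N%:R).
  by rewrite ler_wpM2l ?invr_ge0 ?(ltW tau0)//; lra.
have h6 : (eps + 2 * eps / tau) * N%:R <= eta * N%:R by rewrite ler_wpM2r.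
have h7 : tau^-1 * (2 * eps * N%:R) = 2 * eps / tau * N%:R by ring.
by move: h1 h3 h5 h6; rewrite h7 mulrDl; lra.
Qed.

Lemma exists_good : exists2 h : nat, (0 < h)%N & good h.
Proof.
apply: contrapT => ng.
have ng' h : (0 < h)%N -> good h = false.
  by move=> h0; apply/negP => gh; apply: ng; exists h.
have [N [N1 h1 h2]] := rich_total 1.
have N0' : 0 < N%:R :> R by rewrite ltr0n.
have : (1 - eta) * N%:R <= (1 + 6 * eta) * 0 ^+ 2 * \sum_(1 <= h < N.+1) (good h)%:R.
  have s0 : \sum_(1 <= h < N.+1) al h ^+ 2 <= tau^-1 * (2 * eps * N%:R).
    apply: (@le_trans _ _ (\sum_(1 <= h < N.+1) tau^-1 * (a h - al h ^+ 2))).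
      rewrite big_nat_cond [leRHS]big_nat_cond; apply: ler_sum => h /andP[/andP[h0 _] _].
      by have := al_le_good h; rewrite ng'// mul0r add0r.
    rewrite -mulr_sumr sumrB ler_wpM2l ?invr_ge0 ?(ltW tau0)//; lra.
  have h6 : (eps + 2 * eps / tau) * N%:R <= eta * N%:R by rewrite ler_wpM2r.
  have h7 : tau^-1 * (2 * eps * N%:R) = 2 * eps / tau * N%:R by ring.
  rewrite expr0n /= mulr0 mul0r.
  by move: h1 s0 h6; rewrite h7 mulrDl; lra.
rewrite expr0n /= mulr0 mul0r => h.
have : 0 < (1 - eta) * N%:R by rewrite mulr_gt0//; move: eta1; lra.
lra.
Qed.

Section BaseLevel.
Variable c : R.
Hypotheses (c0 : 0 < c) (Efar : Ex mu (fun x => w x * \1_(far c) x) <= eta)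
  (Ew1 : 1 - eta <= Ex mu w).

Let c2 : 0 < c ^+ 2. Proof. by rewrite exprn_gt0. Qed.

(** Both sets of shifts have density about 1/c^2. A good shift contributes at most (1 + 6 eta) c^2
    to an average of nearly 1, and a shift with D <= 5 eta at least (1 - 16 eta) c^2 to an average
    of at most 1 + eps. *)
Lemma count_good N0 : exists N, [/\ (N0 <= N)%N,
  (1 - 7 * eta) * N%:R <= c ^+ 2 * \sum_(1 <= h < N.+1) (good h)%:R &
  c ^+ 2 * \sum_(1 <= h < N.+1) (D h <= 5 * eta)%R%:R <= (1 + 18 * eta) * N%:R].
Proof.
have [N [NN0 h1 h2]] := rich_total N0.
exists N; split => //.
  have := rich_good (good_upper Efar Ew1) h1 h2.
  rewrite -mulrA; set G := c ^+ 2 * _ => h3.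
  have N0' : 0 <= N%:R :> R by [].
  have k : 0 < 1 + 6 * eta by move: eta0; lra.
  rewrite -(ler_pM2l k); apply: le_trans h3.
  rewrite mulrA ler_wpM2r//; move: eta0 (sqr_ge0 eta); nra.
have N0' : 0 <= N%:R :> R by [].
have h3 : (1 - 16 * eta) * (c ^+ 2 * \sum_(1 <= h < N.+1) (D h <= 5 * eta)%R%:R) <= (1 + eta) * N%:R.
  apply: (@le_trans _ _ ((1 + eps) * N%:R)); last by rewrite ler_wpM2r// lerD2l.
  apply: le_trans h2; rewrite mulrA mulr_sumr; apply: ler_sum => h _.
  have [hD|_] := leP (D h); rewrite ?mulr1 ?mulr0.
    exact: (corr_lower c0 Efar Ew1).
  by apply: Ex_ge0 => x; rewrite exprn_ge0// mulr_ge0.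
have k : 0 < 1 - 16 * eta by move: eta1; lra.
rewrite -(ler_pM2l k); apply: le_trans h3 _.
by rewrite mulrA ler_wpM2r//; move: eta0 eta1; nra.
Qed.

(* The good [g] and their translates by [h] lie in [{D <= 5 eta}], whose density barely exceeds
   that of the good [g] alone, so they meet. *)
Lemma dichotomy_nat (h : nat) : D h <= 4 * eta -> D h <= 2 * eta.
Proof.
move=> Dh; rewrite leNgt; apply/negP => Dn.
(* Translating by h loses at most h elements of {1, ..., N}; N > 2 c^2 h makes this loss, weighted
   by c^2, less than N / 2. *)
have [N [NN0 h1 h2]] := count_good (Num.truncn (2 * c ^+ 2 * h%:R)).+1.
have gD g : good g -> D g <= eta by case/good_stable.
have pt (g : nat) : (good g + ((h < g)%N && good (g - h)%N) <= (D g <= 5 * eta)%R)%N.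
  have e0 : eta <= 5 * eta by move: eta0; lra.
  have [gg|ng] /= := boolP (good g).
    rewrite (le_trans (gD _ gg) e0).
    have [hg /=|//] := ltnP h g.
    have [gg'|//] := boolP (good (g - h)%N).
    have : D h <= D g + D (g - h)%N.
      rewrite -(DN (g - h)%N); apply: le_trans (DD _ _).
      by rewrite -subzn ?(ltnW hg)// opprB addrC subrK.
    by have := gD _ gg; have := gD _ gg'; move: Dn; lra.
  have [hg /=|//] := ltnP h g.
  have [gg'|//] := boolP (good (g - h)%N).
  have : D g <= D (g - h)%N + D h.
    by apply: le_trans (DD _ _); rewrite -PoszD subnK// ltnW.
  move=> h3; rewrite (_ : (D g <= 5 * eta)%R)//.
  by have := gD _ gg'; move: Dh h3; lra.
have sumle : 2 * \sum_(1 <= g < N.+1) (good g)%:R - h%:R <=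
    \sum_(1 <= g < N.+1) (D g <= 5 * eta)%R%:R :> R.
  rewrite -!natr_sum lerBlDr -natrD -natrM ler_nat.
  have := shift_count (fun g => good g) h N.
  have : (\sum_(1 <= g < N.+1) (good g + ((h < g)%N && good (g - h)%N)) <=
      \sum_(1 <= g < N.+1) (D g <= 5 * eta)%R)%N by apply: leq_sum => g _; exact: pt.
  by rewrite big_split /= => h5 h6; exact: double_count h6 h5.
have h3 : c ^+ 2 * (2 * \sum_(1 <= g < N.+1) (good g)%:R - h%:R) <= (1 + 18 * eta) * N%:R.
  by apply: le_trans h2; rewrite ler_wpM2l ?(ltW c2).
have h4 : 2 * c ^+ 2 * h%:R < N%:R.
  by apply: lt_le_trans (truncnS_gt _) _; rewrite ler_nat.
have h5 : eta * N%:R <= 1 / 2000 * N%:R by rewrite ler_wpM2r.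
have N0' : 0 < N%:R :> R by rewrite ltr0n; exact: leq_trans NN0.
move: h1 h3 h4 h5 N0'; move: (\sum_(1 <= g < N.+1) (good g)%:R) => G; lra.
Qed.

Lemma dichotomy (h : int) : D h <= 4 * eta -> D h <= 2 * eta.
Proof.
case: (intP h) => [|n|n]; rewrite ?DN; exact: dichotomy_nat.
Qed.

Let inG (n : nat) : bool := D n <= 2 * eta.

Lemma inG_sub (n k : nat) : (k <= n)%N -> inG n -> inG k -> inG (n - k).
Proof.
move=> kn hn hk; rewrite /inG; apply: dichotomy; rewrite -subzn//.
by apply: le_trans (DD _ _) _; rewrite DN; move: hn hk; rewrite /inG; lra.
Qed.

Lemma inG_add (n k : nat) : inG n -> inG k -> inG (n + k).
Proof.
move=> hn hk; rewrite /inG; apply: dichotomy; rewrite PoszD.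
by apply: le_trans (DD _ _) _; move: hn hk; rewrite /inG; lra.
Qed.

(** The gap makes {D <= 2 eta} closed under sums and differences, so by Euclidean division it
    consists of the multiples of its least positive element m. Its density 1/m, compared with
    [count_good], places c^2 near m. *)
Lemma return_group : exists m : nat, [/\ (0 < m)%N, forall j, inG (m * j),
  forall n, inG n -> (m %| n)%N,
  m%:R * (1 - 7 * eta) <= c ^+ 2 & c ^+ 2 <= (1 + 19 * eta) * m%:R].
Proof.
have exG : exists n, (0 < n)%N && inG n.
  have [h h0 gh] := exists_good; exists h; rewrite h0 /=.
  have [_ _ Dh _ _] := good_stable gh.
  by rewrite /inG; move: eta0 Dh; lra.
case: (ex_minnP exG) => m /andP[m0 Gm] mmin.
have G0 : inG 0.
  by have := inG_sub (leqnn m) Gm Gm; rewrite subnn.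
have Gmul j : inG (m * j).
  by elim: j => [|j IH]; rewrite ?muln0// mulnS; exact: inG_add.
have Gdiv n : inG n -> (m %| n)%N.
  move=> Gn; rewrite /dvdn; apply/negPn/negP => r0.
  have : inG (n %% m).
    have -> : (n %% m = n - m * (n %/ m))%N.
      by rewrite [X in (X - _)%N](divn_eq n m) [(n %/ m * m)%N]mulnC addKn.
    by apply: inG_sub => //; rewrite mulnC leq_trunc_div.
  move=> Gr; have := mmin (n %% m)%N; rewrite lt0n r0 Gr => /(_ isT).
  by rewrite leqNgt ltn_mod m0.
have cntm N : \sum_(1 <= g < N.+1) (m %| g : nat)%N = (N %/ m)%N.
  elim: N => [|N IH]; first by rewrite big_geq// div0n.
  by rewrite big_nat_recr//= IH divnS// addnC.
have m0' : 0 < m%:R :> R by rewrite ltr0n.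
exists m; split => //.
- have [N [N1 h1 _]] := count_good 1.
  have N0' : 0 < N%:R :> R by rewrite ltr0n.
  have h2 : \sum_(1 <= h < N.+1) (good h)%:R <= N%:R / m%:R :> R.
    apply: (@le_trans _ _ (N %/ m)%:R).
      rewrite -cntm -natr_sum ler_nat; apply: leq_sum => h _.
      have [gh|//] := boolP (good h).
      rewrite Gdiv//; have [_ _ Dh _ _] := good_stable gh.
      by rewrite /inG; move: eta0 Dh; lra.
    by rewrite ler_pdivlMr// -natrM ler_nat leq_trunc_div.
  have h3 : (1 - 7 * eta) * N%:R <= c ^+ 2 * (N%:R / m%:R).
    by apply: le_trans h1 _; rewrite ler_wpM2l ?(ltW c2).
  rewrite mulrA ler_pdivlMr// in h3.
  by rewrite -(ler_pM2r N0') mulrAC -mulrA mulrC; move: h3; congr (_ <= _); ring.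
- have [N [N1 _ h2]] := count_good (Num.truncn (c ^+ 2 / eta)).+1.
  have N0' : 0 < N%:R :> R by rewrite ltr0n; exact: leq_trans N1.
  have h3 : N%:R / m%:R - 1 <= \sum_(1 <= h < N.+1) (D h <= 5 * eta)%R%:R :> R.
    apply: (@le_trans _ _ (N %/ m)%:R).
      by rewrite lerBlDr ler_pdivrMr// natr1 -natrM ler_nat ltnW// ltn_ceil.
    rewrite -cntm -natr_sum ler_nat; apply: leq_sum => h _.
    have [mh|//] := boolP (m %| h)%N.
    have := Gmul (h %/ m)%N; rewrite mulnC divnK// /inG => Gh.
    by rewrite (le_trans Gh)//; move: eta0; lra.
  have h4 : c ^+ 2 * (N%:R / m%:R - 1) <= (1 + 18 * eta) * N%:R.
    by apply: le_trans h2; rewrite ler_wpM2l ?(ltW c2).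
  have h5 : c ^+ 2 <= eta * N%:R.
    rewrite mulrC -ler_pdivrMr//; apply: le_trans (ltW (truncnS_gt _)) _.
    by rewrite ler_nat.
  have h6 : c ^+ 2 * (N%:R / m%:R) <= (1 + 19 * eta) * N%:R by lra.
  rewrite mulrA ler_pdivrMr// in h6.
  by rewrite -(ler_pM2r N0'); apply: le_trans h6 _; rewrite mulrAC.
Qed.

(** [E] is almost invariant under T^m, so [almost_fixed], applied to T^m with the trivial twist,
    finds an invariant function near its indicator. A superlevel set of it is invariant, and
    ergodicity of T makes it a coset. *)
Lemma near_coset : exists H m, coset mu Ti H m /\
  Ex mu (fun x => `|w x - m%:R * \1_H x|) <= 130 * eta.
Proof.
have [m [m0 Gm _ mc cm]] := return_group.
have [_ _ SK SiK _] := HS.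
have HSm := mps_iter HS m.
pose E := ~` far c.
have bE : bm (\1_E : X -> R) by apply: bm_indic; exact: measurableC.
pose f0 (x : X) : R[i] := cR (\1_E x).
have bf0 : bmc f0 by exact: bmc_cR.
have f01 x : cmod (f0 x) <= 1.
  by rewrite cmod_cR indicE; case: (_ \in _); rewrite ?normr1 ?normr0.
have b1 : bmc (fun _ : X => 1 : R[i]) by exact: bmc_cst.
have it n x : iter n (twist (iter m Ti) (fun=> 1)) f0 x = f0 (Tz T Ti (- (m * n)%N%:Z) x).
  rewrite Tz_natN mulnC iterM.
  by elim: n x => [//|n IH] x; rewrite iterS /twist IH mul1r -iterSr.
have mR : 0 < m%:R :> R by rewrite ltr0n.
have close n : Ex mu (fun x => cmod (iter n (twist (iter m Ti) (fun=> 1)) f0 x - f0 x) ^+ 2)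
    <= 12 * eta / c ^+ 2.
  have -> : (fun x => cmod (iter n (twist (iter m Ti) (fun=> 1)) f0 x - f0 x) ^+ 2) =
      (fun x => `|\1_E (Tz T Ti (- (m * n)%N%:Z) x) - \1_E x|).
    apply/funext => x; rewrite it /f0 -cRB cmod_cR !indicE.
    by do 2 case: (_ \in _); rewrite ?subrr ?normr0 ?expr0n ?subr0 ?sub0r ?normrN ?normr1 ?expr1n.
  rewrite ler_pdivlMr// mulrC; apply: le_trans (D_level c0 Efar Ew1 _) _.
  by have := Gm n; rewrite /inG; lra.
have [F [bF _ Finv FE]] := almost_fixed HSm b1 (fun=> cmod1) bf0 f01 close.
have [bFr _] := bF.
(* Where the indicators of H and [E] differ, F is at distance at least 1/2 from that of [E]: the
   mean square error bounds the difference with a factor 4. *)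
pose H := [set x | 1 / 2 < complex.Re (F x)].
have mH : measurable H.
  have := @measurable_fun_ltr _ _ _ setT _ _ (bm_cst (1 / 2)).1 bFr.1.
  by move=> /(_ measurableT [set true] I); rewrite setTI.
have bH := bm_indic (R := R) mH.
have Hinv : {ae mu, forall x, (iter m Ti x \in H) = (x \in H)}.
  apply: filterS Finv => x; rewrite /= /twist mul1r => Fx.
  by apply/idP/idP; rewrite !inE /H /= Fx.
have HE : Ex mu (fun x => `|\1_H x - \1_E x|) <= 96 * eta / c ^+ 2.
  apply: (@le_trans _ _ (Ex mu (fun x => 4 * cmod (F x - f0 x) ^+ 2))).
    apply: le_Ex; [by bmct|by bmct|move=> x].
    have h1 := Re_le_cmod (F x - f0 x); rewrite cReD cReN /= in h1.
    have h2 := cmod_ge0 (F x - f0 x).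
    move: h1 h2; move: (cmod _) => q; rewrite !indicE.
    have [/set_mem|/negP xH] := boolP (x \in H); have [xE|xE] := boolP (x \in E);
      rewrite /= ?subrr ?normr0 ?subr0 ?sub0r ?normrN ?normr1.
    - by move=> *; rewrite mulr_ge0// sqr_ge0.
    - rewrite /H /= => h; rewrite ler_norml => /andP[h1 h2] h3; nra.
    - have : complex.Re (F x) <= 1 / 2.
        by rewrite leNgt; apply/negP => h; apply: xH; rewrite inE.
      rewrite ler_norml => h /andP[h1 h2] h3; nra.
    - by move=> *; rewrite mulr_ge0// sqr_ge0.
  rewrite ExZ; last by bmct.
  by move: FE; rewrite -!mulrA; lra.
pose muE := Ex mu \1_E.
have /andP[l1 l2] := level_mass c0 Efar Ew1; rewrite -/muE in l1 l2.
have muE0 : 0 <= muE by apply: Ex_ge0 => x; rewrite indicE.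
have mHE : m%:R * Ex mu (fun x => `|\1_H x - \1_E x|) <= 97 * eta.
  apply: (@le_trans _ _ (m%:R * (96 * eta / c ^+ 2))); first by rewrite ler_wpM2l.
  rewrite mulrA ler_pdivrMr//.
  by move: mc mR eta0 eta1; nra.
have mmuE : `|m%:R * muE - c ^+ 2 * muE| <= 21 * eta.
  have e1 : m%:R * muE - c ^+ 2 * muE <= 8 * eta.
    have : (1 - 7 * eta) * (m%:R * muE) <= c ^+ 2 * muE.
      by rewrite mulrA ler_wpM2r// mulrC.
    have q0 : 0 <= m%:R * muE by rewrite mulr_ge0// ltW.
    move: q0 l1 l2; move: (m%:R * muE) (c ^+ 2 * muE) => u v.
    by move: eta0 eta1; nra.
  have e2 : c ^+ 2 * muE - m%:R * muE <= 21 * eta.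
    have : c ^+ 2 * muE <= (1 + 19 * eta) * (m%:R * muE).
      by rewrite mulrA ler_wpM2r.
    have q1 : m%:R * muE <= 1 + 11 * eta by move: e1 l2; lra.
    have q0 : 0 <= m%:R * muE by rewrite mulr_ge0// ltW.
    move: q0 q1 l1 l2; move: (m%:R * muE) (c ^+ 2 * muE) => u v.
    by move: eta0 eta1; nra.
  by rewrite ler_norml; move: e1 e2 eta0; lra.
(* The number of visits to H among m consecutive times is invariant, so constant. Its value m mu(H)
   is close to m mu(E), hence to 1, and it is an integer, so it is 1. *)
pose N x := \sum_(i < m) (\1_H (iter i Ti x) : R).
have bit i : bm (fun x => \1_H (iter i Ti x) : R).
  have := bm_Tz HS (- i%:Z) bH; congr bm; apply/funext => x.
  by rewrite Tz_natN.
have bN : bm N by apply: bm_sum => i; exact: bit.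
have [k Nk] : exists k, {ae mu, forall x, N x = k}.
  apply: erg => //; apply: filterS Hinv => x /= hx.
  rewrite /N; under eq_bigr do rewrite -iterSr.
  apply: (@addrI _ (\1_H (iter 0 Ti x) : R)).
  have := @big_ord_recl R 0 +%R m (fun i => \1_H (iter i Ti x)).
  rewrite (eq_bigr (fun i : 'I_m => \1_H (iter i.+1 Ti x))) => [<-|i _]; last by [].
  by rewrite big_ord_recr /= addrC; congr (_ + _); rewrite !indicE hx.
have kE : k = m%:R * Ex mu \1_H.
  rewrite -(Ex_cst mu k); transitivity (Ex mu N).
    by apply: eq_ae_Ex => //; [exact: bm_cst|apply: filterS Nk => x /= ->].
  rewrite /N Ex_sum// (eq_bigr (fun=> Ex mu \1_H)) => [|i _].
    by rewrite sumr_const card_ord mulr_natl.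
  have := Ex_Tz HS (- i%:Z) bH; congr (_ = _); congr Ex; apply/funext => x.
  by rewrite Tz_natN.
have HEd : `|Ex mu \1_H - muE| <= Ex mu (fun x => `|\1_H x - \1_E x|).
  by rewrite /muE -ExB//; apply: le_norm_Ex; bmct.
have mHd : `|m%:R * Ex mu \1_H - m%:R * muE| <= 97 * eta.
  rewrite -mulrBr normrM (gtr0_norm mR); apply: le_trans mHE.
  by rewrite ler_wpM2l.
have k02 : 0 < k < 2.
  move: mHd mmuE l1 l2 eta0 eta1; rewrite kE !ler_norml => /andP[? ?] /andP[? ?] ? ? ? ?.
  by apply/andP; split; lra.
have Hpart : {ae mu, forall x, (\sum_(i < m) (iter i Ti x \in H) = 1)%N}.
  apply: filterS Nk => x /= Nx.
  have Nn : N x = (\sum_(i < m) (iter i Ti x \in H))%N%:R.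
    by rewrite natr_sum; apply: eq_bigr => i _; rewrite indicE.
  move: k02; rewrite -Nx Nn ltr0n ltr_nat.
  by case: (\sum_(i < m) _)%N => [|[|]].
exists H, m; split; first by split.
apply: (@le_trans _ _ (Ex mu (fun x => `|w x - c ^+ 2 * \1_E x| +
   (`|c ^+ 2 - m%:R| * \1_E x + m%:R * `|\1_H x - \1_E x|)))).
  apply: le_Ex; [by bmct|by bmct|move=> x].
  have -> : w x - m%:R * \1_H x = (w x - c ^+ 2 * \1_E x) +
     ((c ^+ 2 - m%:R) * \1_E x - m%:R * (\1_H x - \1_E x)) by ring.
  apply: le_trans (ler_normD _ _) _; rewrite lerD2l.
  apply: le_trans (ler_normB _ _) _; rewrite !normrM (gtr0_norm mR) lerD2r.
  by rewrite (@ger0_norm _ (\1_E x))// indicE.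
rewrite !ExD ?ExZ; try by bmct.
have -> : `|c ^+ 2 - m%:R| * Ex mu \1_E = `|m%:R * muE - c ^+ 2 * muE|.
  by rewrite -mulrBl normrM distrC (ger0_norm muE0).
have := level_close c0 Efar Ew1; rewrite -/E => lc.
by move: mmuE mHE lc eta0; lra.
Qed.

End BaseLevel.

Lemma near_coset_rich : exists H m, coset mu Ti H m /\
  Ex mu (fun x => `|w x - m%:R * \1_H x|) <= 130 * eta.
Proof.
have [h _ gh] := exists_good.
have [al0 _ _ Efar Ew1] := good_stable gh.
exact: (near_coset al0 Efar Ew1).
Qed.

End Rich.

End NearExtremalYoung.

(** The degree does not occur: [tpow] brings all degrees to this one cubic inequality. *)
Lemma young_near_extremal {R : realType} (delta : R) : 0 < delta ->
  exists2 eps : R, 0 < eps & forall (d : measure_display) (X : measurableType d)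
    (mu : probability X R) (T Ti : X -> X), mps mu T Ti -> ergodic mu Ti ->
    forall t : X -> R, bm t -> (forall x, 0 <= t x) -> Ex mu (fun x => t x ^+ 4) <= 1 ->
    (forall N0, exists2 N, (N0 <= N)%N & (1 - eps) * N%:R <=
       \sum_(1 <= h < N.+1) Ex mu (fun x => (t x * t (Tz T Ti (- h%:Z) x)) ^+ 3) ^+ 2) ->
    exists H m, coset mu Ti H m /\
      Ex mu (fun x => `|t x ^+ 4 - m%:R * \1_H x|) <= delta.
Proof.
move=> delta0; pose eta : R := Num.min (delta / 130) (1 / 2000).
have [eta0 etad etal] : [/\ 0 < eta, 130 * eta <= delta & eta <= 1 / 2000].
  by rewrite /eta; case: (leP (delta / 130) (1 / 2000)) => h; split; lra.
have eta01 : 0 < eta <= 1 / 2000 by rewrite eta0 etal.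
pose tau : R := (eta / 3) ^+ 3 / 2.
have tau0 : 0 < tau by rewrite divr_gt0// exprn_gt0// divr_gt0.
have tau1 : tau <= 1.
  have h1 : eta / 3 <= 1 by lra.
  have : (eta / 3) ^+ 3 <= 1 by apply: exprn_ile1 => //; rewrite divr_ge0// ltW.
  by rewrite /tau; lra.
(* Counting the shifts that are not good loses eps + 2 eps / tau, which this choice keeps below
   eta. *)
exists (eta * tau / 4); first by rewrite divr_gt0// mulr_gt0.
move=> d X mu T Ti HS erg t bt t0 Et rich.
have [||H [m [cH Hm]]] := near_coset_rich HS erg bt t0 Et eta01 _ _ rich.
- by rewrite divr_gt0// mulr_gt0.
- have -> : eta * tau / 4 + 2 * (eta * tau / 4) / tau = eta * tau / 4 + eta / 2.
    by field; rewrite gt_eqF.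
  by nra.
by exists H, m; split => //; exact: le_trans Hm etad.
Qed.

(** * The norm bound on the seminorms *)

Section Hoelder.
Context {d : measure_display} {X : measurableType d} {R : realType}.
Variable mu : probability X R.

Lemma weighted_AMGM (u v theta : R) : 0 <= u -> 0 <= v -> 0 < theta < 1 ->
  u `^ theta * v `^ (1 - theta) <= theta * u + (1 - theta) * v.
Proof.
move=> u0 v0 /andP[t0 t1].
have t1' : 0 < 1 - theta by rewrite subr_gt0.
have := @conjugate_powR R (u `^ theta) (v `^ (1 - theta)) theta^-1 (1 - theta)^-1.
rewrite !powR_ge0 !invr_gt0 !invrK t0 t1' => /(_ isT isT isT isT).
rewrite addrC subrK => /(_ erefl) /le_trans; apply.
rewrite -!powRrM !divff ?gt_eqF// !powRr1//.
lra.
Qed.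

Lemma hoelder_theta (f g : X -> R) (theta : R) : bm f -> bm g ->
  (forall x, 0 <= f x) -> (forall x, 0 <= g x) -> 0 < theta < 1 ->
  Ex mu (fun x => f x `^ theta * g x `^ (1 - theta)) <=
  Ex mu f `^ theta * Ex mu g `^ (1 - theta).
Proof.
move=> bf bg f0 g0 t01; have /andP[t0 t1] := t01.
have t1' : 0 < 1 - theta by rewrite subr_gt0.
have bft : bm (fun x => f x `^ theta) by apply: bm_powR => //; exact: ltW.
have bgt : bm (fun x => g x `^ (1 - theta)) by apply: bm_powR => //; exact: ltW.
have A0 : 0 <= Ex mu f by exact: Ex_ge0.
have B0 : 0 <= Ex mu g by exact: Ex_ge0.
have rhs0 : 0 <= Ex mu f `^ theta * Ex mu g `^ (1 - theta) by rewrite mulr_ge0 ?powR_ge0.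
have [Az|An] := eqVneq (Ex mu f) 0.
  rewrite (@ae_Ex0 _ _ _ mu)//; first by bmct.
  have := Ex_eq0 bf f0 Az; apply: filterS => x /= ->.
  by rewrite powR0 ?mul0r// gt_eqF.
have [Bz|Bn] := eqVneq (Ex mu g) 0.
  rewrite (@ae_Ex0 _ _ _ mu)//; first by bmct.
  have := Ex_eq0 bg g0 Bz; apply: filterS => x /= ->.
  by rewrite powR0 ?mulr0// gt_eqF.
have Ap : 0 < Ex mu f by rewrite lt_def An.
have Bp : 0 < Ex mu g by rewrite lt_def Bn.
set a := Ex mu f in Ap *; set b := Ex mu g in Bp *.
have c0 : 0 < a `^ theta * b `^ (1 - theta) by rewrite mulr_gt0// powR_gt0.
rewrite -[leRHS]mulr1 -ler_pdivrMl//.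
have E1 : Ex mu (fun x => theta * (a^-1 * f x) + (1 - theta) * (b^-1 * g x)) = 1.
  by rewrite ExD ?ExZ; try by bmct; rewrite /a /b !mulVf// !mulr1 addrC subrK.
rewrite -[leRHS]E1 -ExZ; last by bmct.
apply: le_Ex; [by bmct|by bmct|move=> x].
apply: le_trans (weighted_AMGM _ _ t01); last 2 first.
- by rewrite mulr_ge0// invr_ge0 ltW.
- by rewrite mulr_ge0// invr_ge0 ltW.
rewrite !powRM ?invr_ge0 ?(ltW Ap) ?(ltW Bp)//.
have inv (c th : R) : 0 < c -> c^-1 `^ th = (c `^ th)^-1.
  by move=> cp; rewrite -powR_inv1 ?ltW// -powRrM mulN1r powRN.
by rewrite (inv _ _ Ap) (inv _ _ Bp) invfM mulrACA.
Qed.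

Lemma pow_interpolate (A B C : R) (s : nat) : (2 <= s)%N ->
  0 <= C -> 0 <= A -> 0 <= B ->
  C <= B `^ (2 / s%:R) * A `^ (1 - 2 / s%:R) -> C ^+ s <= A ^+ (s - 2) * B ^+ 2.
Proof.
move=> s2 C0 A0 B0 h.
have s0 : s%:R != 0 :> R by rewrite pnatr_eq0 -lt0n (leq_trans _ s2).
have P (b e : R) : (b `^ e) ^+ s = b `^ (e * s%:R).
  by rewrite -powR_mulrn ?powR_ge0// -powRrM.
have q1 : 2 / s%:R * s%:R = 2%:R :> R by rewrite divfK.
have q2 : (1 - 2 / s%:R) * s%:R = (s - 2)%:R :> R by rewrite natrB// mulrBl mul1r q1.
have -> : A ^+ (s - 2) * B ^+ 2 = (B `^ (2 / s%:R) * A `^ (1 - 2 / s%:R)) ^+ s.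
  by rewrite exprMn !P q1 q2 (powR_mulrn _ B0) (powR_mulrn _ A0) mulrC.
have D0 : 0 <= B `^ (2 / s%:R) * A `^ (1 - 2 / s%:R).
  by apply: mulr_ge0; exact: powR_ge0.
move: D0 h; move: (B `^ _ * A `^ _) => D D0 h.
by apply: lerXn2r.
Qed.

(** The exponent is a weighted mean of 3 and 2, namely 2 + 2/s = 3 (2/s) + 2 (1 - 2/s). At s = 2 the
    weight of the cube is 1, outside the range of [hoelder_theta], and there is nothing to
    interpolate. *)
Lemma hoelder_power (y : X -> R) (s : nat) : bm y -> (forall x, 0 <= y x) -> (2 <= s)%N ->
  Ex mu (fun x => y x `^ (2 + 2 / s%:R)) ^+ s <=
  Ex mu (fun x => y x ^+ 2) ^+ (s - 2) * Ex mu (fun x => y x ^+ 3) ^+ 2.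
Proof.
move=> by_ y0 s2; have s0 : 0 < s%:R :> R by rewrite ltr0n (leq_trans _ s2).
have [->|s2'] := eqVneq s 2%N.
  rewrite subnn expr0 mul1r (_ : 2 + 2 / 2%:R = 3%:R); last by field.
  by under eq_fun do rewrite powR_mulrn//.
have s3 : (2 < s)%N by rewrite ltn_neqAle eq_sym s2' s2.
have th : 0 < (2 / s%:R : R) < 1.
  by rewrite divr_gt0//= ltr_pdivrMr// mul1r ltr_nat.
have b2 : bm (fun x => y x ^+ 2) by bmt.
have b3 : bm (fun x => y x ^+ 3) by bmt.
have := hoelder_theta b3 b2 (fun x => exprn_ge0 3 (y0 x)) (fun x => exprn_ge0 2 (y0 x)) th.
have -> : (fun x => (y x ^+ 3) `^ (2 / s%:R) * (y x ^+ 2) `^ (1 - 2 / s%:R)) =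
    (fun x => y x `^ (2 + 2 / s%:R)).
  apply/funext => x; rewrite -!powR_mulrn// -!powRrM -powRD.
    by congr (_ `^ _); ring.
  apply/implyP => /eqP h; exfalso; move: h.
  rewrite (_ : _ + _ = 2 + 2 / s%:R); last by ring.
  by apply/eqP; rewrite gt_eqF// addr_gt0//; case/andP: th.
move=> h.
have E3 : 0 <= Ex mu (fun x => y x ^+ 3) by apply: Ex_ge0 => x; exact: exprn_ge0.
have E2 : 0 <= Ex mu (fun x => y x ^+ 2) by apply: Ex_ge0 => x; exact: exprn_ge0.
have E1 : 0 <= Ex mu (fun x => y x `^ (2 + 2 / s%:R)) by apply: Ex_ge0 => x; exact: powR_ge0.
exact: pow_interpolate s2 E1 E2 E3 h.
Qed.

End Hoelder.

(** * The seminorms and the multiplicative derivatives *)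

Section Seminorms.
Context {d : measure_display} {X : measurableType d} {R : realType}.

Lemma limn_junk (u : nat -> R) : ~ cvgn u -> limn u = 0.
Proof. by move=> h; exact: dvgP. Qed.

Lemma limnZ (c : R) (u : nat -> R) : 0 < c -> limn (fun n => c * u n) = c * limn u.
Proof.
move=> c0; have [cu|ncu] := pselect (cvgn u).
  by apply/cvg_lim => //; apply: cvgMr.
rewrite (limn_junk ncu) mulr0 limn_junk// => h; apply: ncu.
have -> : u = (fun n => c^-1 * (c * u n)).
  by apply/funext => n; rewrite mulrA mulVf ?mul1r// gt_eqF.
by apply: is_cvgMr.
Qed.

Lemma limn_ge0 (u : nat -> R) : (forall n, 0 <= u n) -> 0 <= limn u.
Proof.
move=> u0; have [cu|ncu] := pselect (cvgn u); last by rewrite limn_junk.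
by apply: limr_ge => //; exact: nearW.
Qed.

Variables (mu : probability X R) (T Ti : X -> X).
Hypothesis HS : mps mu T Ti.

Definition mdiff (h : nat) (f : X -> R[i]) : X -> R[i] :=
  fun x => shiftf T Ti h%:Z f x * conjc (f x).

Definition avg (n : nat) (f : X -> R[i]) (N : nat) : R :=
  N%:R^-1 * \sum_(1 <= h < N.+1) (ghk_inf mu T Ti n (mdiff h f)) ^+ (2 ^ n.+1).

Lemma ghkS n f : ghk_inf mu T Ti n.+1 f = powR (limn (avg n f)) (1 / (2 ^ n.+2)%:R).
Proof. by []. Qed.

Lemma ghk_ge0 n f : 0 <= ghk_inf mu T Ti n f.
Proof. by case: n => [|n]; [exact: cmod_ge0|exact: powR_ge0]. Qed.

Lemma avg_ge0 n f N : 0 <= avg n f N.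
Proof. by rewrite mulr_ge0 ?invr_ge0// sumr_ge0// => h _; rewrite exprn_ge0// ghk_ge0. Qed.

Lemma ghkS_pow n f : ghk_inf mu T Ti n.+1 f ^+ (2 ^ n.+2) = limn (avg n f).
Proof.
rewrite ghkS -powR_mulrn ?powR_ge0// -powRrM mul1r mulVf; last by rewrite pnatr_eq0 expn_eq0.
by rewrite powRr1//; apply: limn_ge0 => N; exact: avg_ge0.
Qed.

(** A divergent sequence has [limn] equal to 0, so a positive seminorm certifies that its averages
    converge. *)
Lemma ghk_cvg n f : 0 < ghk_inf mu T Ti n.+1 f ->
  avg n f @ \oo --> ghk_inf mu T Ti n.+1 f ^+ (2 ^ n.+2).
Proof.
move=> g0; rewrite ghkS_pow; apply: contrapT => ncv.
have : limn (avg n f) = 0 by apply: limn_junk.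
by rewrite -ghkS_pow => /eqP; rewrite expf_eq0 (gt_eqF g0) andbF.
Qed.

Lemma bmc_mdiff h f : bmc f -> bmc (mdiff h f).
Proof.
move=> bf; have b := bmc_Tz HS (- h%:Z) bf.
by rewrite /mdiff /shiftf; bmct.
Qed.

Lemma cmod_mdiff h f x : cmod (mdiff h f x) = cmod (f x) * cmod (f (Tz T Ti (- h%:Z) x)).
Proof. by rewrite /mdiff /shiftf cmodM cmodJ mulrC. Qed.

Lemma ghkZ n c f : bmc f -> 0 < c ->
  ghk_inf mu T Ti n (fun x => cR c * f x) = c * ghk_inf mu T Ti n f.
Proof.
elim: n c f => [|n IH] c f bf c0.
  rewrite /= -{2}(gtr0_norm c0) -cmod_cR -cmodM; congr cmod.
  rewrite /cint; apply/eqP; rewrite eq_complex /=; have [b1 b2] := bf.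
  rewrite !mul0r subr0 addr0 -!/(Ex _ _) -!(ExZ _ c)//.
  apply/andP; split; apply/eqP; congr Ex; apply/funext => x.
    by rewrite cReM /= mul0r subr0.
  by rewrite cImM /= mul0r addr0.
rewrite !ghkS.
have -> : avg n (fun x => cR c * f x) = (fun N => (c ^+ 2) ^+ (2 ^ n.+1) * avg n f N).
  apply/funext => N; rewrite /avg mulrCA; congr (_ * _).
  rewrite mulr_sumr; apply: eq_bigr => h _.
  have -> : mdiff h (fun x => cR c * f x) = (fun x => cR (c ^+ 2) * mdiff h f x).
    by apply/funext => x; rewrite /mdiff /shiftf conjcM conjc_cR expr2 cRM; ring.
  rewrite IH ?exprMn//; first exact: bmc_mdiff.
  by rewrite exprn_gt0.
rewrite limnZ ?exprn_gt0// powRM; first last.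
- by apply: limn_ge0 => N; exact: avg_ge0.
- by rewrite exprn_ge0// sqr_ge0.
congr (_ * _); rewrite -exprM -expnS -powR_mulrn ?(ltW c0)// -powRrM mul1r divff ?powRr1// ?(ltW c0)//.
Qed.

Lemma pk_gt0 n : 0 < pk n :> R.
Proof. by rewrite divr_gt0 ?ltr0n// expn_gt0. Qed.

Lemma pk_ratio n : pk n.+1 / pk n.+2 = (1 + n.+2%:R^-1) / 2 :> R.
Proof.
rewrite /pk (expnS 2 n.+1) natrM -(natr1 n.+2).
have e0 : (2 ^ n.+1)%:R != 0 :> R by rewrite pnatr_eq0 expn_eq0.
have e1 : n.+2%:R != 0 :> R by rewrite pnatr_eq0.
have e2 : n.+2%:R + 1 != 0 :> R by rewrite natr1 pnatr_eq0.
move: ((2 ^ n.+1)%:R : R) (n.+2%:R : R) e0 e1 e2 => a b e0 e1 e2. field.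
by rewrite e0 e1 e2.
Qed.

(* Chosen so that [|Delta_h f| ^ pk n.+1 = (t t_h) ^ (2 + 2 / n.+2)], which interpolates between
   the square and the cube of [t t_h]. *)
Definition tpow (n : nat) (f : X -> R[i]) (x : X) : R := cmod (f x) `^ (pk n.+2 / 4).

Lemma bm_tpow n f : bmc f -> bm (tpow n f).
Proof.
move=> bf; apply: bm_powR; [by rewrite divr_ge0// ltW// pk_gt0|by bmct|by move=> x; exact: cmod_ge0].
Qed.

Lemma tpow4 n f x : tpow n f x ^+ 4 = cmod (f x) `^ pk n.+2.
Proof. by rewrite /tpow -powR_mulrn ?powR_ge0// -powRrM divfK. Qed.

Lemma mdiff_pow n h f x : cmod (mdiff h f x) `^ pk n.+1 =
  (tpow n f x * tpow n f (Tz T Ti (- h%:Z) x)) `^ (2 + 2 / n.+2%:R).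
Proof.
rewrite cmod_mdiff /tpow -powRM ?cmod_ge0// -powRrM; congr (_ `^ _).
have := pk_ratio n; have p0 : pk n.+2 != 0 :> R by rewrite gt_eqF// pk_gt0.
move=> /(congr1 (fun z => z * pk n.+2)); rewrite divfK// => ->.
have e1 : n.+2%:R != 0 :> R by rewrite pnatr_eq0.
by field.
Qed.

Let y n h f x := tpow n f x * tpow n f (Tz T Ti (- h%:Z) x).

Lemma bm_y n h f : bmc f -> bm (y n h f).
Proof.
move=> bf; have b := bm_tpow n bf; have b' := bm_Tz HS (- h%:Z) b.
by rewrite /y; bmct.
Qed.

Lemma y_ge0 n h f x : 0 <= y n h f x.
Proof. by rewrite mulr_ge0// powR_ge0. Qed.

Lemma corr_sq_le4 (t : X -> R) (h : int) : bm t ->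
  Ex mu (fun x => (t x * t (Tz T Ti h x)) ^+ 2) <= Ex mu (fun x => t x ^+ 4).
Proof.
move=> b; have b' := bm_Tz HS h b.
have b4 : bm (fun x => t x ^+ 4) by bmct.
apply: (@le_trans _ _ (Ex mu (fun x => 1 / 2 * t x ^+ 4 + 1 / 2 * t (Tz T Ti h x) ^+ 4))).
  apply: le_Ex; [by bmct|by bmct|move=> x].
  have := sqr_ge0 (t x ^+ 2 - t (Tz T Ti h x) ^+ 2).
  by move: (t x) (t _) => u v; lra.
rewrite ExD ?ExZ; try by bmct.
rewrite (Ex_Tz HS h b4); lra.
Qed.

Lemma corr_cube_le4 (t : X -> R) (h : int) : bm t ->
  Ex mu (fun x => (t x * t (Tz T Ti h x)) ^+ 3) ^+ 2 <=
  Ex mu (fun x => t x ^+ 4) * Ex mu (fun x => t (Tz T Ti h x) ^+ 4 * t x ^+ 4).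
Proof.
move=> b; have b' := bm_Tz HS h b.
have b1 : bm (fun x => t x * t (Tz T Ti h x)) by bmct.
have b2 : bm (fun x => (t x * t (Tz T Ti h x)) ^+ 2) by bmct.
have := Ex_CS mu b2 b1.
have -> : (fun x => (t x * t (Tz T Ti h x)) ^+ 2 * (t x * t (Tz T Ti h x))) =
    (fun x => (t x * t (Tz T Ti h x)) ^+ 3).
  by apply/funext => x; rewrite -exprSr.
move/le_trans; apply; rewrite mulrC.
have -> : (fun x => ((t x * t (Tz T Ti h x)) ^+ 2) ^+ 2) =
    (fun x => t (Tz T Ti h x) ^+ 4 * t x ^+ 4).
  by apply/funext => x; rewrite -exprM exprMn mulrC.
apply: ler_wpM2r; last exact: corr_sq_le4.
by apply: Ex_ge0 => x; rewrite mulr_ge0// (exprM _ 2 2) sqr_ge0.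
Qed.

Lemma corr_sq_le n h f : bmc f -> Ex mu (fun x => y n h f x ^+ 2) <=
  Ex mu (fun x => cmod (f x) `^ pk n.+2).
Proof.
move=> bf; apply: le_trans (corr_sq_le4 (- h%:Z) (bm_tpow n bf)) _.
by under eq_fun do rewrite tpow4.
Qed.

(** [hoelder_power] with s = n+2. The cube correlation is kept, as it is the quantity whose
    near-maximality [young_near_extremal] exploits; [mdiff_le_corr] gives up more to reach
    correlations of |f|^p. *)
Lemma mdiff_le_cube n h f : bmc f ->
  Ex mu (fun x => cmod (mdiff h f x) `^ pk n.+1) ^+ n.+2 <=
  Ex mu (fun x => cmod (f x) `^ pk n.+2) ^+ n * Ex mu (fun x => y n h f x ^+ 3) ^+ 2.
Proof.
move=> bf; under eq_fun do rewrite mdiff_pow.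
have := @hoelder_power _ _ _ mu (y n h f) n.+2 (bm_y n h bf) (@y_ge0 n h f) isT.
move/le_trans; apply; rewrite subn2 /= ler_wpM2r ?sqr_ge0//.
apply: lerXn2r; rewrite ?nnegrE; last exact: corr_sq_le.
- by apply: Ex_ge0 => x; exact: sqr_ge0.
- by apply: Ex_ge0 => x; exact: powR_ge0.
Qed.

Lemma mdiff_le_corr n h f : bmc f ->
  Ex mu (fun x => cmod (mdiff h f x) `^ pk n.+1) ^+ n.+2 <=
  Ex mu (fun x => cmod (f x) `^ pk n.+2) ^+ n.+1 *
  Ex mu (fun x => cmod (f (Tz T Ti (- h%:Z) x)) `^ pk n.+2 * cmod (f x) `^ pk n.+2).
Proof.
move=> bf; apply: le_trans (mdiff_le_cube n h bf) _.
have W0 : 0 <= Ex mu (fun x => cmod (f x) `^ pk n.+2) by apply: Ex_ge0 => x; exact: powR_ge0.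
rewrite (exprSr _ n) -mulrA; apply: ler_wpM2l; first exact: exprn_ge0.
have := corr_cube_le4 (- h%:Z) (bm_tpow n bf).
under [X in _ <= Ex mu X * _]eq_fun do rewrite tpow4.
by under [X in _ <= _ * Ex mu X]eq_fun do rewrite !tpow4.
Qed.

Hypothesis erg : ergodic mu Ti.

Lemma bm_cpow (p : R) (f : X -> R[i]) : 0 <= p -> bmc f -> bm (fun x => cmod (f x) `^ p).
Proof. by move=> p0 bf; apply: bm_powR => // [|x]; [bmct|exact: cmod_ge0]. Qed.

(** [ghk_inf n] is the seminorm of order n+1. Raising the norm bound to the power 2^(n+1) = (n+2)
    p_(n+1) removes all roots. *)
Theorem ghk_le_norm n f : bmc f ->
  ghk_inf mu T Ti n f ^+ (2 ^ n.+1) <= Ex mu (fun x => cmod (f x) `^ pk n.+1) ^+ n.+2.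
Proof.
elim: n f => [|n IH] f bf.
  have -> : pk 1 = 1 :> R by rewrite /pk expn1 divff// pnatr_eq0.
  rewrite expn1; apply: lerXn2r; rewrite ?nnegrE ?cmod_ge0//.
    by apply: Ex_ge0 => x; exact: powR_ge0.
  under eq_fun do rewrite powRr1 ?cmod_ge0//.
  rewrite -[leLHS]/(cmod (cint mu f)).
  have [b1 b2] := bf; set z := cint mu f.
  have bz : bmc (fun x => conjc (ph z) * f x) by bmct.
  have -> : cmod z = Ex mu (fun x => complex.Re (conjc (ph z) * f x)).
    have -> : (fun x => complex.Re (conjc (ph z) * f x)) = (fun x =>
       complex.Re (ph z) * complex.Re (f x) + complex.Im (ph z) * complex.Im (f x)).
      by apply/funext => x; rewrite cReM cReJ cImJ; ring.
    rewrite ExD ?ExZ; try by bmct.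
    have zr : Ex mu (fun x => complex.Re (f x)) = complex.Re z by [].
    have zi : Ex mu (fun x => complex.Im (f x)) = complex.Im z by [].
    rewrite zr zi; have [z0|z0] := eqVneq z 0.
      by rewrite z0 cmod0 /= !mulr0 addr0.
    have : complex.Re (z * conjc (ph z)) = cmod z.
      by rewrite -{1}(phK z) -mulrA mulcJ cmod_ph// expr1n cR1 mulr1.
    by rewrite cReM cReJ cImJ; lra.
  apply: le_Ex; [exact: bz.1|by bmct|move=> x].
  apply: le_trans (ler_norm _) _; apply: le_trans (Re_le_cmod _) _.
  by rewrite cmodM cmodJ ler_piMl ?cmod_ge0// cmod_ph_le1.
rewrite ghkS_pow; set W := Ex mu _.
have W0 : 0 <= W by apply: Ex_ge0 => x; exact: powR_ge0.
have [cv|ncv] := pselect (cvgn (avg n f)); last by rewrite limn_junk ?exprn_ge0.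
have bw : bm (fun x => cmod (f x) `^ pk n.+2).
  by apply: bm_cpow => //; rewrite ltW// pk_gt0.
apply/ler_addgt0Pr => e e0.
have e' : 0 < e / (W ^+ n.+1 + 1) by rewrite divr_gt0// ltr_wpDl// exprn_ge0.
have [N0 hN0] := mean_ergodic HS erg bw e'.
apply: limr_le => //; exists N0.+1 => // N /= NN0.
have Np : 0 < N%:R :> R by rewrite ltr0n; exact: leq_trans NN0.
rewrite /avg mulrC ler_pdivrMr//.
apply: (@le_trans _ _ (\sum_(1 <= h < N.+1) W ^+ n.+1 * Ex mu (fun x =>
   cmod (f (Tz T Ti (- h%:Z) x)) `^ pk n.+2 * cmod (f x) `^ pk n.+2))).
  apply: ler_sum => h _; apply: le_trans (IH _ (bmc_mdiff h bf)) _.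
  exact: mdiff_le_corr.
rewrite -mulr_sumr; have := hN0 N (ltnW NN0); rewrite ler_norml => /andP[_ h1].
have h2 : W ^+ n.+1 * (e / (W ^+ n.+1 + 1)) <= e.
  rewrite mulrA ler_pdivrMr; last by rewrite ltr_wpDl// exprn_ge0.
  by rewrite mulrC ler_wpM2l// ?(ltW e0)// lerDl.
have Wn : 0 <= W ^+ n.+1 by rewrite exprn_ge0.
apply: (@le_trans _ _ (W ^+ n.+1 * (N%:R * W ^+ 2 + e / (W ^+ n.+1 + 1) * N%:R))).
  by rewrite ler_wpM2l// -lerBlDl.
rewrite mulrDr mulrDl; apply: lerD.
  by rewrite mulrA mulrAC -exprD addn2.
by rewrite mulrA ler_wpM2r.
Qed.

End Seminorms.

(** * The system induced on a coset *)

Section CosetSystem.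
Context {d : measure_display} {X : measurableType d} {R : realType}.
Variables (mu : probability X R) (T Ti : X -> X).
Hypothesis HS : mps mu T Ti.
Variables (H : set X) (m : nat).
Hypothesis cH : coset mu Ti H m.

Let mH : measurable H. Proof. by case: cH. Qed.
Let m0 : (0 < m)%N. Proof. by case: cH. Qed.
Let mR : 0 < m%:R :> R. Proof. by rewrite ltr0n. Qed.
Let bH : bm (\1_H : X -> R). Proof. exact: bm_indic. Qed.

Lemma coset_inv (j : int) : {ae mu, forall x, (Tz T Ti (m%:Z * j) x \in H) = (x \in H)}.
Proof.
have [_ _ SK SiK _] := HS; have [_ _ inv _] := cH.
have nat_inv n : {ae mu, forall x, (Tz T Ti (- (m * n)%N%:Z) x \in H) = (x \in H)}.
  elim: n => [|n IH]; first by rewrite muln0; apply: aeW.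
  apply: filterS2 IH (ae_Tz HS (- (m * n)%N%:Z) inv) => x /= <- <-.
  by rewrite -[iter m Ti _](Tz_natN T) -(TzD SK SiK) -opprD -PoszD -mulnS.
case: (intP j) => [|n|n].
- by rewrite mulr0; apply: aeW.
- have := ae_Tz HS (m * n.+1)%N%:Z (nat_inv n.+1); apply: filterS => x /= <-.
  by rewrite (TzK SK SiK).
- by rewrite mulrN -PoszM; exact: nat_inv.
Qed.

Lemma coset_disjoint (h : nat) : ~~ (m %| h)%N ->
  {ae mu, forall x, x \in H -> (Tz T Ti (- h%:Z) x \in H) = false}.
Proof.
have [_ _ SK SiK _] := HS; have [_ _ _ part] := cH.
move=> mh; have r0 : (0 < h %% m)%N by rewrite lt0n.
have rm : (h %% m < m)%N by rewrite ltn_mod.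
have inv := ae_Tz HS (- (h %% m)%N%:Z) (coset_inv (- (h %/ m)%N%:Z)).
apply: filterS2 part inv => x /= px hx xH.
have -> : Tz T Ti (- h%:Z) x = Tz T Ti (m%:Z * - (h %/ m)%N%:Z) (Tz T Ti (- (h %% m)%N%:Z) x).
  rewrite -(TzD SK SiK); congr (Tz T Ti _ x).
  by rewrite {1}(divn_eq h m) PoszD PoszM mulrN opprD mulrC.
rewrite hx Tz_natN; apply/negP => hr.
move: px; rewrite (bigD1 (Ordinal rm)) //= hr (bigD1 (Ordinal m0)) /=; last first.
  by apply/eqP => /(congr1 val) /= e; move: r0; rewrite -e.
by rewrite xH.
Qed.

Lemma Ex_coset : m%:R * Ex mu \1_H = 1.
Proof.
have [_ _ _ part] := cH.
have bit (i : nat) : bm (fun x => \1_H (iter i Ti x) : R).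
  have := bm_Tz HS (- i%:Z) bH; congr bm; apply/funext => x.
  by rewrite Tz_natN.
transitivity (Ex mu (fun x => \sum_(i < m) (\1_H (iter i Ti x) : R))).
  rewrite Ex_sum; last by move=> i; exact: bit.
  rewrite (eq_bigr (fun=> Ex mu \1_H)) => [|i _].
    by rewrite sumr_const card_ord mulr_natl.
  have := Ex_Tz HS (- i%:Z) bH; congr (_ = _); congr Ex; apply/funext => x.
  by rewrite Tz_natN.
rewrite -[RHS](Ex_cst mu); apply: eq_ae_Ex.
- by apply: bm_sum => i; exact: bit.
- exact: bm_cst.
apply: filterS part => x /= px.
have -> : 1 = (\sum_(i < m) (iter i Ti x \in H))%N%:R :> R by rewrite px.
by rewrite natr_sum; apply: eq_bigr => i _; rewrite indicE.
Qed.

Lemma mu_coset : (m%:R%:E * mu H = 1)%E.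
Proof.
have := Ex_coset; rewrite Ex_indic// => h.
have fm : mu H \is a fin_num by apply: fin_num_measure.
by rewrite -(fineK fm) -EFinM; congr (_%:E); exact: h.
Qed.

Definition cond_on (nu : probability X R) : Prop :=
  forall A, measurable A -> nu A = (m%:R%:E * mu (A `&` H))%E.

Lemma cond_exists : exists nu : probability X R, cond_on nu.
Proof.
have mr0 : 0 <= m%:R :> R by [].
pose nu0 : {measure set X -> \bar R} := mscale (NngNum mr0) (mrestr mu mH).
exists (mnormalize nu0 mu) => A mA.
have e1 : nu0 setT = 1%E.
  by rewrite -[LHS]/(m%:R%:E * mu (setT `&` H))%E setTI mu_coset.
rewrite -[LHS]/(mnormalize nu0 mu A) /mnormalize e1 /=.
have -> : ((1 : \bar R) == 0)%E = false by apply/negbTE; rewrite onee_neq0.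
by rewrite /= invr1 mule1.
Qed.

Variable nu : probability X R.
Hypothesis Hnu : cond_on nu.

Lemma ae_cond (P : X -> Prop) :
  {ae mu, forall x, x \in H -> P x} -> {ae nu, forall x, P x}.
Proof.
move=> [A [mA A0 PA]]; exists (A `|` ~` H); split.
- by apply: measurableU => //; exact: measurableC.
- rewrite Hnu; last by apply: measurableU => //; exact: measurableC.
  rewrite (_ : mu _ = 0%E) ?mule0//; apply: (subset_measure0 _ mA _ A0).
    by apply: measurableI => //; apply: measurableU => //; exact: measurableC.
  by move=> x [[//|nH] xH].
- move=> x /= nP; have [xH|xH] := pselect (H x); [left; apply: PA => /= h|by right].
  by apply: nP; apply: h; rewrite inE.
Qed.

Lemma cond_ae (P : X -> Prop) :
  {ae nu, forall x, P x} -> {ae mu, forall x, x \in H -> P x}.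
Proof.
move=> [A [mA A0 PA]]; exists (A `&` H); split.
- exact: measurableI.
- move: A0; rewrite Hnu// => /eqP; rewrite mule_eq0 => /orP[|/eqP //].
  by rewrite eqe (gt_eqF mR).
- move=> x /= /not_implyP[xH nP]; split; first exact: PA.
  exact: set_mem.
Qed.

(** For nonnegative functions: m mu is nu plus a measure carried by the complement of H, where the
    indicator of H vanishes. Adding a bound M to g reduces to this case. *)
Lemma Ex_cond (g : X -> R) : bm g -> Ex nu g = m%:R * Ex mu (fun x => \1_H x * g x).
Proof.
have ge0_case (f : X -> R) : bm f -> (forall x, 0 <= f x) ->
    Ex nu f = m%:R * Ex mu (fun x => \1_H x * f x).
  move=> bf f0.
  have mr0 : 0 <= m%:R :> R by [].
  have mHc : measurable (~` H) by exact: measurableC.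
  pose nu1 : {measure set X -> \bar R} := mscale (NngNum mr0) (mrestr mu mHc).
  pose nu2 : {measure set X -> \bar R} := mscale (NngNum mr0) mu.
  have bHf : bm (fun x => \1_H x * f x) by bmct.
  have mHf : measurable_fun setT (fun x => (\1_H x * f x)%:E).
    by apply/measurable_EFinP; exact: bHf.1.
  have Hf0 x : 0 <= \1_H x * f x by rewrite mulr_ge0// indicE.
  have E1 : (\int[nu2]_x (\1_H x * f x)%:E = m%:R%:E * \int[mu]_x (\1_H x * f x)%:E)%E.
    by apply: ge0_integral_mscale => // x _; rewrite lee_fin.
  have E2 : (\int[nu2]_x (\1_H x * f x)%:E =
      \int[nu]_x (\1_H x * f x)%:E + \int[nu1]_x (\1_H x * f x)%:E)%E.
    rewrite -ge0_integral_measure_add//; last by move=> x _; rewrite lee_fin.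
    apply: eq_measure_integral => A mA _.
    transitivity (nu A + nu1 A)%E; last exact: (esym (measure_addE nu nu1 A)).
    rewrite Hnu// -[nu1 A]/(m%:R%:E * mu (A `&` ~` H))%E -[nu2 A]/(m%:R%:E * mu A)%E.
    rewrite -muleDr//; last by rewrite ge0_adde_def// inE.
    congr (_ * _)%E; rewrite -measureU//.
    - by rewrite -setIUr setUv setIT.
    - exact: measurableI.
    - exact: measurableI.
    - by rewrite setIACA setICr setI0.
  have E3 : (\int[nu1]_x (\1_H x * f x)%:E = 0)%E.
    rewrite (@ae_eq_integral _ _ _ nu1 setT (cst 0%E))//; first by rewrite integral0.
    exists H; split => //.
      by rewrite -[LHS]/(m%:R%:E * mu (H `&` ~` H))%E setICr measure0 mule0.
    move=> x /= h; apply: contrapT => nH; apply: h => _.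
    by rewrite indicE memNset// mul0r.
  have E4 : Ex nu (fun x => \1_H x * f x) = Ex nu f.
    apply: eq_ae_Ex => //; apply: ae_cond; apply: aeW => x xH.
    by rewrite indicE xH mul1r.
  have := EFin_Ex nu bHf; rewrite E4 => E5.
  move: E2; rewrite E1 E3 adde0 -E5 -EFin_Ex// -EFinM => -[] <- //.
move=> bg; have [_ [M gM]] := bg.
have bM : bm (fun x => g x + M) by apply: bmD => //; exact: bm_cst.
have := ge0_case _ bM (fun x => _); rewrite ExD//; last exact: bm_cst.
rewrite Ex_cst (_ : (fun x => \1_H x * (g x + M)) = (fun x => \1_H x * g x + M * \1_H x)); last first.
  by apply/funext => x; ring.
rewrite ExD ?ExZ; try by bmct.
rewrite mulrDr [m%:R * (M * _)]mulrCA Ex_coset mulr1 => h; apply: (addIr M); apply: h => x.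
by have := gM x; rewrite ler_norml => /andP[h _]; rewrite -lerBlDr sub0r.
Qed.

Lemma cond_mps : mps nu (iter m T) (iter m Ti).
Proof.
have [mS mSi SK SiK _] := mps_iter HS m.
split => // A mA.
have mSA : measurable (iter m T @^-1` A) := measurable_Tz_pre HS m%:Z mA.
rewrite !Hnu//; congr (_ * _)%E.
rewrite -(Tz_mp HS m%:Z (measurableI _ _ mA mH)).
have mSAH : measurable (Tz T Ti m%:Z @^-1` (A `&` H)).
  by apply: (measurable_Tz_pre HS); exact: measurableI.
have mSH : measurable (iter m T @^-1` A `&` H) by exact: measurableI.
have inv : {ae mu, forall x, (Tz T Ti m%:Z x \in H) = (x \in H)}.
  by have := coset_inv 1; rewrite mulr1.
rewrite -[LHS](fineK (fin_num_measure _ _ mSH)) -[RHS](fineK (fin_num_measure _ _ mSAH)).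
congr (_%:E); rewrite -!Ex_indic//; apply: eq_ae_Ex; try exact: bm_indic.
apply: filterS inv => x /= hx; rewrite !indicE; congr (_%:R); congr nat_of_bool.
have hx' : H (Tz T Ti m x) <-> H x.
  by split => h; apply: set_mem; [rewrite -hx|rewrite hx]; rewrite inE.
apply/idP/idP; rewrite !inE => -[h1 h2]; split => //.
- exact/hx'.
- exact/hx'.
Qed.

(** A T^m-invariant function on H is copied to the m translates of H. The resulting sum is invariant
    under T, hence constant, and on H it restores the given function. *)
Lemma cond_ergodic : ergodic mu Ti -> ergodic nu (iter m Ti).
Proof.
move=> erg g bg inv.
have [_ _ _ part] := cH.
pose u i x : R := \1_H (iter i Ti x) * g (iter i Ti x).
have bu i : bm (u i).
  have b0 : bm (fun x => \1_H x * g x) by bmct.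
  have := bm_Tz HS (- i%:Z) b0; congr bm; apply/funext => x.
  by rewrite Tz_natN.
have um : {ae mu, forall x, u m x = u 0%N x}.
  have invH : {ae mu, forall x, (Tz T Ti (m%:Z * -1) x \in H) = (x \in H)} := coset_inv (-1).
  apply: filterS2 invH (cond_ae inv) => x /=.
  rewrite mulrN1 Tz_natN => h1 h2; rewrite /u /= !indicE h1.
  by case: (boolP (x \in H)) h2 => [_ /(_ isT) ->|_ _]; rewrite ?mul0r.
have bG : bm (fun x => \sum_(i < m) u i x) by apply: bm_sum => i; exact: bu.
have [c hc] : exists c, {ae mu, forall x, \sum_(i < m) u i x = c}.
  apply: erg => //; apply: filterS um => x /= hx.
  rewrite (eq_bigr (fun i : 'I_m => u i.+1 x)) => [|i _]; last by rewrite /u iterSr.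
  apply: (@addrI _ (u 0%N x)).
  have := @big_ord_recl R 0 +%R m (fun i => u i x) => <-.
  by rewrite big_ord_recr /= addrC; congr (_ + _); rewrite hx.
exists c; apply: ae_cond; apply: filterS2 hc part => x /= <- px xH.
rewrite (bigD1 (Ordinal m0)) //= big1 ?addr0; first by rewrite /u /= indicE xH mul1r.
move=> i i0; rewrite /u indicE; suff /negPf -> : iter i Ti x \notin H by rewrite mul0r.
apply/negP => hi; move: px.
by rewrite (bigD1 (Ordinal m0)) //= xH (bigD1 i) //= hi.
Qed.

End CosetSystem.

Section ElementaryInequalities.
Context {R : realType}.

Lemma Re_cRM (a : R) (z : R[i]) : complex.Re (cR a * z) = a * complex.Re z.
Proof. by case: z => u v; rewrite /= mul0r subr0. Qed.

Lemma bernoulli (e : R) (k : nat) : 0 <= e <= 1 -> 1 - k%:R * e <= (1 - e) ^+ k.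
Proof.
move=> /andP[e0 e1]; elim: k => [|k IH]; first by rewrite mul0r subr0 expr0.
have h : (1 - k%:R * e) * (1 - e) <= (1 - e) ^+ k * (1 - e).
  by apply: ler_wpM2r => //; lra.
rewrite exprSr; apply: le_trans h; rewrite -natr1.
have k0 : 0 <= k%:R :> R by [].
have : 0 <= k%:R * e * e by rewrite !mulr_ge0.
by lra.
Qed.

Lemma root_ge (x c : R) (k : nat) : (0 < k)%N -> 0 <= x -> c <= 1 -> c <= x ^+ k -> c <= x.
Proof.
move=> k0 x0 c1 h; have [x1|x1] := leP x 1; last by rewrite (le_trans c1)// ltW.
by apply: le_trans h _; rewrite -[leRHS]expr1; apply: ler_wiXn2l; rewrite ?x0.
Qed.

Lemma sum_multiples (x : nat -> R) (m J : nat) : (0 < m)%N -> (forall h, 0 <= x h) ->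
  \sum_(1 <= j < J.+1) x (m * j)%N <= \sum_(1 <= h < (m * J).+1) x h.
Proof.
move=> m0 x0; elim: J => [|J IH]; first by rewrite muln0 !big_geq.
have hle : ((m * J).+1 <= (m * J.+1).+1)%N by rewrite ltnS leq_pmul2l.
rewrite big_nat_recr//= (big_cat_nat _ hle)//=.
apply: lerD => //.
have e : (m * J.+1 = (m * J + m.-1).+1)%N by rewrite mulnS addnC -addnS prednK.
rewrite e big_nat_recr/=; last by rewrite ltnS leq_addr.
by rewrite lerDr sumr_ge0.
Qed.

(** Failures of P have density at most 1/4, so P meets each of its translates: among the first J > k
    indices, the failures at j or at j + k number at most J/4 + (J + k)/4 < J. *)
Lemma dense_differences (P : nat -> bool) (J0 : nat) :
  (forall J, (J0 <= J)%N -> (4 * \sum_(1 <= j < J.+1) ~~ P j <= J)%N) ->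
  forall g : int, exists j j' : nat, [/\ P j, P j' & g = j%:Z - j'%:Z].
Proof.
move=> bad.
have key k : exists j, P j && P (j + k)%N.
  apply: contrapT => /forallNP no.
  pose J := (k + J0).+1.
  have h1 := bad J (leq_trans (leq_addl _ _) (leqnSn _)).
  have h2 : (4 * \sum_(1 <= j < (J + k).+1) ~~ P j <= J + k)%N.
    by apply: bad; rewrite /J; lia.
  have h3 : (J <= \sum_(1 <= j < J.+1) ~~ P j + \sum_(1 <= j < (J + k).+1) ~~ P j)%N.
    apply: (@leq_trans (\sum_(1 <= j < J.+1) 1)%N).
      by rewrite sum_nat_const_nat subn1 muln1.
    apply: (@leq_trans (\sum_(1 <= j < J.+1) (~~ P j + ~~ P (j + k))%N)).
      by apply: leq_sum => j _; have := no j; do 2 case: (P _).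
    rewrite big_split /= leq_add2l.
    have e : (J + k).+1 = (J.+1 + k)%N by rewrite addSn.
    have E : (\sum_(1 + k <= i < J.+1 + k) ~~ P i = \sum_(1 <= i < J.+1) ~~ P (i + k))%N.
      by rewrite (@big_addn _ _ _ 1 (J.+1 + k) k) addnK.
    have s1 : (1 <= 1 + k)%N by lia.
    have s2 : (1 + k <= J.+1 + k)%N by lia.
    by rewrite e -E [X in (_ <= X)%N](big_cat_nat s1 s2) /=; exact: leq_addl.
  by move: h1 h2 h3; rewrite /J; lia.
move=> g; have [gp|gn] := leP 0 g.
  have [j /andP[h1 h2]] := key `|g|%N.
  by exists (j + `|g|)%N, j; split => //; lia.
have [j /andP[h1 h2]] := key `|g|%N.
by exists j, (j + `|g|)%N; split => //; lia.
Qed.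

End ElementaryInequalities.

(** * The inverse theorem for bounded functions *)

Section PhaseInverse.
Context {R : realType}.

(** The coset belongs to the data: the moduli of the rescaled derivatives along multiples of m
    concentrate on the same H, so the induction carries only the phase. [eps] is chosen before the
    system. *)
Definition phase_inverse (n : nat) : Prop :=
  forall delta : R, 0 < delta -> exists2 eps : R, 0 < eps &
  forall (d : measure_display) (X : measurableType d) (mu : probability X R)
    (T Ti : X -> X), mps mu T Ti -> ergodic mu Ti ->
  forall (H : set X) (m : nat), coset mu Ti H m ->
  forall nu : probability X R, cond_on mu H m nu ->
  forall f : X -> R[i], bmc f ->
    Ex mu (fun x => cmod (f x) `^ pk n.+1) <= 1 ->
    Ex mu (fun x => `|cmod (f x) `^ pk n.+1 - m%:R * \1_H x|) <= eps ->
    1 - eps <= ghk_inf mu T Ti n f ->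
  exists q, [/\ uni q, PP nu (iter m Ti) n.+1 q &
    Ex nu (fun x => cmod (ph (f x) - q x)) <= delta].

(** For the integral z of f, E |f| |ph f - ph z|^2 = 2 E |f| - 2 |z| <= 2 eps, so on H the phase of
    f is close to the constant [ph z]. *)
Lemma phase_inverse0 : phase_inverse 0.
Proof.
move=> delta delta0.
pose eps : R := Num.min (1 / 2) (Num.min (delta / 4) (delta ^+ 2 / 8)).
have [eps0 eps2 epsd epsd2] : [/\ 0 < eps, eps <= 1 / 2, eps <= delta / 4 & eps <= delta ^+ 2 / 8].
  rewrite /eps; split.
  - by rewrite !lt_min !divr_gt0// exprn_gt0.
  - by rewrite ge_min lexx.
  - by rewrite !ge_min lexx orbT.
  - by rewrite !ge_min lexx !orbT.
clearbody eps.
exists eps => // d X mu T Ti HS erg H m cH nu Hnu f bf Ef close norm.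
have [mH m0 _ _] := cH.
have bH : bm (\1_H : X -> R) := bm_indic mH.
have mR : 0 < m%:R :> R by rewrite ltr0n.
have pk1 : pk 1 = 1 :> R by rewrite /pk expn1 divff// pnatr_eq0.
have E1 : (fun x => cmod (f x) `^ pk 1) = (fun x => cmod (f x)).
  by apply/funext => x; rewrite pk1 powRr1// cmod_ge0.
have E2 : (fun x => `|cmod (f x) `^ pk 1 - m%:R * \1_H x|) =
    (fun x => `|cmod (f x) - m%:R * \1_H x|).
  by apply/funext => x; rewrite pk1 powRr1// cmod_ge0.
rewrite E1 in Ef; rewrite E2 in close.
pose z := cint mu f.
have zn : 1 - eps <= cmod z := norm.
have z0 : z != 0.
  by apply/eqP => z0; move: zn; rewrite z0 cmod0; lra.
have lam1 := cmod_ph z0.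
exists (fun=> ph z); split.
- exact: uni_cst.
- exact: (PP_cst (cond_mps HS cH Hnu)).
have bph : bmc (fun x => ph (f x)) := bmc_ph (bmc_cmeas bf).
rewrite (Ex_cond HS cH Hnu); last by bmct.
rewrite -ExZ; last by bmct.
pose g x := cmod (f x) * cmod (ph (f x) - ph z) ^+ 2.
have bg : bm g by rewrite /g; bmct.
have g0 x : 0 <= g x by rewrite mulr_ge0 ?sqr_ge0// cmod_ge0.
have Eg : Ex mu g <= 2 * eps.
  have -> : g = (fun x => 2 * cmod (f x) - 2 * complex.Re (conjc (ph z) * f x)).
    apply/funext => x; rewrite /g; have [->|fx0] := eqVneq (f x) 0.
      by rewrite cmod0 !mul0r !mulr0 /= ?mulr0 subrr.
    have : cmod (ph (f x) - ph z) ^+ 2 = 2 - 2 * complex.Re (conjc (ph z) * ph (f x)).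
      have := cmod_sqr (ph (f x)); have := cmod_sqr (ph z).
      rewrite (cmod_ph fx0) lam1 expr1n cmod_sqr cReD cReN cImD cImN cReM cReJ cImJ.
      by move: (complex.Re _) (complex.Im _) (complex.Re _) (complex.Im _) => *; lra.
    have -> : complex.Re (conjc (ph z) * f x) =
        cmod (f x) * complex.Re (conjc (ph z) * ph (f x)).
      by rewrite -{1}(phK (f x)) mulrCA Re_cRM.
    by move=> ->; ring.
  have bR : bm (fun x => complex.Re (conjc (ph z) * f x)).
    by have [] : bmc (fun x => conjc (ph z) * f x) by bmct.
  rewrite ExB ?ExZ; try by bmct.
  have -> : Ex mu (fun x => complex.Re (conjc (ph z) * f x)) = cmod z.
    have [b1 b2] := bf.
    have -> : (fun x => complex.Re (conjc (ph z) * f x)) = (fun x =>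
       complex.Re (ph z) * complex.Re (f x) + complex.Im (ph z) * complex.Im (f x)).
      by apply/funext => x; rewrite cReM cReJ cImJ; ring.
    rewrite ExD ?ExZ; try by bmct.
    have zr : Ex mu (fun x => complex.Re (f x)) = complex.Re z by [].
    have zi : Ex mu (fun x => complex.Im (f x)) = complex.Im z by [].
    rewrite zr zi.
    have : complex.Re (z * conjc (ph z)) = cmod z.
      by rewrite -{1}(phK z) -mulrA mulcJ lam1 expr1n cR1 mulr1.
    by rewrite cReM cReJ cImJ; lra.
  by move: zn Ef; lra.
have CS : Ex mu (fun x => cmod (f x) * cmod (ph (f x) - ph z)) ^+ 2 <= 2 * eps.
  have b1 : bm (fun x => Num.sqrt (cmod (f x))) by bmct.
  have b2 : bm (fun x => Num.sqrt (cmod (f x)) * cmod (ph (f x) - ph z)) by bmct.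
  have := Ex_CS mu b1 b2.
  have -> : (fun x => Num.sqrt (cmod (f x)) * (Num.sqrt (cmod (f x)) * cmod (ph (f x) - ph z))) =
    (fun x => cmod (f x) * cmod (ph (f x) - ph z)).
    by apply/funext => x; rewrite mulrA -expr2 sqr_sqrtr// cmod_ge0.
  have -> : (fun x => Num.sqrt (cmod (f x)) ^+ 2) = (fun x => cmod (f x)).
    by apply/funext => x; rewrite sqr_sqrtr// cmod_ge0.
  have -> : (fun x => (Num.sqrt (cmod (f x)) * cmod (ph (f x) - ph z)) ^+ 2) = g.
    by apply/funext => x; rewrite exprMn sqr_sqrtr// cmod_ge0.
  move=> /le_trans; apply; apply: le_trans Eg; rewrite ler_piMl//.
  exact: Ex_ge0.
have A1 : Ex mu (fun x => cmod (f x) * cmod (ph (f x) - ph z)) <= delta / 2.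
  rewrite -(ler_pXn2r (n := 2)) ?nnegrE//; last 2 first.
  - by apply: Ex_ge0 => x; rewrite mulr_ge0// cmod_ge0.
  - by rewrite divr_ge0// ltW.
  by apply: le_trans CS _; move: epsd2; rewrite exprMn; lra.
apply: (@le_trans _ _ (Ex mu (fun x => 2 * `|cmod (f x) - m%:R * \1_H x| +
   cmod (f x) * cmod (ph (f x) - ph z)))).
  apply: le_Ex; [by bmct|by bmct|move=> x].
  have h2 : cmod (ph (f x) - ph z) <= 2.
    apply: le_trans (cmodD _ _) _; rewrite cmodN lam1.
    by have := cmod_ph_le1 (f x); lra.
  have h0 := cmod_ge0 (ph (f x) - ph z).
  rewrite mulrA.
  have : (m%:R * \1_H x - cmod (f x)) * cmod (ph (f x) - ph z) <=
     `|cmod (f x) - m%:R * \1_H x| * 2.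
    apply: le_trans (ler_norm _) _; rewrite normrM distrC (ger0_norm h0).
    by rewrite ler_wpM2l.
  by rewrite mulrBl; lra.
rewrite ExD ?ExZ; try by bmct.
lra.
Qed.

End PhaseInverse.

(** * Correlations of a weight close to the normalised indicator of a coset *)

Section NearCosetWeights.
Context {d : measure_display} {X : measurableType d} {R : realType}.
Variables (mu : probability X R) (T Ti : X -> X).
Hypotheses (HS : mps mu T Ti) (erg : ergodic mu Ti).
Variables (H : set X) (m : nat).
Hypothesis cH : coset mu Ti H m.
Variables (w : X -> R) (eps : R).
Hypotheses (bw : bm w) (w0 : forall x, 0 <= w x) (Ew : Ex mu w <= 1).
Hypothesis close : Ex mu (fun x => `|w x - m%:R * \1_H x|) <= eps.

Let mR : 0 < m%:R :> R. Proof. by rewrite ltr0n; case: cH. Qed.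
Let bH : bm (\1_H : X -> R). Proof. by apply: bm_indic; case: cH. Qed.
Let corr (h : nat) := Ex mu (fun x => w (Tz T Ti (- h%:Z) x) * w x).

(* Below both [w] and [m 1_H], so its correlations bound those of [w] at every multiple of [m]. *)
Definition clip x : R := Num.min (w x) (m%:R * \1_H x).

Lemma bm_clip : bm clip. Proof. by rewrite /clip; bmct. Qed.

Lemma clip_ge0 x : 0 <= clip x.
Proof. by rewrite le_min w0 mulr_ge0 ?(ltW mR)// indicE. Qed.

Lemma clip_le x : clip x <= w x. Proof. by rewrite ge_min lexx. Qed.

Lemma clip_leH x : clip x <= m%:R * \1_H x. Proof. by rewrite ge_min lexx orbT. Qed.

Lemma clip_lem x : clip x <= m%:R.
Proof.
apply: le_trans (clip_leH x) _; rewrite indicE.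
by case: (_ \in _); rewrite ?mulr1// mulr0 ltW.
Qed.

(** With e = m 1_H - clip, of integral at most eps, (m - e') (m - e) >= m^2 - m (e' + e) on H, where
    e' is the translate; T^(mj) preserves H almost everywhere. *)
Lemma corr_clip j : m%:R * (1 - 2 * eps) <=
  Ex mu (fun x => clip (Tz T Ti (- (m * j)%N%:Z) x) * clip x).
Proof.
pose e x := m%:R * \1_H x - clip x.
have bc := bm_clip; have be : bm e by rewrite /e; bmct.
have e0 x : 0 <= e x by rewrite subr_ge0; exact: clip_leH.
have Ee : Ex mu e <= eps.
  apply: le_trans close; apply: le_Ex; [by []|by bmct|move=> x].
  rewrite /e /clip; have [h|h] := leP (w x) (m%:R * \1_H x); last by rewrite subrr.
  by rewrite distrC; exact: ler_norm.
pose h : int := - (m * j)%N%:Z; rewrite -/h; have bcT := bm_Tz HS h bc; have beT := bm_Tz HS h be.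
apply: (@le_trans _ _ (Ex mu (fun x => m%:R ^+ 2 * \1_H x - m%:R * (e (Tz T Ti h x) + e x)))).
  have -> : Ex mu (fun x => m%:R ^+ 2 * \1_H x - m%:R * (e (Tz T Ti h x) + e x)) =
      m%:R ^+ 2 * Ex mu \1_H - m%:R * (Ex mu e + Ex mu e).
    rewrite ExB; [|by bmct|by bmct]; rewrite !ExZ; [|by bmct|by bmct].
    rewrite ExD; [|by bmct|by bmct].
    by have := Ex_Tz HS h be => /= ->.
  rewrite expr2 -mulrA (Ex_coset HS cH) mulr1.
  have : m%:R * Ex mu e <= m%:R * eps by rewrite ler_wpM2l// ltW.
  lra.
apply: le_ae_Ex; [by bmct|by bmct|].
have inv := coset_inv HS cH (- j%:Z).
apply: filterS inv => x /=; rewrite mulrN -PoszM -/h => hx.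
have -> : clip (Tz T Ti h x) = m%:R * \1_H x - e (Tz T Ti h x).
  by rewrite /e !indicE hx; ring.
have -> : clip x = m%:R * \1_H x - e x by rewrite /e; ring.
have := e0 x; have := e0 (Tz T Ti h x); rewrite !indicE.
case: (boolP (x \in H)) => xH h1 h2.
  rewrite !mulr1 -subr_ge0.
  rewrite (_ : _ - _ = e (Tz T Ti h x) * e x); last by ring.
  exact: mulr_ge0.
have z y : (y \in H) = false -> e y = 0.
  move=> yH; apply/eqP; rewrite eq_le e0 andbT.
  by have := clip_ge0 y; rewrite /e indicE yH mulr0; lra.
by rewrite (z x (negbTE xH)) (z (Tz T Ti h x)) ?hx ?(negbTE xH)// !mulr0 !(addr0, subrr, mulr0, subr0).
Qed.

Lemma corr_mult_lower j : m%:R * (1 - 2 * eps) <= corr (m * j).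
Proof.
apply: le_trans (corr_clip j) _; have bc := bm_clip.
have bcT := bm_Tz HS (- (m * j)%N%:Z) bc; have bwT := bm_Tz HS (- (m * j)%N%:Z) bw.
apply: le_Ex; [by bmct|by bmct|move=> x].
by apply: ler_pM; rewrite ?clip_ge0 ?clip_le.
Qed.

(** Up to N = m J, the gaps corr - c sum to at most 3 theta N / 100, and so does the excess of corr
    over its lower bound m (1 - 2 eps) at the multiples of m. Each failing j costs theta m in one of
    the two, so at most 6 J / 100 fail. *)
Lemma good_returns (c : nat -> R) (theta : R) : 0 < theta <= 1 ->
  0 <= eps <= theta / 100 ->
  (forall h, 0 <= c h <= corr h) ->
  (exists N1, forall N, (N1 <= N)%N ->
    (1 - 2 * (theta / 100)) * N%:R <= \sum_(1 <= h < N.+1) c h) ->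
  exists J0, forall J, (J0 <= J)%N ->
  (4 * \sum_(1 <= j < J.+1)
     ~~ ((corr (m * j) - c (m * j)%N <= theta * m%:R)%R &&
         (corr (m * j) <= (1 + theta) * m%:R)%R) <= J)%N.
Proof.
move=> /andP[th0 th1] /andP[eps0 epst] hc [N1 hN1].
have m0 : (0 < m)%N by case: cH.
pose e1 := theta / 100.
have e10 : 0 < e1 by rewrite divr_gt0.
have [N2 hN2] := mean_ergodic HS erg bw e10.
exists (maxn N1 N2) => J; rewrite geq_max => /andP[J1 J2].
pose N := (m * J)%N.
have JN : (J <= N)%N by rewrite leq_pmull.
have s1 := hN1 N (leq_trans J1 JN).
have s2 : \sum_(1 <= h < N.+1) corr h <= (1 + e1) * N%:R.
  have := hN2 N (leq_trans J2 JN); rewrite ler_norml => /andP[_].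
  have W1 : Ex mu w ^+ 2 <= 1 by rewrite expr_le1//; apply: Ex_ge0.
  have : N%:R * Ex mu w ^+ 2 <= N%:R by rewrite ler_piMr.
  rewrite -/(corr _) => h1 h2.
  have -> : \sum_(1 <= h < N.+1) corr h =
    \sum_(1 <= h < N.+1) Ex mu (fun x => w (Tz T Ti (- h%:Z) x) * w x) by [].
  by move: h1 h2; lra.
have corr0 h : 0 <= corr h by have /andP[h1 h2] := hc h; exact: le_trans h2.
have t1 : \sum_(1 <= j < J.+1) (corr (m * j) - c (m * j)%N) <=
    \sum_(1 <= h < N.+1) (corr h - c h).
  apply: (@sum_multiples _ (fun h => corr h - c h)) => // h.
  by rewrite subr_ge0; case/andP: (hc h).
have t2 : \sum_(1 <= j < J.+1) corr (m * j) <= \sum_(1 <= h < N.+1) corr h.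
  exact: (@sum_multiples _ corr).
pose P j := (corr (m * j) - c (m * j)%N <= theta * m%:R)%R &&
         (corr (m * j) <= (1 + theta) * m%:R)%R.
pose bad := (\sum_(1 <= j < J.+1) ~~ P j)%N.
have NE : N%:R = m%:R * J%:R :> R by rewrite -natrM.
have t3 : bad%:R * (theta * m%:R) <= \sum_(1 <= j < J.+1) (corr (m * j) - c (m * j)%N) +
    (\sum_(1 <= j < J.+1) corr (m * j) - J%:R * (m%:R * (1 - 2 * eps))).
  have -> : J%:R * (m%:R * (1 - 2 * eps)) = \sum_(1 <= j < J.+1) (m%:R * (1 - 2 * eps)).
    by rewrite sumr_const_nat subn1 /= mulr_natl.
  rewrite -sumrB -big_split /= natr_sum mulr_suml; apply: ler_sum => j _.
  have /andP[g1 g2] := hc (m * j)%N; have g3 := corr_mult_lower j.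
  rewrite /P; have [h1|h1] /= := leP (corr (m * j) - c (m * j)%N) (theta * m%:R).
    have [h2|h2] /= := leP (corr (m * j)) ((1 + theta) * m%:R).
      by rewrite mul0r addr_ge0 ?subr_ge0.
    rewrite mul1r; have : 0 <= m%:R * eps by rewrite mulr_ge0// ltW.
    by move: h2 g2; lra.
  rewrite mul1r; move: h1 g3; lra.
rewrite -(ler_nat R) natrM -[(\sum_(1 <= j < J.+1) _)%N]/bad.
have JR : 0 <= J%:R :> R by [].
have t4 : bad%:R * (theta * m%:R) <= 6 * e1 * (m%:R * J%:R).
  move: t1 t2 t3; rewrite !sumrB => t1 t2 t3.
  have : eps * (m%:R * J%:R) <= e1 * (m%:R * J%:R).
    by apply: ler_wpM2r => //; rewrite mulr_ge0// ltW.
  rewrite NE -/e1 in s1 s2; lra.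
have : theta * m%:R * bad%:R <= theta * m%:R * (6 / 100 * J%:R).
  by move: t4; rewrite /e1; lra.
rewrite ler_pM2l ?mulr_gt0// => h.
by lra.
Qed.

End NearCosetWeights.

(** * Renormalised derivatives are near-extremisers *)

Section Rescaling.
Context {R : realType}.

(** With r = (1 + 1/s) / 2, the bounds B <= a^(1/s) and K^(1-r) <= a^(2 (1-r)) = a^(1 - 1/s)
    multiply to a. In use K is a product of clipped weights, B a moment of the derivative, and K / a
    <= K^r / B is what is needed. *)
Lemma rescale_lower (s : nat) (a B K : R) : (0 < s)%N -> 0 < a -> 0 <= B -> B ^+ s <= a ->
  0 <= K <= a ^+ 2 -> B * K <= a * K `^ ((1 + s%:R^-1) / 2).
Proof.
move=> s0 a0 B0 Ba /andP[K0 Ka]; have sR : 0 < s%:R :> R by rewrite ltr0n.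
have s1 : s%:R^-1 <= 1 :> R by rewrite invf_le1// ler1n.
have si : 0 < s%:R^-1 :> R by rewrite invr_gt0.
have [->|K1] := eqVneq K 0; first by rewrite mulr0 mulr_ge0 ?powR_ge0// ltW.
set r := (1 + _) / 2; have r1 : 0 <= 1 - r by rewrite /r; move: s1; lra.
have hB : B <= a `^ s%:R^-1.
  have -> : B = (B ^+ s) `^ s%:R^-1.
    by rewrite -powR_mulrn// -powRrM divff ?powRr1// gt_eqF.
  by apply: ge0_ler_powR; rewrite ?nnegrE ?exprn_ge0// ltW.
have hK : K `^ (1 - r) <= a `^ (1 - s%:R^-1).
  have -> : a `^ (1 - s%:R^-1) = (a ^+ 2) `^ (1 - r).
    by rewrite -powR_mulrn ?(ltW a0)// -powRrM; congr (_ `^ _); rewrite /r; field; rewrite gt_eqF.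
  by apply: ge0_ler_powR; rewrite ?nnegrE ?exprn_ge0// ltW.
have -> : B * K = B * K `^ (1 - r) * K `^ r.
  by rewrite -mulrA -powRD ?subrK ?powRr1//; apply/implyP => _.
apply: ler_wpM2r; first exact: powR_ge0.
have Ea : a `^ s%:R^-1 * a `^ (1 - s%:R^-1) = a.
  rewrite -powRD; last by rewrite (gt_eqF a0) implybT.
  by rewrite subrKC powRr1// ltW.
rewrite -[leRHS]Ea; apply: ler_pM hB hK => //; exact: powR_ge0.
Qed.

Lemma norm_subl_le (v h z : R) : z <= v -> z <= h -> `|v - h| <= v + h - 2 * z.
Proof. by move=> h1 h2; rewrite ler_norml; apply/andP; split; lra. Qed.

Lemma ratio_lower1 (M theta eps k : R) : 1 <= M -> 0 < theta <= 1 / 10 ->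
  0 <= eps <= theta / 100 -> M * (1 - 2 * eps) <= k ->
  1 + 1 - 2 * (((1 + theta) * M)^-1 * k) <= 4 * theta.
Proof.
move=> M1 /andP[t0 t1] /andP[e0 e1] h.
suff : 1 - 2 * theta <= ((1 + theta) * M)^-1 * k by lra.
rewrite ler_pdivlMl; last by apply: mulr_gt0; lra.
have h1 : 0 <= M * theta * theta by rewrite !mulr_ge0//; lra.
have h2 : M * eps <= M * (theta / 100) by apply: ler_wpM2l => //; lra.
have h3 : 0 <= M * theta by rewrite mulr_ge0//; lra.
lra.
Qed.

Lemma ratio_lower2 (M theta b c : R) : 1 <= M -> 0 < theta <= 1 / 10 ->
  (1 - 2 * theta) * M <= c -> 0 < b <= (1 + theta) * M -> 1 - 4 * theta <= b^-1 * c.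
Proof.
move=> M1 /andP[t0 t1] h /andP[b0 b1]; rewrite ler_pdivlMl//.
have h1 : 0 <= M * theta * theta by rewrite !mulr_ge0//; lra.
have h2 : (1 - 4 * theta) * b <= (1 - 4 * theta) * ((1 + theta) * M).
  by apply: ler_wpM2l => //; lra.
have h3 : 0 <= M * theta by rewrite mulr_ge0//; lra.
lra.
Qed.

Lemma cmodMB (a b a' b' : R[i]) : cmod b <= 1 -> cmod a' <= 1 ->
  cmod (a * b - a' * b') <= cmod (a - a') + cmod (b - b').
Proof.
move=> b1 a1; apply: le_trans (cmod_triB _ (a' * b) _) _.
rewrite -mulrBl -mulrBr !cmodM; apply: lerD.
  by rewrite ler_piMr// cmod_ge0.
by rewrite ler_piMl// cmod_ge0.
Qed.

End Rescaling.

Section GoodShift.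
Context {d : measure_display} {X : measurableType d} {R : realType}.
Variables (mu : probability X R) (T Ti : X -> X).
Hypotheses (HS : mps mu T Ti) (erg : ergodic mu Ti).
Variables (H : set X) (m : nat).
Hypothesis cH : coset mu Ti H m.
Variables (n : nat) (f : X -> R[i]) (eps : R).
Hypothesis bf : bmc f.
Let w x := cmod (f x) `^ pk n.+2.
Hypothesis Ew : Ex mu w <= 1.
Hypothesis close : Ex mu (fun x => `|w x - m%:R * \1_H x|) <= eps.

(** [lam] normalises the p-th moment to 1. Both |g|^p and m 1_H have integral 1 and dominate K / a,
    with K the product of the clipped weights, so their distance is at most 2 - 2 E K / a, which
    [corr_clip] bounds. For the seminorm, c, B^(n+2) and m are all close up to factors. *)
Lemma good_shift (j : nat) (theta : R) : 0 < theta <= 1 / 10 -> 0 <= eps <= theta / 100 ->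
  let corr := Ex mu (fun x => w (Tz T Ti (- (m * j)%N%:Z) x) * w x) in
  corr - ghk_inf mu T Ti n (mdiff T Ti (m * j) f) ^+ (2 ^ n.+1) <= theta * m%:R ->
  corr <= (1 + theta) * m%:R ->
  exists2 lam : R, 0 < lam & let g x := cR lam * mdiff T Ti (m * j) f x in
    [/\ Ex mu (fun x => cmod (g x) `^ pk n.+1) <= 1,
        Ex mu (fun x => `|cmod (g x) `^ pk n.+1 - m%:R * \1_H x|) <= 4 * theta &
        1 - 4 * theta <= ghk_inf mu T Ti n g].
Proof.
move=> th01 e01 corr hc hcorr.
have /andP[th0 th1] := th01; have /andP[e0 e1] := e01.
set D := mdiff T Ti (m * j) f in hc *.
set p := pk n.+1; have p0 : 0 < p :> R := pk_gt0 n.+1.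
have [mH m0 _ _] := cH.
have mR : 1 <= m%:R :> R by rewrite ler1n.
have bH : bm (\1_H : X -> R) := bm_indic mH.
have bw : bm w by apply: bm_cpow => //; rewrite ltW// pk_gt0.
have w0 x : 0 <= w x by exact: powR_ge0.
have bD : bmc D := bmc_mdiff HS (m * j) bf.
have bDp : bm (fun x => cmod (D x) `^ p) by apply: bm_cpow => //; exact: ltW.
set B := Ex mu (fun x => cmod (D x) `^ p).
have B0 : 0 <= B by apply: Ex_ge0 => x; exact: powR_ge0.
set c := _ ^+ _ in hc.
have cB : c <= B ^+ n.+2 := ghk_le_norm HS erg n bD.
have corr0 : 0 <= corr by apply: Ex_ge0 => x; exact: (mulr_ge0 (w0 _) (w0 _)).
have Ew0 : 0 <= Ex mu w := Ex_ge0 mu w0.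
have W1 : Ex mu w ^+ n.+1 <= 1 := exprn_ile1 n.+1 Ew0 Ew.
have Bc : B ^+ n.+2 <= corr.
  have h : B ^+ n.+2 <= Ex mu w ^+ n.+1 * corr := mdiff_le_corr HS n (m * j) bf.
  exact: (le_trans h (ler_piMl corr0 W1)).
have low := corr_mult_lower HS cH bw w0 close j; rewrite -/corr in low.
set M : R := m%:R in mR hc hcorr low *.
set a := (1 + theta) * M.
have me : M * eps <= M * (theta / 100) by apply: ler_wpM2l => //; lra.
have Mth : 0 < M * theta by apply: mulr_gt0 => //; lra.
have cl : (1 - 2 * theta) * M <= c by move: hc low; lra.
have c0 : 0 < c.
  by apply: lt_le_trans cl; apply: mulr_gt0; lra.
have Bp : 0 < B.
  rewrite lt_neqAle B0 andbT; apply/eqP => B0'.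
  by move: c0 cB; rewrite -B0' expr0n /=; lra.
have a0 : 0 < a by rewrite /a mulr_gt0//; lra.
have Ba : B ^+ n.+2 <= a by apply: le_trans Bc _.
pose lam := B `^ (- p^-1).
have lam0 : 0 < lam by rewrite powR_gt0.
have lamp : lam `^ p = B^-1 by rewrite -powRrM mulNr mulVf ?gt_eqF// powR_inv1.
exists lam; [exact: lam0|move=> g].
have gp x : cmod (g x) `^ p = B^-1 * cmod (D x) `^ p.
  by rewrite /g cmodM cmod_cR (gtr0_norm lam0) (powRM _ (ltW lam0) (cmod_ge0 _)) lamp.
have Eg : Ex mu (fun x => cmod (g x) `^ p) = 1.
  by under eq_fun do rewrite gp; rewrite (ExZ _ _ bDp) mulVf// gt_eqF.
have bg : bm (fun x => cmod (g x) `^ p).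
  by under eq_fun do rewrite gp; bmct.
split; first by rewrite Eg.
- pose K x := clip H m w x * clip H m w (Tz T Ti (- (m * j)%N%:Z) x).
  have bcl := bm_clip cH bw.
  have bclT := bm_Tz HS (- (m * j)%N%:Z) bcl.
  have bK : bm K by rewrite /K; bmct.
  have clm x := clip_lem cH w x.
  have cl0 x := clip_ge0 cH w0 x.
  have K0 x : 0 <= K x by rewrite mulr_ge0.
  have Ma : M <= a by rewrite /a mulrDl mul1r lerDl mulrC ltW.
  have M0 : 0 <= M by exact: ltW (lt_le_trans ltr01 mR).
  have Ka x : 0 <= K x <= a ^+ 2.
    rewrite K0 expr2; apply: ler_pM; [exact: cl0|exact: cl0|exact: le_trans (clm _) Ma|].
    exact: le_trans (clm _) Ma.
  have Kg x : a^-1 * K x <= cmod (g x) `^ p.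
    rewrite gp (ler_pdivrMl _ _ a0) mulrCA (ler_pdivlMl _ _ Bp).
    apply: (le_trans (@rescale_lower R n.+2 a B (K x) isT a0 B0 Ba (Ka x))).
    rewrite (ler_pM2l a0).
    have -> : cmod (D x) `^ p = (w x * w (Tz T Ti (- (m * j)%N%:Z) x)) `^ ((1 + n.+2%:R^-1) / 2).
      rewrite /w -powRM; [|exact: cmod_ge0..].
      rewrite -cmod_mdiff -powRrM -pk_ratio mulrC divfK//.
      by rewrite gt_eqF// pk_gt0.
    have n2 : 0 <= n.+2%:R^-1 :> R by rewrite invr_ge0.
    have r0 : 0 <= (1 + n.+2%:R^-1) / 2 :> R by rewrite divr_ge0// addr_ge0.
    apply: (ge0_ler_powR r0); rewrite ?nnegrE.
    - exact: K0.
    - exact: (mulr_ge0 (w0 _) (w0 _)).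
    - by apply: ler_pM; [exact: cl0|exact: cl0|exact: clip_le|exact: clip_le].
  have KH x : a^-1 * K x <= M * \1_H x.
    rewrite (ler_pdivrMl _ _ a0) mulrC; apply: ler_pM; [exact: cl0|exact: cl0|exact: clip_leH|].
    exact: (le_trans (clm _) Ma).
  have EK : M * (1 - 2 * eps) <= Ex mu K.
    apply: (le_trans (corr_clip HS cH bw w0 close j)).
    rewrite le_eqVlt; apply/orP; left; apply/eqP; congr Ex; apply/funext => x.
    exact: mulrC.
  apply: (@le_trans _ _ (Ex mu (fun x => cmod (g x) `^ p + M * \1_H x - 2 * (a^-1 * K x)))).
    apply: le_Ex; [by bmct|by bmct|move=> x].
    exact: norm_subl_le.
  have -> : Ex mu (fun x => cmod (g x) `^ p + M * \1_H x - 2 * (a^-1 * K x)) =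
      1 + 1 - 2 * (a^-1 * Ex mu K).
    rewrite ExB; [|by bmct|by bmct].
    rewrite ExD; [|by bmct|by bmct].
    rewrite Eg (ExZ _ _ bH) (Ex_coset HS cH); congr (_ - _).
    by rewrite ExZ; [|by bmct]; rewrite (ExZ _ _ bK).
  exact: (@ratio_lower1 R M theta eps (Ex mu K) mR th01 e01 EK).
- apply: (@root_ge _ _ _ (2 ^ n.+1)).
  + by rewrite expn_gt0.
  + exact: ghk_ge0.
  + by rewrite lerBlDr lerDl mulr_ge0// ltW.
  rewrite (ghkZ HS _ bD lam0) exprMn -/c.
  (* Here 2^(n+1) = (n+2) p and lam^p = 1/B. *)
  have -> : lam ^+ (2 ^ n.+1) = (B ^+ n.+2)^-1.
    rewrite -exprVn -lamp -(powR_mulrn (2 ^ n.+1) (ltW lam0)).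
    rewrite -(powR_mulrn n.+2 (powR_ge0 lam p)) -powRrM.
    by congr (_ `^ _); rewrite /p /pk divfK// pnatr_eq0.
  by apply: (@ratio_lower2 R M theta) => //; rewrite exprn_gt0.
Qed.

End GoodShift.

(** * Approximate derivatives along all integers *)

Section CocycleApproximation.
Context {d : measure_display} {X : measurableType d} {R : realType}.
Variables (nu : probability X R) (S Si : X -> X).
Hypothesis HS : mps nu S Si.

Lemma cocycle_of_phase (f D q : X -> R[i]) (j : nat) (eps xi : R) :
  bmc f -> bmc D -> uni q ->
  (forall x, ph (D x) = ph (f (Tz S Si (- j%:Z) x)) * conjc (ph (f x))) ->
  Ex nu (fun x => cmod (uph (f x) - ph (f x))) <= eps ->
  Ex nu (fun x => cmod (ph (D x) - q x)) <= xi ->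
  Ex nu (fun x => cmod (uph (f (Tz S Si (- j%:Z) x)) * conjc (uph (f x)) - q x)) <=
    eps + eps + xi.
Proof.
move=> bf bD [bq uq] hD he hx.
have bphD : bmc (fun x => ph (D x)) := bmc_ph (bmc_cmeas bD).
have [bu uu] := uni_uph (bmc_cmeas bf).
have bp : bmc (fun x => ph (f x)) := bmc_ph (bmc_cmeas bf).
have be : bm (fun x => cmod (uph (f x) - ph (f x))) by bmct.
have beT := bm_Tz HS (- j%:Z) be.
have buT := bmc_Tz HS (- j%:Z) bu.
apply: (@le_trans _ _ (Ex nu (fun x => cmod (uph (f (Tz S Si (- j%:Z) x)) - ph (f (Tz S Si (- j%:Z) x)))
   + cmod (uph (f x) - ph (f x)) + cmod (ph (D x) - q x)))).
  apply: le_Ex; [by bmct|by bmct|move=> x].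
  apply: (le_trans (cmod_triB _ (ph (D x)) _)); apply: lerD => //.
  rewrite hD; apply: (le_trans (cmodMB _ _ _ _)).
  - by rewrite cmodJ uu.
  - exact: cmod_ph_le1.
  - by rewrite -conjcB cmodJ.
rewrite ExD; [|by bmct|by bmct]; rewrite ExD; [|by bmct|by bmct].
rewrite (Ex_Tz HS (- j%:Z) be); apply: lerD => //; exact: lerD.
Qed.

(** With x = T^(-j') y, the derivative of u along j - j' at x is the quotient at y of its
    derivatives along j and j', since u(y) cancels. *)
Lemma cocycle_difference (u q q' : X -> R[i]) (n j j' : nat) (xi : R) :
  uni u -> uni q -> uni q' -> PP nu Si n q -> PP nu Si n q' ->
  Ex nu (fun x => cmod (u (Tz S Si (- j%:Z) x) * conjc (u x) - q x)) <= xi ->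
  Ex nu (fun x => cmod (u (Tz S Si (- j'%:Z) x) * conjc (u x) - q' x)) <= xi ->
  exists q'', [/\ uni q'', PP nu Si n q'' &
    Ex nu (fun x => cmod (u (Tz S Si (- (j%:Z - j'%:Z)) x) * conjc (u x) - q'' x)) <= xi + xi].
Proof.
move=> uu uq uq' Pq Pq' h h'; have [_ _ SK SiK _] := HS.
pose q1 x := q x * conjc (q' x).
have uq1 : uni q1 by apply: uniM => //; exact: uniJ.
exists (fun x => q1 (Tz S Si j'%:Z x)); split.
- by apply: uni_comp uq1; exact: measurable_Tz HS _.
- by apply: (PP_Tz HS); apply: PPM Pq _; exact: PPJ.
have [bu u1] := uu; have [bq q1u] := uq; have [bq' q1u'] := uq'.
have buj := bmc_Tz HS (- j%:Z) bu; have buj' := bmc_Tz HS (- j'%:Z) bu.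
pose A x := cmod (u (Tz S Si (- j%:Z) x) * conjc (u x) - q x).
pose A' x := cmod (u (Tz S Si (- j'%:Z) x) * conjc (u x) - q' x).
have bA : bm A by rewrite /A; bmct.
have bA' : bm A' by rewrite /A'; bmct.
have bAA : bm (fun x => A x + A' x) by bmct.
have bAT := bm_Tz HS j'%:Z bAA.
have buT := bmc_Tz HS (- (j%:Z - j'%:Z)) bu.
have bq1 := bmc_Tz HS j'%:Z uq1.1.
apply: (@le_trans _ _ (Ex nu (fun x => A (Tz S Si j'%:Z x) + A' (Tz S Si j'%:Z x)))).
  apply: le_Ex; [by bmct|exact: bAT|move=> x].
  set y := Tz S Si j'%:Z x.
  have xy : x = Tz S Si (- j'%:Z) y by rewrite (TzK SK SiK).
  have -> : Tz S Si (- (j%:Z - j'%:Z)) x = Tz S Si (- j%:Z) y.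
    by rewrite -(TzD SK SiK); congr (Tz S Si _ x); lia.
  have -> : u (Tz S Si (- j%:Z) y) * conjc (u x) =
     u (Tz S Si (- j%:Z) y) * conjc (u y) * conjc (u (Tz S Si (- j'%:Z) y) * conjc (u y)).
    rewrite -xy conjcM conjcK (mulrC (conjc (u x))) mulrA -(mulrA _ _ (u y)).
    by rewrite (mulJc1 (u1 y)) mulr1.
  apply: (le_trans (cmodMB _ _ _ _)).
  - by rewrite cmodJ cmodM cmodJ !u1 mulr1.
  - by rewrite q1u.
  - by rewrite -conjcB cmodJ.
rewrite (Ex_Tz HS j'%:Z bAA) ExD//; exact: lerD.
Qed.

End CocycleApproximation.

Section SeminormSum.
Context {d : measure_display} {X : measurableType d} {R : realType}.
Variables (mu : probability X R) (T Ti : X -> X).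

(** Bernoulli's inequality turns a seminorm of at least 1 - eps into a limit of averages of at least
    1 - e1; the second [e1] leaves room to read it off at finite N. *)
Lemma seminorm_sum_lower n (f : X -> R[i]) (eps e1 : R) : 0 <= eps -> eps <= 1 / 2 ->
  (2 ^ n.+2)%:R * eps <= e1 -> 0 < e1 -> 1 - eps <= ghk_inf mu T Ti n.+1 f ->
  exists N1, forall N, (N1 <= N)%N -> (1 - 2 * e1) * N%:R <=
    \sum_(1 <= h < N.+1) ghk_inf mu T Ti n (mdiff T Ti h f) ^+ (2 ^ n.+1).
Proof.
move=> eps0 eps1 he e10 normG.
have G0 : 0 < ghk_inf mu T Ti n.+1 f by lra.
have cv := ghk_cvg G0.
set G := ghk_inf mu T Ti n.+1 f in normG G0 cv.
have hG : 1 - e1 <= G ^+ (2 ^ n.+2).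
  apply: (@le_trans _ _ ((1 - eps) ^+ (2 ^ n.+2))).
    apply: le_trans (bernoulli _ _); first by rewrite lerD2l lerN2.
    by rewrite eps0 /=; lra.
  by apply: lerXn2r => //; rewrite nnegrE; [lra|exact: ltW].
have [N1 _ hN1] : \forall N \near \oo, 1 - 2 * e1 < avg mu T Ti n f N.
  by apply: cvgr_gt cv _ _; lra.
exists N1.+1 => N NN1; have Np : 0 < N%:R :> R by rewrite ltr0n; exact: leq_trans NN1.
by have := hN1 N (ltnW NN1); rewrite /= /avg (ltr_pdivlMl _ _ Np) mulrC => /ltW.
Qed.

End SeminormSum.

(** * Induction on the degree *)

Section PhaseInverseStep.
Context {R : realType}.

(** [uph] and [ph] differ only at the zeros of f, where the integrand on the left of the hypothesis
    is all of m 1_H. *)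
Lemma uph_close (d : measure_display) (X : measurableType d) (mu : probability X R)
    (T Ti : X -> X) (H : set X) (m : nat) (nu : probability X R) (f : X -> R[i]) (p eps : R) :
  mps mu T Ti -> coset mu Ti H m -> cond_on mu H m nu -> bmc f -> 0 < p ->
  Ex mu (fun x => `|cmod (f x) `^ p - m%:R * \1_H x|) <= eps ->
  Ex nu (fun x => cmod (uph (f x) - ph (f x))) <= eps.
Proof.
move=> HS cH Hnu bf p0; have [mH m0 _ _] := cH.
have bH : bm (\1_H : X -> R) := bm_indic mH.
have [bu uu] := uni_uph (bmc_cmeas bf).
have bp : bmc (fun x => ph (f x)) := bmc_ph (bmc_cmeas bf).
have bw : bm (fun x => cmod (f x) `^ p) by apply: bm_cpow => //; exact: ltW.
apply: le_trans; rewrite (Ex_cond HS cH Hnu); last by bmct.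
rewrite -ExZ; last by bmct.
apply: le_Ex; [by bmct|by bmct|move=> x].
have [fx0|fx0] := eqVneq (f x) 0.
  rewrite fx0 cmod0 powR0 ?gt_eqF// ph0 subr0 cmod_uph sub0r normrN mulr1.
  exact: ler_norm.
by rewrite uph_ph// subrr cmod0 !mulr0.
Qed.

Lemma phase_inverse_step n : phase_inverse (R := R) n -> phase_inverse (R := R) n.+1.
Proof.
move=> IH delta delta0.
have d2 : 0 < delta / 2 by rewrite divr_gt0.
have [xi xi0 rigid] := cocycle_rigidity n d2.
have x4 : 0 < xi / 4 by rewrite divr_gt0.
have [epsn epsn0 IHn] := IH _ x4.
(* [good_shift] returns errors 4 theta, which have to fit the [epsn] of the induction hypothesis. *)
have [theta th0 [th1 th2]] : exists2 theta : R, 0 < theta & theta <= 1 / 10 /\ 4 * theta <= epsn.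
  exists (Num.min (epsn / 4) (1 / 10)); first by rewrite lt_min !divr_gt0.
  by split; case: (leP (epsn / 4) (1 / 10)) => ?; lra.
pose K : R := (2 ^ n.+2)%:R.
have K1 : 1 <= K by rewrite ler1n expn_gt0.
(* In this order: the weights in [good_returns] and [good_shift], the loss K eps when the seminorm
   is raised to the power K, the zeros of f entering each derivative twice, and the zeros of f in
   the final triangle inequality. *)
have [eps e0 [e1 e2 e3 e4]] : exists2 eps : R, 0 < eps &
    [/\ eps <= theta / 100, K * eps <= theta / 100, eps <= xi / 8 & eps <= delta / 2].
  exists (Num.min (theta / 100 / K) (Num.min (xi / 8) (delta / 2))).
    by rewrite !lt_min !divr_gt0//; apply: lt_le_trans K1.
  split; [| |by rewrite !ge_min lexx orbT|by rewrite !ge_min lexx !orbT].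
    rewrite ge_min; apply/orP; left; rewrite ler_pdivrMr; last exact: lt_le_trans K1.
    by rewrite ler_peMr// divr_ge0// ltW.
  have K0 : 0 < K by exact: lt_le_trans K1.
  apply: (@le_trans _ _ (K * (theta / 100 / K))).
    by rewrite (ler_pM2l K0) ge_min lexx.
  by rewrite mulrC divfK// gt_eqF.
have e3' : eps + eps + xi / 4 <= xi / 2 by lra.
have e4' : eps + delta / 2 <= delta by lra.
have xx : xi / 2 + xi / 2 = xi by field.
exists eps => // d X mu T Ti HS erg H m cH nu Hnu f bf Ef close norm.
have [mH m0 _ _] := cH.
pose w x := cmod (f x) `^ pk n.+2.
have w0 x : 0 <= w x by exact: powR_ge0.
have bw : bm w by apply: bm_cpow => //; rewrite ltW// pk_gt0.
have th01 : 0 < theta <= 1 by rewrite th0/=; lra.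
have th10 : 0 < theta <= 1 / 10 by rewrite th0.
have e01 : 0 <= eps <= theta / 100 by rewrite ltW.
pose c h := ghk_inf mu T Ti n (mdiff T Ti h f) ^+ (2 ^ n.+1).
pose corr h := Ex mu (fun x => w (Tz T Ti (- h%:Z) x) * w x).
have Ew0 : 0 <= Ex mu w := Ex_ge0 mu w0.
have W1 : Ex mu w ^+ n.+1 <= 1 := exprn_ile1 n.+1 Ew0 Ef.
have corr0 h : 0 <= corr h by apply: Ex_ge0 => x; exact: (mulr_ge0 (w0 _) (w0 _)).
have hc h : 0 <= c h <= corr h.
  rewrite exprn_ge0; last exact: ghk_ge0.
  have h1 := ghk_le_norm HS erg n (bmc_mdiff HS h bf).
  apply: (le_trans h1); apply: (le_trans (mdiff_le_corr HS n h bf)).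
  exact: (ler_piMl (corr0 h) W1).
have cN : exists N1, forall N, (N1 <= N)%N ->
    (1 - 2 * (theta / 100)) * N%:R <= \sum_(1 <= h < N.+1) c h.
  by apply: (seminorm_sum_lower _ _ e2 _ norm); [exact: ltW|lra|rewrite divr_gt0].
have [J0 hJ] := good_returns HS erg cH bw w0 Ef close th01 e01 hc cN.
have diffs := dense_differences hJ.
have p0 : 0 < pk n.+2 :> R := pk_gt0 n.+2.
have hu := uph_close HS cH Hnu bf p0 close.
have HSm := cond_mps HS cH Hnu.
have ergm := cond_ergodic HS cH Hnu erg.
pose S := iter m T; pose Si := iter m Ti.
(* At an index satisfying both bounds, the rescaled derivative meets the induction hypothesis, and
   the positive factor [lam] does not change its phase. *)
have bad j : (corr (m * j)%N - c (m * j)%N <= theta * m%:R)%R &&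
         (corr (m * j)%N <= (1 + theta) * m%:R)%R ->
    exists q, [/\ uni q, PP nu Si n.+1 q & Ex nu (fun x =>
       cmod (uph (f (Tz S Si (- j%:Z) x)) * conjc (uph (f x)) - q x)) <= xi / 2].
  move=> /andP[h1 h2].
  have [lam lam0 [g1 g2 g3]] := good_shift HS erg cH bf Ef close th10 e01 h1 h2.
  pose D := mdiff T Ti (m * j) f; have bD : bmc D := bmc_mdiff HS (m * j) bf.
  have bg : bmc (fun x => cR lam * D x) by bmct.
  have g2' := le_trans g2 th2.
  have g3' : 1 - epsn <= ghk_inf mu T Ti n (fun x => cR lam * D x).
    by apply: le_trans g3; rewrite lerD2l lerN2.
  have [q [uq Pq hq]] := IHn d X mu T Ti HS erg H m cH nu Hnu (fun x => cR lam * D x) bg g1 g2' g3'.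
  exists q; split => //.
  have hD x : ph (cR lam * D x) = ph (f (Tz S Si (- j%:Z) x)) * conjc (ph (f x)).
    rewrite ph_cR// /D /mdiff /shiftf phM phJ; congr (ph (f _) * _).
    by rewrite (Tz_iter T Ti) mulrN PoszM.
  apply: (le_trans (cocycle_of_phase HSm bf bg uq hD hu hq)).
  exact: e3'.
have [q [uq Pq hq]] : exists q, [/\ uni q, PP nu Si n.+2 q &
    Ex nu (fun x => cmod (uph (f x) - q x)) <= delta / 2].
  apply: (rigid _ _ _ _ _ HSm ergm (fun x => uph (f x)) (uni_uph (bmc_cmeas bf))) => g.
  have [j [j' [gj gj' ->]]] := diffs g.
  have [q [uq Pq hq]] := bad j gj; have [q' [uq' Pq' hq']] := bad j' gj'.
  have := cocycle_difference HSm (uni_uph (bmc_cmeas bf)) uq uq' Pq Pq' hq hq'.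
  by rewrite xx.
exists q; split => //.
have [bu _] := uni_uph (bmc_cmeas bf); have [bq _] := uq.
have bp : bmc (fun x => ph (f x)) := bmc_ph (bmc_cmeas bf).
apply: (@le_trans _ _ (Ex nu (fun x => cmod (uph (f x) - ph (f x)) + cmod (uph (f x) - q x)))).
  apply: le_Ex; [by bmct|by bmct|move=> x].
  by apply: (le_trans (cmod_triB _ (uph (f x)) _)); rewrite (cmodBC (ph _)).
rewrite ExD; [|by bmct|by bmct].
exact: (le_trans (lerD hu hq)).
Qed.

Theorem phase_inverseP n : phase_inverse (R := R) n.
Proof. by elim: n => [|n IH]; [exact: phase_inverse0|exact: phase_inverse_step]. Qed.

End PhaseInverseStep.

(** * Inequalities for p-th powers *)

Section PowerInequalities.
Context {R : realType}.
Variable p : R.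
Hypothesis p1 : 1 <= p.

Let p0 : 0 < p. Proof. by apply: lt_le_trans p1. Qed.

Lemma powR_le_id (u : R) : 0 <= u <= 1 -> u `^ p <= u.
Proof.
move=> /andP[u0 u1]; have [->|un0] := eqVneq u 0; first by rewrite powR0// gt_eqF.
rewrite -[leRHS](powRr1 u0); apply: ger_powR => //.
by rewrite lt_neqAle eq_sym un0 u0.
Qed.

Lemma le_powR (a b : R) : 0 <= a <= b -> a `^ p <= b `^ p.
Proof.
move=> /andP[a0 ab]; apply: (ge0_ler_powR (ltW p0)); rewrite ?nnegrE//.
exact: le_trans ab.
Qed.

Lemma powR_superadd (a b : R) : 0 <= a -> 0 <= b -> a `^ p + b `^ p <= (a + b) `^ p.
Proof.
move=> a0 b0; have [s0|s0] := leP (a + b) 0.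
  have -> : a = 0 by lra.
  have -> : b = 0 by lra.
  by rewrite addr0 powR0 ?gt_eqF// addr0.
have H (x : R) : 0 <= x -> x <= a + b -> x `^ p <= (a + b) `^ p * (x / (a + b)).
  move=> x0 xs; have -> : x `^ p = (a + b) `^ p * (x / (a + b)) `^ p.
    rewrite -powRM ?(ltW s0) ?divr_ge0 ?(ltW s0)//; congr (_ `^ _).
    by rewrite mulrC divfK// gt_eqF.
  apply: ler_wpM2l; first exact: powR_ge0.
  by apply: powR_le_id; rewrite divr_ge0 ?(ltW s0)//= ler_pdivrMr// mul1r.
have h1 : a <= a + b by rewrite lerDl.
have h2 : b <= a + b by rewrite lerDr.
apply: (le_trans (lerD (H a a0 h1) (H b b0 h2))).
by rewrite -mulrDr -mulrDl divff ?mulr1// gt_eqF.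
Qed.

Lemma powR_dist (x y : R) : 0 <= x -> 0 <= y -> `|x - y| `^ p <= `|x `^ p - y `^ p|.
Proof.
wlog xy : x y / y <= x => [H|] x0 y0.
  have [xy|xy] := leP y x; first exact: H.
  by rewrite distrC (distrC (x `^ p)); apply: H => //; exact: ltW.
rewrite ger0_norm ?subr_ge0//.
have h := @powR_superadd (x - y) y; rewrite subrK subr_ge0 in h.
have {}h := h xy y0.
by apply: le_trans (ler_norm _); rewrite lerBrDr.
Qed.

Lemma powRD_le (a b : R) : 0 <= a -> 0 <= b ->
  (a + b) `^ p <= 2 `^ p * (a `^ p + b `^ p).
Proof.
wlog ab : a b / b <= a => [H|] a0 b0.
  have [ba|ab] := leP b a; first exact: H.
  by rewrite addrC (addrC (a `^ p)); apply: H => //; exact: ltW.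
apply: (@le_trans _ _ ((2 * a) `^ p)).
  by apply: le_powR; rewrite addr_ge0//=; lra.
rewrite powRM//; apply: ler_wpM2l; first exact: powR_ge0.
by rewrite lerDl powR_ge0.
Qed.

Lemma powR_le2 (u : R) : 0 <= u <= 2 -> u `^ p <= 2 `^ p * u.
Proof.
move=> /andP[u0 u2]; have -> : u `^ p = 2 `^ p * (u / 2) `^ p.
  by rewrite -powRM ?divr_ge0//; congr (_ `^ _); lra.
apply: ler_wpM2l; first exact: powR_ge0.
by apply: (@le_trans _ _ (u / 2)); [apply: powR_le_id; apply/andP; split|]; lra.
Qed.

(* [f - M q = (|f| - M) ph f + M (ph f - q)] with [M = a `^ p^-1]. *)
Lemma coset_dist_pointwise (z q : R[i]) (a i : R) : 0 <= a -> i = 0 \/ i = 1 -> cmod q = 1 ->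
  cmod (z - cR (a `^ p^-1) * cR i * q) `^ p <=
  2 `^ p * (`|cmod z `^ p - a * i| + 2 `^ p * (a * (i * cmod (ph z - q)))).
Proof.
move=> a0 hi q1; set M := a `^ p^-1.
have M0 : 0 <= M by exact: powR_ge0.
have i0 : 0 <= i by case: hi => ->.
have Mp : M `^ p = a by rewrite -powRrM mulVf ?powRr1// gt_eqF.
have ip : i `^ p = i by case: hi => ->; [rewrite powR0// gt_eqF|rewrite powR1].
have c0 := cmod_ge0 (ph z - q).
have c2 : cmod (ph z - q) <= 2.
  by apply: le_trans (cmodD _ _) _; rewrite cmodN q1; have := cmod_ph_le1 z; lra.
have E : z - cR M * cR i * q = cR (cmod z - M * i) * ph z + cR (M * i) * (ph z - q).
  by rewrite -{1}(phK z) cRB -!cRM; ring.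
apply: (@le_trans _ _ ((`|cmod z - M * i| + M * i * cmod (ph z - q)) `^ p)).
  apply: le_powR; apply/andP; split; first exact: cmod_ge0.
  rewrite E; apply: (le_trans (cmodD _ _)); rewrite (cmodM _ (ph z)) (cmodM _ (ph z - q)) !cmod_cR.
  apply: lerD; first by apply: (ler_piMr (normr_ge0 _)); exact: cmod_ph_le1.
  by rewrite ger0_norm// mulr_ge0.
apply: (le_trans (powRD_le _ _)) => //; first by rewrite !mulr_ge0.
apply: ler_wpM2l; first exact: powR_ge0.
apply: lerD.
  apply: (le_trans (powR_dist (cmod_ge0 z) (mulr_ge0 M0 i0))).
  by rewrite powRM// Mp ip.
rewrite powRM ?mulr_ge0// powRM// Mp ip -(mulrA a i) (mulrCA (2 `^ p)); apply: ler_wpM2l => //.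
by rewrite mulrCA; apply: ler_wpM2l => //; apply: powR_le2; rewrite c0.
Qed.

End PowerInequalities.

Section NearInverse.
Context {R : realType}.

Lemma pk_ge1 n : 1 <= pk n.+1 :> R.
Proof.
rewrite /pk ler_pdivlMr// mul1r ler_nat.
by apply: (@leq_trans n.+2) => //; exact: ltn_expl.
Qed.

(** [young_near_extremal] supplies the coset and the modulus of f, then [phase_inverseP] the phase
    on that coset; [coset_dist_pointwise] adds the two errors. *)
Lemma near_inverse n (delta : R) : 0 < delta -> exists2 eps : R, 0 < eps &
  forall (d : measure_display) (X : measurableType d) (mu : probability X R)
    (T Ti : X -> X), mps mu T Ti -> ergodic mu Ti ->
  forall f : X -> R[i], bmc f -> Ex mu (fun x => cmod (f x) `^ pk n.+2) <= 1 ->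
  1 - eps <= ghk_inf mu T Ti n.+1 f ->
  exists (H : set X) (m : nat) (nu : probability X R) (q : X -> R[i]),
    [/\ coset mu Ti H m, cond_on mu H m nu, uni q, PP nu (iter m Ti) n.+2 q &
    Ex mu (fun x => cmod (f x - cR (m%:R `^ (pk n.+2)^-1) * cR (\1_H x) * q x) `^ pk n.+2)
      <= delta].
Proof.
move=> delta0; pose C : R := 2 `^ pk n.+2.
have C0 : 0 < C by rewrite powR_gt0.
have d1 : 0 < delta / 2 / C by rewrite !divr_gt0.
have d2 : 0 < delta / 2 / C / C by rewrite !divr_gt0.
have [eps2 eps20 inv] := @phase_inverseP R n.+1 _ d2.
have [e1 e10 [e11 e12]] : exists2 e : R, 0 < e & e <= eps2 /\ e <= delta / 2 / C.
  by exists (Num.min eps2 (delta / 2 / C)); rewrite ?lt_min ?eps20// !ge_min !lexx orbT.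
have [eps1 eps10 young] := young_near_extremal e10.
pose K : R := (2 ^ n.+2)%:R.
have K0 : 0 < K by rewrite ltr0n expn_gt0.
have [eps e0 [h1 h2 h3]] : exists2 eps : R, 0 < eps &
    [/\ eps <= 1 / 2, K * eps <= eps1 / 2 & eps <= eps2].
  exists (Num.min (1 / 2) (Num.min (eps1 / 2 / K) eps2)).
    by rewrite !lt_min eps20 !divr_gt0.
  split; [by rewrite ge_min lexx| |by rewrite !ge_min lexx !orbT].
  apply: (@le_trans _ _ (K * (eps1 / 2 / K))).
    by rewrite (ler_pM2l K0) !ge_min lexx orbT.
  by rewrite mulrC divfK// gt_eqF.
have E1 : 1 - 2 * (eps1 / 2) = 1 - eps1 by field.
have E2 : C * (delta / 2 / C + C * (delta / 2 / C / C)) = delta.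
  by field; rewrite gt_eqF.
have eps12 : 0 < eps1 / 2 by rewrite divr_gt0.
exists eps => // d X mu T Ti HS erg f bf Ef normf.
have bt := bm_tpow n bf.
have t0 x : 0 <= tpow n f x by exact: powR_ge0.
have Et : Ex mu (fun x => tpow n f x ^+ 4) <= 1.
  by have -> : (fun x => tpow n f x ^+ 4) = (fun x => cmod (f x) `^ pk n.+2)
    by apply/funext => x; exact: tpow4.
have [N1 hN1] := seminorm_sum_lower (ltW e0) h1 h2 eps12 normf.
have [N0|H [m [cH close]]] := young _ _ mu T Ti HS erg (tpow n f) bt t0 Et.
  exists (maxn N0 N1); first exact: leq_maxl.
  have := hN1 _ (leq_maxr N0 N1); rewrite E1 => /le_trans; apply.
  apply: ler_sum => h _.
  apply: (le_trans (ghk_le_norm HS erg n (bmc_mdiff HS h bf))).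
  apply: (le_trans (mdiff_le_cube HS n h bf)).
  have Ew0 : 0 <= Ex mu (fun x => cmod (f x) `^ pk n.+2) by apply: Ex_ge0 => x; exact: powR_ge0.
  by apply: (ler_piMl _ (exprn_ile1 n Ew0 Ef)); exact: sqr_ge0.
have [nu Hnu] := cond_exists HS cH.
have close1 : Ex mu (fun x => `|cmod (f x) `^ pk n.+2 - m%:R * \1_H x|) <= e1.
  have -> : (fun x => `|cmod (f x) `^ pk n.+2 - m%:R * \1_H x|) =
     (fun x => `|tpow n f x ^+ 4 - m%:R * \1_H x|) by apply/funext => x; rewrite tpow4.
  exact: close.
have nf : 1 - eps2 <= ghk_inf mu T Ti n.+1 f by apply: le_trans normf; rewrite lerD2l lerN2.
have [q [uq Pq hq]] := inv d X mu T Ti HS erg H m cH nu Hnu f bf Ef (le_trans close1 e11) nf.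
exists H, m, nu, q; split => //.
have [mH m0 _ _] := cH; have bH : bm (\1_H : X -> R) := bm_indic mH.
have bp : bmc (fun x => ph (f x)) := bmc_ph (bmc_cmeas bf).
have [bq q1] := uq.
have pn0 : 0 <= pk n.+2 :> R by rewrite ltW// pk_gt0.
have bw : bm (fun x => cmod (f x) `^ pk n.+2) by apply: bm_cpow.
have bL : bm (fun x => cmod (f x - cR (m%:R `^ (pk n.+2)^-1) * cR (\1_H x) * q x) `^ pk n.+2).
  by apply: bm_cpow => //; bmct.
apply: (@le_trans _ _ (Ex mu (fun x => C * (`|cmod (f x) `^ pk n.+2 - m%:R * \1_H x| +
    C * (m%:R * (\1_H x * cmod (ph (f x) - q x))))))).
  apply: le_Ex; [exact: bL|by bmct|move=> x].
  apply: coset_dist_pointwise; [exact: pk_ge1|by []| |exact: q1].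
  by rewrite indicE; case: (_ \in _); [right|left].
rewrite ExZ; [|by bmct]; rewrite ExD; [|by bmct|by bmct]; rewrite ExZ; [|by bmct].
rewrite ExZ; [|by bmct].
rewrite -(Ex_cond HS cH Hnu); last by bmct.
rewrite -E2; apply: (ler_wpM2l (ltW C0)); apply: lerD; first exact: le_trans close1 e12.
by apply: (ler_wpM2l (ltW C0)).
Qed.

End NearInverse.

(** * Polynomials on cosets and their seminorms *)

Section PhaseDifferences.
Context {d : measure_display} {X : measurableType d} {R : realType}.
Variables (nu : probability X R) (S Si : X -> X).
Hypothesis HS : mps nu S Si.

Lemma uni_diff h (q : X -> R[i]) : uni q -> uni (fun x => q (Tz S Si h x) * conjc (q x)).
Proof.
by move=> uq; apply: uniM; [apply: uni_comp uq; exact: measurable_Tz HS h|exact: uniJ].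
Qed.

(** [PP] differentiates along -1. The derivative along -(k+1) is a translate of that one times the
    derivative along -k; positive steps follow by translating and conjugating. *)
Lemma PP_diff n h (q : X -> R[i]) : uni q -> PP nu Si n.+1 q ->
  PP nu Si n (fun x => q (Tz S Si h x) * conjc (q x)).
Proof.
have [_ _ SK SiK _] := HS.
move=> uq Pq; have [_ q1] := uq.
have neg (k : nat) : PP nu Si n (fun x => q (Tz S Si (- k%:Z) x) * conjc (q x)).
  elim: k => [|k IH].
    have -> : (fun x => q (Tz S Si (- 0%:Z) x) * conjc (q x)) = (fun=> 1).
      by apply/funext => x; exact: mulcJ1.
    case: n {Pq} => [|n]; first exact: aeW.
    by apply: (PP_cst HS); exact: cmod1.
  have Pq' : PP nu Si n (fun x => q (Si x) * conjc (q x)) := Pq.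
  have := PPM (PP_Tz HS (- k%:Z) Pq') IH; congr (PP _ _ _ _); apply/funext => x.
  rewrite mulrA -(mulrA (q (Si _))) (mulJc1 (q1 _)) mulr1; congr (q _ * _).
  by rewrite -(TzN1 S) -(TzD SK SiK); congr (Tz S Si _ x); lia.
case: (intP h) => [|k|k]; [exact: (neg 0%N)| |exact: neg].
have := PP_Tz HS k.+1%:Z (PPJ (neg k.+1)); congr (PP _ _ _ _); apply/funext => x.
by rewrite (TzK SK SiK) conjcM conjcK mulrC.
Qed.

End PhaseDifferences.

Section Polynomials.
Context {d : measure_display} {X : measurableType d} {R : realType}.
Variables (mu : probability X R) (T Ti : X -> X).
Hypothesis HS : mps mu T Ti.
Variables (H : set X) (m : nat).
Hypothesis cH : coset mu Ti H m.
Variable nu : probability X R.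
Hypothesis Hnu : cond_on mu H m nu.

(** [idiff] after exponentiation: an integer-valued difference becomes the value 1. *)
Fixpoint cdiff (hs : seq int) (q : X -> R[i]) : X -> R[i] :=
  if hs is h :: hs' then fun x =>
    cdiff hs' q (Tz T Ti (- (m%:Z * h)) x) * conjc (cdiff hs' q x)
  else q.

Lemma expe_idiff hs (P : X -> R) x :
  expe (idiff T Ti m hs P x) = cdiff hs (fun y => expe (P y)) x.
Proof. by elim: hs x => [//|h hs IH] x /=; rewrite expeB !IH. Qed.

Lemma cdiff_rcons hs h (q : X -> R[i]) : cdiff (rcons hs h) q = cdiff hs (cdiff [:: h] q).
Proof. by elim: hs => [//|h' hs IH] /=; rewrite IH. Qed.

Let HSm := cond_mps HS cH Hnu.

Lemma cdiff_phase n hs (q : X -> R[i]) : uni q -> PP nu (iter m Ti) (n + size hs) q ->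
  uni (cdiff hs q) /\ PP nu (iter m Ti) n (cdiff hs q).
Proof.
move=> uq; elim: hs n => [|h hs IH] n; first by rewrite addn0.
rewrite [size _]/= addnS -addSn => /IH[u P] /=.
have E : (fun x => cdiff hs q (Tz T Ti (- (m%:Z * h)) x) * conjc (cdiff hs q x)) =
    (fun x => cdiff hs q (Tz (iter m T) (iter m Ti) (- h) x) * conjc (cdiff hs q x)).
  by apply/funext => x; rewrite Tz_iter mulrN.
by rewrite E; split; [exact: (uni_diff HSm)|exact: (PP_diff HSm)].
Qed.

Lemma phase_is_poly n (q : X -> R[i]) : uni q -> PP nu (iter m Ti) n.+1 q ->
  is_poly mu T Ti H m n (fun x => carg (q x)).
Proof.
move=> uq Pq; have [bq q1] := uq; split.
  have mq := measurable_carg (bmc_cmeas bq) q1.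
  exact: measurable_funS mq.
move=> hs sz; have := @cdiff_phase 0 hs q uq; rewrite sz => /(_ Pq)[_ /=].
move=> /(cond_ae cH Hnu); apply: filterS => x hx Hx.
apply: expe_eq1; rewrite expe_idiff.
have -> : (fun y => expe (carg (q y))) = q by apply/funext => y; rewrite cargK.
by apply: hx; rewrite inE.
Qed.

(** P is extended by 0 outside H, where it need not be measurable, so that the phase is unimodular
    and measurable on X. *)
Definition coset_phase (P : X -> R) : X -> R[i] := fun x => expe ((P \_ H) x).

Lemma uni_coset_phase (P : X -> R) : measurable_fun H P -> uni (coset_phase P).
Proof.
move=> mP; have [mH _ _ _] := cH; split; last by move=> x; exact: cmod_expe.
have mPH : measurable_fun setT (P \_ H).
  by apply/(measurable_restrict _ _ _) => //; rewrite setTI.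
apply: (bmcP (M := 1)); last by move=> x; rewrite cmod_expe.
have m2 : measurable_fun setT (fun x => 2 * pi * (P \_ H) x) by exact: measurable_funM.
split; rewrite /coset_phase /expe /=.
- exact: measurableT_comp (continuous_measurable_fun (@continuous_cos R)) m2.
- exact: measurableT_comp (continuous_measurable_fun (@continuous_sin R)) m2.
Qed.

Lemma poly_phase n (P : X -> R) : is_poly mu T Ti H m n P ->
  PP nu (iter m Ti) n.+1 (coset_phase P).
Proof.
move=> [mP hP].
have inH : {ae nu, forall x, x \in H} by apply: (ae_cond cH Hnu); exact: aeW.
have same hs : {ae nu, forall x, idiff T Ti m hs P x = idiff T Ti m hs (P \_ H) x}.
  elim: hs => [|h hs IH].
    by apply: filterS inH => x xH /=; rewrite patchE xH.
  apply: filterS2 IH (ae_Tz HSm (- h) IH) => x /= e1 e2.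
  by rewrite e1; move: e2; rewrite Tz_iter mulrN => ->.
(* Increments all equal to 1 suffice: each composes with the inverse of T^m, which is the derivative
   in [PP]. *)
have one : {ae nu, forall x, cdiff (nseq n.+1 1) (coset_phase P) x = 1}.
  have h1 : {ae nu, forall x, exists z : int, idiff T Ti m (nseq n.+1 1) P x = z%:~R}.
    apply: (ae_cond cH Hnu); apply: filterS (hP (nseq n.+1 1) (size_nseq _ _)) => x hx xH.
    by apply: hx; exact: set_mem.
  apply: filterS2 (same (nseq n.+1 1)) h1 => x e [z hz].
  by rewrite -[LHS]expe_idiff -e hz expe_int.
have key k (q : X -> R[i]) : {ae nu, forall x, cdiff (nseq k 1) q x = 1} ->
    PP nu (iter m Ti) k q.
  elim: k q => [//|k IH] q h; apply: IH.
  have e : cdiff [:: 1] q = (fun x => q (iter m Ti x) * conjc (q x)).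
    by apply/funext => x /=; rewrite mulr1 Tz_natN.
  rewrite -e -cdiff_rcons.
  suff -> : rcons (nseq k 1) 1 = nseq k.+1 (1 : int) by exact: h.
  by elim: k {h} => //= k ->.
exact: key.
Qed.

Lemma fine_coset : fine (mu H) = m%:R^-1.
Proof.
have [mH m0 _ _] := cH; have := Ex_coset HS cH; rewrite Ex_indic// => h.
have mR : m%:R != 0 :> R by rewrite pnatr_eq0 -lt0n.
by apply: (mulfI mR); rewrite h divff.
Qed.

Lemma coset_poly_funE p (P : X -> R) x : coset_poly_fun mu p H P x =
  cR (m%:R `^ p^-1) * cR (\1_H x) * expe (P x).
Proof.
rewrite /coset_poly_fun fine_coset; congr (cR _ * _ * _).
rewrite -(powR_inv1 (ler0n R m)) -powRrM; congr (_ `^ _).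
by rewrite mulN1r opprK.
Qed.

End Polynomials.

Section Multiples.
Context {R : realType}.

Lemma count_multiples (m N : nat) : (0 < m)%N ->
  (\sum_(1 <= h < N.+1) (m %| h) = N %/ m)%N.
Proof.
move=> m0; elim: N => [|N IH]; first by rewrite big_geq// div0n.
by rewrite big_nat_recr //= IH divnS// addnC.
Qed.

Lemma cvg_density (m : nat) : (0 < m)%N ->
  (fun N : nat => N%:R^-1 * (N %/ m)%:R : R) @ \oo --> (m%:R^-1 : R).
Proof.
move=> m0; have mR : 0 < m%:R :> R by rewrite ltr0n.
apply/cvgrPdist_le => e e0.
near=> N.
have N0 : (0 < N)%N by near: N; exact: nbhs_infty_gt.
have NR : 0 < N%:R :> R by rewrite ltr0n.
have h : N%:R = (N %/ m)%:R * m%:R + (N %% m)%:R :> R by rewrite -natrM -natrD -divn_eq.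
have hm : (N %% m)%:R <= m%:R :> R by rewrite ler_nat ltnW// ltn_mod.
have hm0 : 0 <= (N %% m)%:R :> R by [].
have -> : m%:R^-1 - N%:R^-1 * (N %/ m)%:R = N%:R^-1 * ((N %% m)%:R / m%:R) :> R.
  have -> : (N %% m)%:R = N%:R - (N %/ m)%:R * m%:R :> R by move: h; lra.
  by field; rewrite !gt_eqF.
rewrite ger0_norm; last by rewrite mulr_ge0 ?invr_ge0 ?divr_ge0// ltW.
apply: (@le_trans _ _ N%:R^-1).
  by apply: ler_piMr; rewrite ?invr_ge0 ?(ltW NR)// ler_pdivrMr// mul1r.
rewrite -[leRHS]invrK lef_pV2 ?posrE ?invr_gt0//.
near: N; exact: nbhs_infty_ger.
Unshelve. all: by end_near.
Qed.

End Multiples.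

(** * Exact seminorms of polynomials on cosets *)

Section CosetNorm.
Context {d : measure_display} {X : measurableType d} {R : realType}.
Variables (mu : probability X R) (T Ti : X -> X).
Hypotheses (HS : mps mu T Ti) (erg : ergodic mu Ti).

(** A multiple h of m gives the derivative c^2 1_H times a phase polynomial of lower degree; any
    other h gives 0, as H and its translate are disjoint. The multiples have density 1/m, whence one
    more factor 1/m per order. *)
Lemma ghk_coset n (H : set X) (m : nat) (nu : probability X R) (c : R) (q f : X -> R[i]) :
  coset mu Ti H m -> cond_on mu H m nu -> 0 <= c -> uni q -> PP nu (iter m Ti) n.+1 q ->
  bmc f -> {ae mu, forall x, f x = cR c * cR (\1_H x) * q x} ->
  ghk_inf mu T Ti n f ^+ (2 ^ n.+1) = c ^+ (2 ^ n.+1) * m%:R^-1 ^+ n.+2.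
Proof.
elim: n H m nu c q f => [|n IH] H m nu c q f cH Hnu c0 uq Pq bf hf.
  have [mH m0 _ _] := cH; have bH : bm (\1_H : X -> R) := bm_indic mH.
  have mR : m%:R != 0 :> R by rewrite pnatr_eq0 -lt0n.
  have HSm := cond_mps HS cH Hnu; have ergm := cond_ergodic HS cH Hnu erg.
  have [bq q1] := uq.
  have inv : {ae nu, forall x, q (iter m Ti x) = q x}.
    apply: filterS Pq => x /= hx.
    by rewrite -[LHS]mulr1 -(mulJc1 (q1 x)) mulrA hx mul1r.
  have [z hz] := ergodic_cst ergm bq inv.
  have z1 : cmod z = 1 by apply: (@ae_cst _ _ _ nu); apply: filterS hz => x <-.
  have hz' : {ae mu, forall x, f x = cR (c * \1_H x) * z}.
    apply: filterS2 hf (cond_ae cH Hnu hz) => x -> h; rewrite -cRM.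
    rewrite indicE; case: (boolP (x \in H)) => xH; first by rewrite h.
    by rewrite mulr0 cR0 !mul0r.
  have [bfr bfi] := bf.
  have ExH : Ex mu \1_H = m%:R^-1.
    by apply: (mulfI mR); rewrite (Ex_coset HS cH) divff.
  have Er : Ex mu (fun x => complex.Re (f x)) = c / m%:R * complex.Re z.
    rewrite -ExH -ExZ// mulrC -ExZ; last by bmct.
    apply: eq_ae_Ex; [by []|by bmct|apply: filterS hz' => x ->].
    by rewrite Re_cRM mulrC.
  have Ei : Ex mu (fun x => complex.Im (f x)) = c / m%:R * complex.Im z.
    rewrite -ExH -ExZ// mulrC -ExZ; last by bmct.
    apply: eq_ae_Ex; [by []|by bmct|apply: filterS hz' => x ->].
    by rewrite cImM /= mul0r addr0 mulrC.
  rewrite [ghk_inf _ _ _ _ _]/= cmod_sqr /cint.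
  have -> : complex.Re (Complex (Rintegral mu setT (fun x => complex.Re (f x)))
      (Rintegral mu setT (fun x => complex.Im (f x)))) = c / m%:R * complex.Re z := Er.
  have -> : complex.Im (Complex (Rintegral mu setT (fun x => complex.Re (f x)))
      (Rintegral mu setT (fun x => complex.Im (f x)))) = c / m%:R * complex.Im z := Ei.
  by rewrite !(exprMn _ (c / m%:R)) -mulrDr -cmod_sqr z1 expr1n mulr1 exprMn.
have [mH m0 _ _] := cH; have [bq q1] := uq.
have [_ _ SK SiK _] := HS.
rewrite ghkS_pow; pose A : R := c ^+ (2 ^ n.+2) * m%:R^-1 ^+ n.+2.
have term h : ghk_inf mu T Ti n (mdiff T Ti h f) ^+ (2 ^ n.+1) = (m %| h)%N%:R * A.
  have bD := bmc_mdiff HS h bf.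
  have hfT := ae_Tz HS (- h%:Z) hf.
  have [/dvdnP[j hj]|mh] := boolP (m %| h)%N.
    rewrite mul1r /A (_ : c ^+ (2 ^ n.+2) = (c ^+ 2) ^+ (2 ^ n.+1)); last by rewrite -exprM -expnS.
    apply: (IH H m nu (c ^+ 2) (fun x => q (Tz (iter m T) (iter m Ti) (- j%:Z) x) * conjc (q x))) => //.
    - exact: sqr_ge0.
    - exact: (uni_diff (cond_mps HS cH Hnu)).
    - exact: (PP_diff (cond_mps HS cH Hnu)).
    have inv := coset_inv HS cH (- j%:Z).
    apply: filterS3 hf hfT inv => x e1 e2 e3.
    rewrite /mdiff /shiftf e2 e1 Tz_iter.
    have -> : m%:Z * - j%:Z = - h%:Z by rewrite hj PoszM mulrN mulrC.
    move: e3; have -> : m%:Z * - j%:Z = - h%:Z by rewrite hj PoszM mulrN mulrC.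
    move=> e3; rewrite !indicE e3 !conjcM !conjc_cR expr2 cRM.
    case: (x \in H); rewrite ?cR1 ?cR0; ring.
  rewrite mul0r; have m1 : (0 < m)%N by [].
  (* The vanishing derivative is the case c = 0 of the induction hypothesis, with trivial phase. *)
  have := IH H m nu 0 (fun=> 1) (mdiff T Ti h f) cH Hnu (lexx _) (uni_cst cmod1).
  rewrite expr0n expn_eq0 /= mul0r; apply=> //.
    by apply: (PP_cst (cond_mps HS cH Hnu)); exact: cmod1.
  apply: filterS3 hf hfT (coset_disjoint HS cH mh) => x e1 e2 e3.
  rewrite /mdiff /shiftf e2 e1 !indicE cR0 !mul0r.
  case: (boolP (x \in H)) => xH; last by rewrite !cR0 !mulr0 !mul0r conjc0 mulr0.
  by rewrite e3// cR0 !mulr0 !mul0r.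
have -> : avg mu T Ti n f = (fun N : nat => N%:R^-1 * (N %/ m)%:R * A).
  apply/funext => N; rewrite /avg -mulrA; congr (_ * _).
  rewrite -(count_multiples N m0) natr_sum mulr_suml; apply: eq_bigr => h _.
  exact: term.
have -> : c ^+ (2 ^ n.+2) * m%:R^-1 ^+ n.+3 = m%:R^-1 * A by rewrite /A (exprS _ n.+2); ring.
by apply/cvg_lim => //; apply: cvgMl; exact: cvg_density.
Qed.

Lemma truncE N (f : X -> R[i]) x :
  trunc N f x = cR (\1_[set y | cmod (f y) <= N%:R] x) * f x.
Proof.
rewrite /trunc indicE; have [h|h] := boolP (cmod (f x) <= N%:R).
  by rewrite mem_set// cR1 mul1r.
by rewrite memNset ?cR0 ?mul0r//; apply/negP.
Qed.

Lemma cmod_trunc_le N (f : X -> R[i]) x : cmod (trunc N f x) <= N%:R.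
Proof. by rewrite /trunc; case: ifP => // _; rewrite cmod0. Qed.

Lemma bmc_trunc N (f : X -> R[i]) : cmeasurable f -> bmc (trunc N f).
Proof.
move=> mf; apply: (bmcP (M := N%:R)); last by move=> x; exact: cmod_trunc_le.
have -> : trunc N f = (fun x => cR (\1_[set y | cmod (f y) <= N%:R] x) * f x).
  by apply/funext => x; exact: truncE.
apply: cmeasM => //.
have mA : measurable [set y | cmod (f y) <= N%:R].
  have := @measurable_fun_ler _ _ _ setT _ _ (cmeas_cmod mf) (bm_cst N%:R).1.
  by move=> /(_ measurableT [set true] I); rewrite setTI.
have [m1 _] := @bm_indic _ _ R _ mA.
by split => //=; exact: measurable_cst.
Qed.

Lemma ghk_coset_poly n (H : set X) (m : nat) (P : X -> R) (f : X -> R[i]) :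
  is_coset mu Ti H m -> is_poly mu T Ti H m n.+1 P -> cmeasurable f ->
  {ae mu, forall x, f x = coset_poly_fun mu (pk n.+2) H P x} ->
  ghk mu T Ti n.+2 f = 1.
Proof.
move=> /(is_coset_coset HS) cH hP mf hf.
have [nu Hnu] := cond_exists HS cH.
have uq := uni_coset_phase cH hP.1.
have Pq := poly_phase HS cH Hnu hP.
have [mH m0 _ _] := cH; have mR : 0 < m%:R :> R by rewrite ltr0n.
pose M : R := m%:R `^ (pk n.+2)^-1.
have M0 : 0 <= M by exact: powR_ge0.
have [_ q1] := uq.
have hf' : {ae mu, forall x, f x = cR M * cR (\1_H x) * coset_phase H P x}.
  apply: filterS hf => x ->; rewrite (coset_poly_funE HS cH) /coset_phase patchE indicE.
  by case: (x \in H); rewrite ?cR0 ?mulr0 ?mul0r.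
have hM : M ^+ (2 ^ n.+2) * m%:R^-1 ^+ n.+3 = 1.
  rewrite /M -powR_mulrn ?powR_ge0// -powRrM.
  have -> : (pk n.+2)^-1 * (2 ^ n.+2)%:R = n.+3%:R :> R.
    by rewrite /pk invf_div divfK// pnatr_eq0 expn_eq0.
  by rewrite powR_mulrn ?(ltW mR)// -exprMn divff ?expr1n// gt_eqF.
(* Truncation above the height M changes f only on a null set, so the sequence defining [ghk] is
   eventually 1. *)
have big N : M <= N%:R -> ghk_inf mu T Ti n.+1 (trunc N f) = 1.
  move=> MN; have ht : {ae mu, forall x, trunc N f x = cR M * cR (\1_H x) * coset_phase H P x}.
    apply: filterS hf' => x hx; rewrite /trunc -hx.
    have -> // : cmod (f x) <= N%:R.
    rewrite hx cmodM q1 mulr1 -cRM cmod_cR; apply: le_trans MN.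
    by rewrite normrM ger0_norm// indicE; case: (_ \in _); rewrite ?normr1 ?normr0 ?mulr1 ?mulr0.
  have := ghk_coset cH Hnu M0 uq Pq (bmc_trunc N mf) ht.
  rewrite hM => /eqP; rewrite pexpr_eq1 ?expn_gt0 ?ghk_ge0//.
  by move/eqP.
rewrite /ghk; apply/cvg_lim => //; apply: cvg_near_cst.
have := nbhs_infty_ger M; apply: filterS => N MN; exact: big.
Qed.

End CosetNorm.

(** * Unbounded functions *)

Section PowerIntegral.
Context {d : measure_display} {X : measurableType d} {R : realType}.
Variables (mu : probability X R) (p : R).
Hypothesis p1 : 1 <= p.

Let p0 : 0 < p. Proof. by apply: lt_le_trans p1. Qed.

Definition pint (g : X -> R[i]) : \bar R := (\int[mu]_x (cmod (g x) `^ p)%:E)%E.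

Lemma pint_ge0 g : (0 <= pint g)%E.
Proof. by apply: integral_ge0 => x _; rewrite lee_fin powR_ge0. Qed.

Lemma cLnormE g : cLnorm mu p g = poweR (pint g) p^-1.
Proof.
have -> : pint g = (\int[mu]_x (poweR `|(cmod (g x))%:E| p))%E.
  by apply: eq_integral => x _; rewrite /= ger0_norm// cmod_ge0.
by rewrite /cLnorm Lnorm.unlock.
Qed.

Lemma cLnorm_le g (c : R) : 0 <= c ->
  (cLnorm mu p g <= c%:E)%E <-> (pint g <= (c `^ p)%:E)%E.
Proof.
move=> c0; rewrite cLnormE; split=> h.
  have -> : pint g = poweR (poweR (pint g) p^-1) p.
    by rewrite -poweRrM mulVf ?gt_eqF// poweRe1// pint_ge0.
  rewrite -poweR_EFin; apply: (gt0_ler_poweR (ltW p0)) h; rewrite in_itv /= ?leey ?andbT.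
    exact: poweR_ge0.
  by rewrite lee_fin.
have -> : c%:E = poweR (c `^ p)%:E p^-1.
  by rewrite poweR_EFin -powRrM divff ?gt_eqF// powRr1.
apply: (gt0_ler_poweR _) h; rewrite ?invr_ge0 ?(ltW p0)// in_itv /= ?leey ?andbT.
  exact: pint_ge0.
by rewrite lee_fin powR_ge0.
Qed.

Lemma measurable_cpow (g : X -> R[i]) : cmeasurable g -> measurable_fun setT (fun x => (cmod (g x) `^ p)%:E).
Proof.
move=> mg; apply/measurable_EFinP.
exact: (measurableT_comp (measurable_powR p) (cmeas_cmod mg)).
Qed.

Lemma pint_bmc (g : X -> R[i]) : bmc g -> pint g = (Ex mu (fun x => cmod (g x) `^ p))%:E.
Proof. by move=> bg; rewrite /pint -EFin_Ex//; apply: bm_cpow => //; exact: ltW. Qed.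

Lemma cmeasD (f g : X -> R[i]) : cmeasurable f -> cmeasurable g ->
  cmeasurable (fun x => f x + g x).
Proof.
move=> [rf i_f] [rg ig]; split.
- by under eq_fun do rewrite cReD; exact: measurable_funD.
- by under eq_fun do rewrite cImD; exact: measurable_funD.
Qed.

Lemma cmeasB (f g : X -> R[i]) : cmeasurable f -> cmeasurable g ->
  cmeasurable (fun x => f x - g x).
Proof.
move=> mf [rg ig]; apply: cmeasD => //; split.
- by under eq_fun do rewrite cReN; exact: measurableT_comp.
- by under eq_fun do rewrite cImN; exact: measurableT_comp.
Qed.

Lemma le_pint (f g : X -> R[i]) : cmeasurable f -> cmeasurable g ->
  (forall x, cmod (f x) <= cmod (g x)) -> (pint f <= pint g)%E.
Proof.
move=> mf mg fg; apply: ge0_le_integral => //.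
- by move=> x _; rewrite lee_fin powR_ge0.
- exact: measurable_cpow.
- exact: measurable_cpow.
- by move=> x _; rewrite lee_fin; apply: (le_powR p1); rewrite cmod_ge0 fg.
Qed.

Lemma pintD (f g : X -> R[i]) : cmeasurable f -> cmeasurable g ->
  (pint (fun x => (f x + g x)%R) <= (2 `^ p)%:E * (pint f + pint g))%E.
Proof.
move=> mf mg; have mfp := measurable_cpow mf; have mgp := measurable_cpow mg.
have f0 x : setT x -> (0 <= (cmod (f x) `^ p)%:E)%E by rewrite lee_fin powR_ge0.
have g0 x : setT x -> (0 <= (cmod (g x) `^ p)%:E)%E by rewrite lee_fin powR_ge0.
have fg0 x : setT x -> (0 <= (cmod (f x) `^ p)%:E + (cmod (g x) `^ p)%:E)%E.
  by move=> xT; apply: adde_ge0; [exact: f0|exact: g0].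
have s0 x : setT x -> (0 <= (cmod (f x + g x) `^ p)%:E)%E by rewrite lee_fin powR_ge0.
have c0 : (0 <= (2 `^ p)%:E)%E by rewrite lee_fin powR_ge0.
have mfg := emeasurable_funD mfp mgp.
rewrite /pint -(ge0_integralD mu measurableT f0 mfp g0 mgp).
rewrite -(ge0_integralZl mu measurableT mfg fg0 c0).
have mC := measurable_funeM (2 `^ p)%:E mfg.
apply: (@ge0_le_integral _ X R mu setT measurableT _ _ s0 (measurable_cpow (cmeasD mf mg)) mC).
move=> x _; rewrite -EFinD -EFinM lee_fin.
apply: (@le_trans _ _ ((cmod (f x) + cmod (g x)) `^ p)).
  by apply: (le_powR p1); rewrite cmod_ge0 cmodD.
by apply: (powRD_le p1); exact: cmod_ge0.
Qed.

Lemma pint_trunc (f : X -> R[i]) : cmeasurable f -> (pint f < +oo)%E ->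
  (fun N => pint (fun x => (f x - trunc N f x)%R)) @ \oo --> 0%E.
Proof.
move=> mf ff.
have mt N : cmeasurable (fun x => f x - trunc N f x).
  by apply: cmeasB => //; apply: bmc_cmeas; exact: bmc_trunc.
have lef N x : cmod (f x - trunc N f x) <= cmod (f x).
  by rewrite /trunc; case: ifP; rewrite ?subrr ?subr0 ?cmod0 ?cmod_ge0.
have [|||_ _ h] := @dominated_convergence _ _ _ mu setT measurableT
  (fun N x => (cmod (f x - trunc N f x) `^ p)%:E) (cst 0%E)
  (fun x => (cmod (f x) `^ p)%:E) (fun N => measurable_cpow (mt N)) (measurable_cst _).
- apply: aeW => x _; apply: cvg_near_cst.
  have := nbhs_infty_ger (cmod (f x)); apply: filterS => N hN.
  by rewrite /trunc hN subrr cmod0 powR0// gt_eqF.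
- apply/integrableP; split; first exact: measurable_cpow.
  apply: le_lt_trans ff; rewrite le_eqVlt; apply/orP; left; apply/eqP.
  by apply: eq_integral => x _; rewrite gee0_abs// lee_fin powR_ge0.
- apply: aeW => x N _; rewrite gee0_abs ?lee_fin ?powR_ge0//.
  by apply: (le_powR p1); rewrite cmod_ge0 lef.
by rewrite integral_cst// mul0e in h.
Qed.

End PowerIntegral.

Section LpNearInverse.
Context {R : realType}.

Lemma bmc_coset_phase {d : measure_display} {X : measurableType d} (mu : probability X R)
    (Ti : X -> X) (H : set X) m (M : R) (q : X -> R[i]) :
  coset mu Ti H m -> uni q -> bmc (fun x => cR M * cR (\1_H x) * q x).
Proof.
move=> [mH _ _ _] [bq _]; have bH : bm (\1_H : X -> R) := bm_indic mH.
by bmct.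
Qed.

(** Since 1 - eps > 0, the seminorms of the truncations converge, so far enough along they exceed 1
    - e1 while the truncation is also close to f in L^p; [near_inverse] applies to it. *)
Lemma Lp_near_inverse n (delta : R) : 0 < delta -> exists2 eps : R, 0 < eps &
  forall (d : measure_display) (X : measurableType d) (mu : probability X R)
    (T Ti : X -> X), mps mu T Ti -> ergodic mu Ti ->
  forall f : X -> R[i], cmeasurable f -> (pint mu (pk n.+2) f <= 1)%E ->
  1 - eps <= ghk mu T Ti n.+2 f ->
  exists (H : set X) (m : nat) (nu : probability X R) (q : X -> R[i]),
    [/\ coset mu Ti H m, cond_on mu H m nu, uni q, PP nu (iter m Ti) n.+2 q &
    (pint mu (pk n.+2) (fun x => (f x - cR (m%:R `^ (pk n.+2)^-1) * cR (\1_H x) * q x)%R)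
      <= delta%:E)%E].
Proof.
move=> delta0; pose C : R := 2 `^ pk n.+2.
have C0 : 0 < C by rewrite powR_gt0.
have d1 : 0 < delta / 2 / C by rewrite !divr_gt0.
have [e1 e10 inv] := near_inverse n d1.
have E2 : C * (delta / 2 / C + delta / 2 / C) = delta by field; rewrite gt_eqF.
have [eps e0 [ee1 ee2]] : exists2 e : R, 0 < e & 2 * e <= e1 /\ e <= 1 / 2.
  exists (Num.min (e1 / 2) (1 / 2)); first by rewrite lt_min !divr_gt0.
  by split; case: (leP (e1 / 2) (1 / 2)) => ?; lra.
have ee : 1 - e1 < 1 - eps by lra.
have ep : 0 < 1 - eps by lra.
exists eps => // d X mu T Ti HS erg f mf f1 hf.
have p1 : 1 <= pk n.+2 :> R := pk_ge1 n.+1.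
pose u N := ghk_inf mu T Ti n.+1 (trunc N f).
have hu : 1 - eps <= limn u := hf.
have cu : cvgn u.
  by apply: contrapT => h; move: hu; rewrite (limn_junk h) leNgt ep.
have [N1 _ hN1] : \forall N \near \oo, 1 - e1 < u N.
  by apply: (cvgr_gt (limn u)) => //; apply: lt_le_trans hu.
have ff : (pint mu (pk n.+2) f < +oo)%E by apply: le_lt_trans f1 (ltry _).
have := pint_trunc p1 mf ff => /fine_cvgP[[N2 _ fin]].
move=> /cvgrPdist_le /(_ _ d1)[N3 _ small].
pose N := maxn N1 (maxn N2 N3).
have hN := hN1 N (leq_maxl _ _).
have h2 : (N2 <= N)%N by rewrite /N !leq_max leqnn orbT.
have h3 : (N3 <= N)%N by rewrite /N !leq_max leqnn !orbT.
have bt := bmc_trunc N mf.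
have lt_f x : cmod (trunc N f x) <= cmod (f x).
  by rewrite /trunc; case: ifP => // _; rewrite cmod0 cmod_ge0.
have Et : Ex mu (fun x => cmod (trunc N f x) `^ pk n.+2) <= 1.
  rewrite -lee_fin -(pint_bmc mu p1 bt); apply: le_trans f1.
  exact: (le_pint mu p1 (bmc_cmeas bt) mf lt_f).
have [H [m [nu [q [cH Hnu uq Pq hq]]]]] := inv d X mu T Ti HS erg _ bt Et (ltW hN).
exists H, m, nu, q; split => //.
set M := m%:R `^ _ in hq *.
have bg := bmc_coset_phase M cH uq.
have -> : (fun x => f x - cR M * cR (\1_H x) * q x) =
   (fun x => (f x - trunc N f x) + (trunc N f x - cR M * cR (\1_H x) * q x)).
  by apply/funext => x; ring.
have b2 : bmc (fun x => trunc N f x - cR M * cR (\1_H x) * q x) by bmct.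
have m1 : cmeasurable (fun x => f x - trunc N f x) by apply: cmeasB => //; exact: bmc_cmeas.
apply: (le_trans (pintD mu p1 m1 (bmc_cmeas b2))).
rewrite -[X in (_ <= X%:E)%E]E2 EFinM; apply: lee_wpmul2l; first by rewrite lee_fin ltW.
rewrite EFinD; apply: leeD.
  have := small N h3; rewrite /= sub0r normrN => hs.
  rewrite -(fineK (fin N h2)) lee_fin; apply: le_trans hs.
  exact: ler_norm.
by rewrite (pint_bmc mu p1 b2) lee_fin.
Qed.

End LpNearInverse.

(** * Limits of near-extremisers *)

Section PointwiseLimit.
Context {R : realType}.
Variable p : R.
Hypothesis p1 : 1 <= p.

Let p0 : 0 < p. Proof. by apply: lt_le_trans p1. Qed.
Let M (m : nat) : R := m%:R `^ p^-1.
Let M0 m : 0 <= M m. Proof. exact: powR_ge0. Qed.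
Let Mp m : M m `^ p = m%:R.
Proof. by rewrite -powRrM mulVf ?powRr1// gt_eqF. Qed.

Lemma powR_cvg (a : nat -> R) (l : R) : 0 < l -> a @ \oo --> l ->
  (fun i => a i `^ p) @ \oo --> l `^ p.
Proof.
move=> l0 al.
have h : is_derive l 1 (@powR R ^~ p) (p * l `^ (p - 1)) by exact: is_derive1_powR.
have c : {for l, continuous (@powR R ^~ p)}.
  by have [dl _] := h; apply: differentiable_continuous; exact/derivable1_diffP.
exact: (cvg_comp a (@powR R ^~ p) al c).
Qed.

Lemma nat_cvg_cst (a : nat -> nat) (l : R) : (fun i => (a i)%:R : R) @ \oo --> l ->
  exists N, forall i, (N <= i)%N -> a i = a N.
Proof.
have h2 : 0 < 1 / 2 :> R by rewrite divr_gt0.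
move=> /cvgrPdist_lt /(_ _ h2)[N _ hN]; exists N => i Ni.
have h1 := hN i Ni; have h3 := hN N (leqnn N); rewrite /= in h1 h3.
have h : `|(a i)%:R - (a N)%:R : R| < 1.
  rewrite (_ : _ - _ = (l - (a N)%:R) - (l - (a i)%:R)); last by ring.
  by apply: (le_lt_trans (ler_normB _ _)); lra.
have : (a i)%:Z - (a N)%:Z = 0 by apply: (@int_lt1 R); rewrite intrB.
by move/eqP; rewrite subr_eq0 => /eqP[].
Qed.

(** * The limit at one point x: [z] is f x and [b i] is membership in the i-th coset *)

Section Limit.
Variables (mi : nat -> nat) (b : nat -> bool) (q : nat -> R[i]).
Hypotheses (mi0 : forall i, (0 < mi i)%N) (q1 : forall i, cmod (q i) = 1).

Let e z i := cmod (z - cR (M (mi i)) * cR (b i)%:R * q i).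

Lemma norm_diff_le z i : `|M (mi i) * (b i)%:R - cmod z| <= e z i.
Proof.
have E : cmod (cR (M (mi i)) * cR (b i)%:R * q i) = M (mi i) * (b i)%:R.
  by rewrite cmodM q1 mulr1 -cRM cmod_cR ger0_norm// mulr_ge0.
have t1 := cmod_triB z (cR (M (mi i)) * cR (b i)%:R * q i) 0.
have t2 := cmod_triB (cR (M (mi i)) * cR (b i)%:R * q i) z 0.
rewrite !subr0 E in t1 t2; rewrite cmodBC -/(e z i) in t2.
by rewrite -/(e z i) in t1; rewrite ler_norml; apply/andP; split; lra.
Qed.

Lemma eventually_on z : z != 0 -> e z @ \oo --> 0 -> \forall i \near \oo, b i = true.
Proof.
move=> z0 ez; have cz : 0 < cmod z.
  by rewrite lt_neqAle cmod_ge0 andbT eq_sym; apply: contraNneq z0 => /cmod_eq0 ->.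
have h : \forall i \near \oo, e z i < cmod z by exact: cvgr_lt 0 ez _ cz.
apply: filterS h => i hi.
case bi : (b i) => //; move: hi; have := norm_diff_le z i.
by rewrite bi mulr0 sub0r normrN ger0_norm ?cmod_ge0// leNgt => /negbTE ->.
Qed.

Lemma index_cvg z : z != 0 -> e z @ \oo --> 0 -> (fun i => M (mi i)) @ \oo --> cmod z.
Proof.
move=> z0 ez; apply/cvgrPdist_lt => r r0.
have h1 := eventually_on z0 ez.
have h2 : \forall i \near \oo, e z i < r by exact: cvgr_lt 0 ez _ r0.
apply: filterS2 h1 h2 => i bi; apply: le_lt_trans.
by have := norm_diff_le z i; rewrite bi mulr1 distrC.
Qed.

(** The heights [M (mi i)] converge to |z|, so their p-th powers, the integers [mi i], converge and
    are eventually constant. *)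
Lemma eventually_index z : z != 0 -> e z @ \oo --> 0 ->
  exists m0, (0 < m0)%N /\ \forall i \near \oo, mi i = m0.
Proof.
move=> z0 ez; have cz : 0 < cmod z.
  by rewrite lt_neqAle cmod_ge0 andbT eq_sym; apply: contraNneq z0 => /cmod_eq0 ->.
have := powR_cvg cz (index_cvg z0 ez).
have -> : (fun i => M (mi i) `^ p) = (fun i => (mi i)%:R) by apply/funext => i; exact: Mp.
by move=> /nat_cvg_cst[N hN]; exists (mi N); split => //; exists N.
Qed.

Variable m0 : nat.
Hypotheses (m00 : (0 < m0)%N) (mim0 : \forall i \near \oo, mi i = m0).

Let Mpos : 0 < M m0. Proof. by rewrite powR_gt0// ltr0n. Qed.

Lemma eventually_off z : z = 0 -> e z @ \oo --> 0 -> \forall i \near \oo, b i = false.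
Proof.
move=> -> ez; have h : \forall i \near \oo, e 0 i < M m0 by exact: cvgr_lt 0 ez _ Mpos.
apply: filterS2 mim0 h => i mi_ hi; apply/negP => bi.
have := norm_diff_le 0 i; rewrite cmod0 subr0 bi mulr1 mi_ ger0_norm// leNgt.
by rewrite hi.
Qed.

Lemma limit_norm z : z != 0 -> e z @ \oo --> 0 -> cmod z = M m0.
Proof.
move=> z0 ez; apply: (cvg_unique _ (index_cvg z0 ez)) => //.
by apply: cvg_near_cst; apply: filterS mim0 => i ->.
Qed.

Lemma limit_phase z : z != 0 -> e z @ \oo --> 0 ->
  (fun i => cmod (q i - ph z)) @ \oo --> 0.
Proof.
move=> z0 ez; have -> : 0 = (M m0)^-1 * 0 :> R by rewrite mulr0.
have h : (fun i => (M m0)^-1 * e z i) @ \oo --> (M m0)^-1 * 0 by apply: cvgMr.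
apply: cvg_trans h; apply: near_eq_cvg.
have h1 := eventually_on z0 ez.
apply: filterS2 mim0 h1 => i mi_ bi.
rewrite /e bi mi_ cR1 mulr1 -{1}(phK z) (limit_norm z0 ez) -mulrBr cmodM cmod_cR.
by rewrite gtr0_norm// mulKf ?gt_eqF// cmodBC.
Qed.

End Limit.
End PointwiseLimit.

Section Systems.
Context {d : measure_display} {X : measurableType d} {R : realType}.
Variables (mu : probability X R) (T Ti : X -> X).

Lemma ergodic_systemP : ergodic_system mu T Ti -> mps mu T Ti /\ ergodic mu Ti.
Proof.
move=> [mT mTi [K1 K2] pres erg]; split => // g bg inv.
have mg : cmeasurable (fun x => cR (g x)) := bmc_cmeas (bmc_cR bg).
have [||c hc] := erg _ mg.
- have bg2 : bm (fun x => cmod (cR (g x)) ^+ 2).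
    by have := bmc_cR bg => b; bmct.
  by rewrite -EFin_Ex// ltry.
- by apply: filterS inv => x ->.
- by exists (complex.Re c); apply: filterS hc => x <-.
Qed.

(** The p-th powers of the errors have summable integrals; capping them at 1 stays within bounded
    functions and does not affect convergence to 0. *)
Lemma fast_cvg_ae (p : R) (f : X -> R[i]) (g : nat -> X -> R[i]) : 1 <= p ->
  cmeasurable f -> (forall i, bmc (g i)) ->
  (forall i, (pint mu p (fun x => (f x - g i x)%R) <= ((1 / 2) ^+ i)%:E)%E) ->
  {ae mu, forall x, (fun i => cmod (f x - g i x)) @ \oo --> 0}.
Proof.
move=> p1 mf bg small; have p0 : 0 < p by exact: lt_le_trans p1.
pose h i x := Num.min 1 (cmod (f x - g i x) `^ p).
have mfg i : cmeasurable (fun x => f x - g i x) by apply: cmeasB => //; exact: bmc_cmeas.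
have h0 i x : 0 <= h i x by rewrite le_min ler01 powR_ge0.
have h1 i x : h i x <= 1 by rewrite ge_min lexx.
have mfp i : measurable_fun setT (fun x => cmod (f x - g i x) `^ p).
  exact: (measurableT_comp (measurable_powR p) (cmeas_cmod (mfg i))).
have bh i : bm (h i).
  split; first exact: measurable_minr (measurable_cst _) (mfp i).
  by exists 1 => x; rewrite ger0_norm.
have Eh i : Ex mu (h i) <= (1 / 2) ^+ i.
  rewrite -lee_fin EFin_Ex//; apply: le_trans (small i).
  have hs x : setT x -> (0 <= (h i x)%:E)%E by rewrite lee_fin.
  have mh : measurable_fun setT (fun x => (h i x)%:E) by apply/measurable_EFinP; exact: (bh i).1.
  apply: (@ge0_le_integral _ X R mu setT measurableT _ _ hs mh (measurable_cpow p (mfg i))).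
  by move=> x _; rewrite lee_fin ge_min lexx orbT.
have [C hC] : exists C, forall n, \sum_(0 <= i < n) Ex mu (h i) <= C.
  exists 2 => n; apply: (@le_trans _ _ (\sum_(0 <= i < n) (1 / 2) ^+ i)).
    by apply: ler_sum => i _.
  have -> : \sum_(0 <= i < n) (1 / 2) ^+ i = 2 - 2 * (1 / 2) ^+ n :> R.
    elim: n => [|n IH]; first by rewrite big_geq// expr0; ring.
    by rewrite big_nat_recr//= IH exprS; lra.
  by rewrite lerBlDr lerDl mulr_ge0// exprn_ge0// divr_ge0.
have := summable_ae bh h0 hC; apply: filterS => x cv.
have h_0 := cvg_series_cvg_0 cv.
apply/cvgrPdist_lt => r r0; pose r1 : R := Num.min 1 (r `^ p).
have r10 : 0 < r1 by rewrite lt_min ltr01 powR_gt0.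
have hlt : \forall i \near \oo, h i x < r1 by exact: cvgr_lt 0 h_0 _ r10.
apply: filterS hlt => i hi /=.
rewrite sub0r normrN ger0_norm ?cmod_ge0// ltNge; apply/negP => rc.
move: hi; rewrite ltNge => /negP; apply; rewrite /r1 /h le_min !ge_min lexx /=.
by rewrite (le_powR p1) ?orbT// (ltW r0).
Qed.

End Systems.

Section ExactLimit.
Context {d : measure_display} {X : measurableType d} {R : realType}.
Variables (mu : probability X R) (T Ti : X -> X).
Hypothesis HS : mps mu T Ti.

Lemma cmod_cdiff m hs (q : X -> R[i]) x : (forall x, cmod (q x) = 1) ->
  cmod (cdiff T Ti m hs q x) = 1.
Proof. by move=> q1; elim: hs x => [//|h hs IH] x /=; rewrite cmodM cmodJ !IH mulr1. Qed.

Variables (p : R) (k : nat) (f : X -> R[i]) (Hi : nat -> set X) (mi : nat -> nat)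
  (nui : nat -> probability X R) (qi : nat -> X -> R[i]).
Hypotheses (p1 : 1 <= p) (mf : cmeasurable f)
  (cHi : forall i, coset mu Ti (Hi i) (mi i))
  (Hnui : forall i, cond_on mu (Hi i) (mi i) (nui i))
  (uqi : forall i, uni (qi i))
  (Pqi : forall i, PP (nui i) (iter (mi i) Ti) k.+1 (qi i)).
Hypothesis cv : {ae mu, forall x, (fun i => cmod (f x -
  cR ((mi i)%:R `^ p^-1) * cR (\1_(Hi i) x) * qi i x)) @ \oo --> 0}.
Hypothesis fn0 : ~ {ae mu, forall x, f x = 0}.

Let err x i := cmod (f x - cR ((mi i)%:R `^ p^-1) * cR (x \in Hi i)%:R * qi i x).
Let mi0 i : (0 < mi i)%N. Proof. by case: (cHi i). Qed.
Let q1 x i : cmod (qi i x) = 1. Proof. by case: (uqi i). Qed.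

Let good : {ae mu, forall x, err x @ \oo --> 0}.
Proof. exact: cv. Qed.

(** The support of the limit: at almost every point, membership in the i-th coset eventually agrees
    with membership in [H]. *)
Let H := [set x | f x != 0].

Let inH x : (x \in H) = (f x != 0).
Proof. by apply/idP/idP; rewrite inE. Qed.

Let mH : measurable H.
Proof.
have -> : H = ~` ((fun x => cmod (f x)) @^-1` [set 0]).
  apply/seteqP; split => x; rewrite /H /= => h.
    by move=> /cmod_eq0 f0; rewrite f0 eqxx in h.
  by apply/eqP => f0; apply: h; rewrite f0 cmod0.
apply: measurableC; rewrite -[X in measurable X]setTI.
exact: (cmeas_cmod mf).
Qed.

Let index_limit : exists m0, (0 < m0)%N /\ \forall i \near \oo, mi i = m0.
Proof.
have [x [gx fx]] : exists x, err x @ \oo --> 0 /\ f x != 0.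
  apply: contrapT => /forallNP no; apply: fn0; apply: filterS good => x gx.
  by apply/eqP; apply: contrapT => /negP fx; apply: (no x).
exact: (eventually_index p1 mi0 (q1 x) fx gx).
Qed.

Section Index.
Variable m0 : nat.
Hypotheses (m00 : (0 < m0)%N) (mim0 : \forall i \near \oo, mi i = m0).

Let on_limit x : err x @ \oo --> 0 -> \forall i \near \oo, (x \in Hi i) = (x \in H).
Proof.
rewrite inH => gx; have [fx|fx] := eqVneq (f x) 0.
  exact: (eventually_off (q1 x) m00 mim0 fx gx).
exact: (eventually_on (q1 x) fx gx).
Qed.

(** At almost every point the identities involve finitely many memberships. Some index i has all of
    them stabilised and [mi i = m0]; the identity for the i-th coset is then the one for [H]. *)
Lemma limit_coset : coset mu Ti H m0.
Proof.
split => //.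
- have inv : {ae mu, forall x, forall i, (iter (mi i) Ti x \in Hi i) = (x \in Hi i)}.
    by apply: ae_foralln => i; have [_ _ h _] := cHi i.
  apply: filterS3 good (ae_Tz HS (- m0%:Z) good) inv => x g1 g2 hi.
  rewrite Tz_natN in g2.
  have [i [[h1 h2] h3]] := filter_ex (filterI (filterI (on_limit g1) (on_limit g2)) mim0).
  by rewrite -h1 -h2 -h3 hi.
- have part : {ae mu, forall x, forall i, (\sum_(j < mi i) (iter j Ti x \in Hi i) = 1)%N}.
    by apply: ae_foralln => i; have [_ _ _ h] := cHi i.
  have gj : {ae mu, forall x, forall j, err (iter j Ti x) @ \oo --> 0}.
    apply: ae_foralln => j; have := ae_Tz HS (- j%:Z) good.
    by apply: filterS => x; rewrite Tz_natN.
  apply: filterS2 gj part => x gx px.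
  have sums n : \forall i \near \oo,
      (\sum_(j < n) (iter j Ti x \in Hi i) = \sum_(j < n) (iter j Ti x \in H))%N.
    elim: n => [|n IH]; first by apply: nearW => i; rewrite !big_ord0.
    apply: filterS2 IH (on_limit (gx n)) => i h1 h2.
    by rewrite !big_ord_recr /= h1 h2.
  have [i [h1 h2]] := filter_ex (filterI (sums m0) mim0).
  by rewrite -h1 -h2 px.
Qed.

(** Products of unimodular functions depend continuously on the factors, so iterated derivatives of
    the [qi i] converge on [H] to those of the phase of f. At a point of the i-th coset they equal
    1, and a point of [H] eventually lies there. *)
Lemma limit_poly : is_poly mu T Ti H m0 k (fun x => carg (uph (f x))).
Proof.
have cH := limit_coset; have [nu Hnu] := cond_exists HS cH.
have HSm := cond_mps HS cH Hnu.
have [bu u1] := uni_uph mf.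
split; first exact: measurable_funS (measurable_carg (bmc_cmeas bu) u1).
have conv hs : {ae nu, forall x, (fun i => cmod (cdiff T Ti m0 hs (qi i) x -
    cdiff T Ti m0 hs (fun x => uph (f x)) x)) @ \oo --> 0}.
  elim: hs => [|h hs IH].
    apply: (ae_cond cH Hnu); apply: filterS good => x gx; rewrite inH => fx /=.
    rewrite uph_ph//; exact: (limit_phase (q1 x) m00 mim0 fx gx).
  apply: filterS2 IH (ae_Tz HSm (- h) IH) => x c1 c2 /=.
  pose D i y := cmod (cdiff T Ti m0 hs (qi i) y - cdiff T Ti m0 hs (fun x => uph (f x)) y).
  have c3 : (fun i => D i (Tz (iter m0 T) (iter m0 Ti) (- h) x) + D i x) @ \oo --> 0.
    by rewrite -[X in _ --> X]addr0; exact: (cvgD c2 c1).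
  apply: (@squeeze_cvgr _ _ _ _ (fun=> 0)
    (fun i => D i (Tz (iter m0 T) (iter m0 Ti) (- h) x) + D i x)) => //; last exact: cvg_cst.
  apply: nearW => i; rewrite /D cmod_ge0 /= Tz_iter mulrN; apply: (le_trans (cmodMB _ _ _ _)).
  - by rewrite cmodJ cmod_cdiff// => y; exact: q1.
  - by rewrite cmod_cdiff.
  - by rewrite -conjcB cmodJ.
move=> hs sz.
have one : {ae mu, forall x, forall i, x \in Hi i -> cdiff T Ti (mi i) hs (qi i) x = 1}.
  apply: ae_foralln => i.
  have := @cdiff_phase _ _ _ _ _ _ HS _ _ (cHi i) _ (Hnui i) 0 hs (qi i) (uqi i).
  by rewrite sz => /(_ (Pqi i))[_ /=]; move=> /(cond_ae (cHi i) (Hnui i)).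
apply: filterS3 good (cond_ae cH Hnu (conv hs)) one => x gx cx ox Hx.
have xH : x \in H by rewrite inE.
have c0 : cmod (1 - cdiff T Ti m0 hs (fun x => uph (f x)) x) = 0.
  apply: (cvg_unique _ _ (cx xH)) => //; apply: cvg_near_cst.
  apply: filterS2 (on_limit gx) mim0 => i h1 h2.
  by rewrite -h2 ox ?h2// h1.
apply: expe_eq1; rewrite expe_idiff.
have -> : (fun y => expe (carg (uph (f y)))) = (fun y => uph (f y)).
  by apply/funext => y; rewrite cargK// u1.
by move/cmod_eq0 : c0 => /eqP; rewrite subr_eq0 => /eqP.
Qed.

Lemma limit_coset_poly :
  {ae mu, forall x, f x = coset_poly_fun mu p H (fun x => carg (uph (f x))) x}.
Proof.
have cH := limit_coset; apply: filterS good => x gx.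
rewrite (coset_poly_funE HS cH) cargK ?cmod_uph// indicE inH.
have [->|fx] := eqVneq (f x) 0; first by rewrite cR0 mulr0 mul0r.
rewrite cR1 mulr1 uph_ph// -{1}(phK (f x)).
by rewrite (limit_norm (q1 x) mim0 fx gx).
Qed.

End Index.

Lemma exact_limit : exists (H : set X) (m : nat) (P : X -> R),
  [/\ is_coset mu Ti H m, is_poly mu T Ti H m k P &
      {ae mu, forall x, f x = coset_poly_fun mu p H P x}].
Proof.
have [m0 [m00 mim0]] := index_limit.
exists H, m0, (fun x => carg (uph (f x))); split.
- exact: (coset_is_coset HS (limit_coset m00 mim0)).
- exact: (limit_poly m00 mim0).
- exact: (limit_coset_poly m00 mim0).
Qed.

End ExactLimit.

Section Extremisers.
Context {d : measure_display} {X : measurableType d} {R : realType}.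
Variables (mu : probability X R) (T Ti : X -> X).
Hypotheses (HS : mps mu T Ti) (erg : ergodic mu Ti).

(** Excludes the zero function as an extremiser; without a point where f is nonzero, the indices
    [mi i] could not be controlled. *)
Lemma ghk_ae0 n (f : X -> R[i]) H m : coset mu Ti H m -> cmeasurable f ->
  {ae mu, forall x, f x = 0} -> ghk mu T Ti n.+2 f = 0.
Proof.
move=> cH mf f0; have [nu Hnu] := cond_exists HS cH.
rewrite /ghk (_ : (fun N => _) = (fun=> 0)); first exact: lim_cst.
apply/funext => N.
have h : {ae mu, forall x, trunc N f x = cR 0 * cR (\1_H x) * 1}.
  by apply: filterS f0 => x fx; rewrite truncE fx cR0 mulr0 !mul0r.
have P1 : PP nu (iter m Ti) n.+2 (fun=> 1 : R[i]).
  by apply: (PP_cst (cond_mps HS cH Hnu)); exact: cmod1.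
have := ghk_coset HS erg cH Hnu (lexx _) (uni_cst cmod1) P1 (bmc_trunc N mf) h.
rewrite (expr0n _ (2 ^ n.+2)) expn_eq0 /= mul0r => /eqP; rewrite expf_eq0 => /andP[_ /eqP].
exact.
Qed.

Lemma extremiser n (f : X -> R[i]) : cmeasurable f -> (pint mu (pk n.+2) f <= 1)%E ->
  ghk mu T Ti n.+2 f = 1 ->
  exists (H : set X) (m : nat) (P : X -> R),
    [/\ is_coset mu Ti H m, is_poly mu T Ti H m n.+1 P &
        {ae mu, forall x, f x = coset_poly_fun mu (pk n.+2) H P x}].
Proof.
move=> mf f1 hf; have p1 : 1 <= pk n.+2 :> R := pk_ge1 n.+1.
have near i : exists y : set X * nat * (probability X R) * (X -> R[i]),
    [/\ coset mu Ti y.1.1.1 y.1.1.2, cond_on mu y.1.1.1 y.1.1.2 y.1.2, uni y.2,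
       PP y.1.2 (iter y.1.1.2 Ti) n.+2 y.2 &
    (pint mu (pk n.+2) (fun x => (f x - cR (y.1.1.2%:R `^ (pk n.+2)^-1) * cR (\1_(y.1.1.1) x) * y.2 x)%R)
      <= ((1 / 2) ^+ i)%:E)%E].
  have di : 0 < (1 / 2) ^+ i :> R by rewrite exprn_gt0// divr_gt0.
  have [eps eps0 inv] := Lp_near_inverse n di.
  have hf' : 1 - eps <= ghk mu T Ti n.+2 f by rewrite hf gerBl ltW.
  have [H [m [nu [q h]]]] := inv d X mu T Ti HS erg f mf f1 hf'.
  by exists (H, m, nu, q).
have [F hF] := choice near.
pose g i x := cR ((F i).1.1.2%:R `^ (pk n.+2)^-1) * cR (\1_(F i).1.1.1 x) * (F i).2 x.
have bg i : bmc (g i) by have [c _ u _ _] := hF i; exact: bmc_coset_phase c u.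
have small i : (pint mu (pk n.+2) (fun x => (f x - g i x)%R) <= ((1 / 2) ^+ i)%:E)%E.
  by have [] := hF i.
apply: (@exact_limit _ _ _ mu T Ti HS (pk n.+2) n.+1 f (fun i => (F i).1.1.1)
  (fun i => (F i).1.1.2) (fun i => (F i).1.2) (fun i => (F i).2)) => //.
- by move=> i; have [] := hF i.
- by move=> i; have [] := hF i.
- by move=> i; have [] := hF i.
- by move=> i; have [] := hF i.
- exact: (fast_cvg_ae p1 mf bg small).
- move=> f0; have [c _ _ _ _] := hF 0%N.
  by move: hf; rewrite (ghk_ae0 n c mf f0) => /esym/eqP; rewrite oner_eq0.
Qed.

Lemma coset_setT : coset mu Ti setT 1.
Proof.
split => //; first by apply: aeW => x; rewrite !in_setT.
by apply: aeW => x; rewrite big_ord1 in_setT.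
Qed.

End Extremisers.

(** * The modulus of near-extremality *)

Section NearExtremisers.
Context {R : realType}.

Definition near_extremal (k : nat) (eps delta : R) : Prop :=
  forall (d : measure_display) (X : measurableType d) (mu : probability X R) (T Ti : X -> X),
    ergodic_system mu T Ti -> forall f : X -> R[i],
    inLp mu (pk k) f -> (cLnorm mu (pk k) f <= 1)%E -> 1 - eps <= ghk mu T Ti k f ->
    exists (H : set X) (m : nat) (P : X -> R),
      [/\ is_coset mu Ti H m, is_poly mu T Ti H m k.-1 P &
          (cLnorm mu (pk k) (fun x => (f x - coset_poly_fun mu (pk k) H P x)%R) <= delta%:E)%E].

Lemma cLnorm_le1 {d : measure_display} {X : measurableType d} (mu : probability X R) n
    (f : X -> R[i]) : (cLnorm mu (pk n.+1) f <= 1)%E -> (pint mu (pk n.+1) f <= 1)%E.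
Proof. by move=> /(cLnorm_le mu (pk_ge1 n) f ler01); rewrite powR1. Qed.

Lemma near_extremal_exists n (delta : R) : 0 < delta ->
  exists2 eps : R, 0 < eps & near_extremal n.+2 eps delta.
Proof.
move=> delta0; have p1 : 1 <= pk n.+2 :> R := pk_ge1 n.+1.
have dp : 0 < delta `^ pk n.+2 by rewrite powR_gt0.
have [eps eps0 inv] := Lp_near_inverse n dp; exists eps => // d X mu T Ti es f [mf _] f1 hf.
have [HS erg] := ergodic_systemP es.
have [H [m [nu [q [cH Hnu uq Pq hq]]]]] := inv d X mu T Ti HS erg f mf (cLnorm_le1 f1) hf.
exists H, m, (fun x => carg (q x)); split.
- exact: (coset_is_coset HS cH).
- exact: (phase_is_poly HS cH Hnu).
- apply/(cLnorm_le mu p1 _ (ltW delta0)); apply: le_trans hq.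
  rewrite le_eqVlt; apply/orP; left; apply/eqP; congr pint; apply/funext => x.
  by rewrite (coset_poly_funE HS cH) cargK//; case: uq.
Qed.

(** The coset X with P = 0 is at distance at most B from any f of norm at most 1. So the infimum
    defining [modulus] is over a nonempty set even when eps is large. *)
Lemma near_extremal_bounded n : exists2 B : R, 0 <= B & forall eps, near_extremal n.+2 eps B.
Proof.
have p1 : 1 <= pk n.+2 :> R := pk_ge1 n.+1; have p0 : 0 < pk n.+2 :> R := pk_gt0 n.+2.
pose C : R := 2 `^ pk n.+2 * (1 + 1).
have C0 : 0 <= C by rewrite mulr_ge0 ?powR_ge0.
exists (C `^ (pk n.+2)^-1) => [|eps d X mu T Ti es f [mf _] f1 _]; first exact: powR_ge0.
have [HS erg] := ergodic_systemP es.
have cT := coset_setT mu Ti.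
exists setT, 1%N, (fun=> 0); split.
- exact: (coset_is_coset HS cT).
- split; first exact: measurable_cst.
  move=> hs sz; apply: aeW => x _; exists 0.
  by elim: hs {sz} x => [//|h hs IH] x /=; rewrite !IH subrr.
apply/(cLnorm_le mu p1 _ (powR_ge0 _ _)).
rewrite -powRrM mulVf ?gt_eqF// powRr1//.
pose g (x : X) : R[i] := - 1.
have mg : cmeasurable g := bmc_cmeas (bmc_cst _).
have -> : (fun x => (f x - coset_poly_fun mu (pk n.+2) setT (fun=> 0) x)%R) = (fun x => f x + g x).
  apply/funext => x; rewrite (coset_poly_funE HS cT) /g indicE in_setT powR1 expe0.
  by rewrite cR1 !mulr1.
apply: (le_trans (pintD mu p1 mf mg)); rewrite /C EFinM EFinD.
apply: lee_wpmul2l; first by rewrite lee_fin powR_ge0.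
apply: leeD; first exact: cLnorm_le1.
rewrite (pint_bmc mu p1 (bmc_cst _)) /g cmodN cmod1 powR1 Ex_cst.
exact: lexx.
Qed.

(* At [eps = 0] the summand [1] only serves to make the infimum be exceeded. *)
Definition modulus (k : nat) (eps : R) : R :=
  inf [set delta | 0 <= delta /\ near_extremal k eps delta] + (if 0 < eps then eps else 1).

Let distances k eps := [set delta : R | 0 <= delta /\ near_extremal k eps delta].

Let distances_ge0 k eps : lbound (distances k eps) 0.
Proof. by move=> x []. Qed.

Let has_inf_distances n eps : has_inf (distances n.+2 eps).
Proof.
by have [B B0 hB] := near_extremal_bounded n; split; [exists B|exists 0; exact: (@distances_ge0 n.+2 eps)].
Qed.

Lemma modulus_ge0 n eps : 0 <= modulus n.+2 eps.
Proof.
apply: addr_ge0; last by have [/ltW|] := ltP 0 eps.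
exact: (lb_le_inf (has_inf_distances n eps).1 (@distances_ge0 n.+2 eps)).
Qed.

Lemma near_extremal_modulus n eps : near_extremal n.+2 eps (modulus n.+2 eps).
Proof.
have e0 : 0 < (if 0 < eps then eps else 1).
  by have [h|h] := ltP 0 eps.
have [delta [_ hd] lt] := inf_adherent e0 (has_inf_distances n eps).
move=> d X mu T Ti es f fL f1 hf; have [H [m [P [h1 h2 h3]]]] := hd d X mu T Ti es f fL f1 hf.
by exists H, m, P; split => //; apply: (le_trans h3); rewrite lee_fin ltW.
Qed.

(** A distance admissible at some eps is admissible at every smaller one, so [near_extremal_exists]
    at one eps bounds the infimum on a whole right neighbourhood of 0. *)
Lemma modulus_cvg n : modulus n.+2 e @[e --> 0^'+] --> (0 : R).
Proof.
apply/cvgrPdist_le => r r0; have r2 : 0 < r / 2 by rewrite divr_gt0.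
have [eps eps0 heps] := near_extremal_exists n r2.
near=> e.
have e0 : 0 < e by near: e; exact: nbhs_right_gt.
have ee : e <= eps by near: e; exact: nbhs_right_le.
have er : e <= r / 2 by near: e; exact: nbhs_right_le.
rewrite sub0r normrN ger0_norm ?modulus_ge0// /modulus e0.
suff h : inf (distances n.+2 e) <= r / 2 by rewrite (splitr r); exact: lerD.
apply: ge_inf; first exact: (has_inf_distances n e).2.
split; first exact: ltW.
move=> d X mu T Ti es f fL f1 hf; apply: (heps d X mu T Ti es f fL f1).
by apply: le_trans hf; rewrite lerD2l lerN2.
Unshelve. all: by end_near.
Qed.

End NearExtremisers.

Theorem theorem1p19 (R : realType) (k : nat) (hk : (2 <= k)%N) :
  (* (1) extremisers *)
  (forall (d : measure_display) (X : measurableType d)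
          (mu : probability X R) (T Tinv : X -> X),
     ergodic_system mu T Tinv ->
     forall f : X -> R[i],
       inLp mu (pk k) f -> (cLnorm mu (pk k) f <= 1)%E ->
       (ghk mu T Tinv k f = 1 <->
        exists (H : set X) (m : nat) (P : X -> R),
          [/\ is_coset mu Tinv H m, is_poly mu T Tinv H m k.-1 P &
              {ae mu, forall x, f x = coset_poly_fun mu (pk k) H P x}]))
  /\
  (* (2) near-extremisers *)
  (exists c : R -> R,
     [/\ (forall e, 0 <= e -> 0 <= c e),
         c e @[e --> 0^'+] --> 0 &
         forall (d : measure_display) (X : measurableType d)
                (mu : probability X R) (T Tinv : X -> X),
           ergodic_system mu T Tinv ->
           forall f : X -> R[i],
             inLp mu (pk k) f -> (cLnorm mu (pk k) f <= 1)%E ->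
             forall eps : R, 0 <= eps ->
               1 - eps <= ghk mu T Tinv k f ->
               exists (H : set X) (m : nat) (P : X -> R),
                 [/\ is_coset mu Tinv H m, is_poly mu T Tinv H m k.-1 P &
                     (cLnorm mu (pk k)
                        (fun x => (f x - coset_poly_fun mu (pk k) H P x)%R)
                      <= (c eps)%:E)%E]]).
Proof.
case: k hk => [//|[//|n]] _; split.
- move=> d X mu T Ti es f [mf _] f1; have [HS erg] := ergodic_systemP es.
  split=> [hf|[H [m [P [cH hP hf]]]]]; first exact: (extremiser HS erg mf (cLnorm_le1 f1) hf).
  exact: (ghk_coset_poly HS erg cH hP mf hf).
- exists (modulus n.+2); split.
  + by move=> e _; exact: modulus_ge0.
  + exact: modulus_cvg.
  + move=> d X mu T Ti es f fL f1 eps _ hf.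
    exact: (near_extremal_modulus es fL f1 hf).
Qed.
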